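(* Assume the parameter conditions and notation given in the context. Let $r\in(0,r_0)$ and $W_r^h:=\{(w_h,\phi_h)\in\mathbf H_h:\ \|(w_h,\phi_h)\|_{\mathbf H}\le r\}$, and assume that the data satisfy $$ r\,C_{\mathcal A}(1+r\,\widetilde C_{\mathcal B})\,|\alpha|\,|g|+\widetilde C_{\mathcal B}\,\|\varphi_D\|_{1/2,\Gamma_D}\ \le\ r .$$ Then the discrete problem: find $(\vec\xi_h,\varphi_h)\in\mathbb H_h\times\mathbf H_h^{\varphi}$, $\vec\xi_h=(t_h,\sigma_h,u_h)$, with $\varphi_h|_{\Gamma_D}=\varphi_{D,h}$, such that $$\mathbf A_{\varphi_h}(\vec\xi_h,\vec\eta_h)+\mathbf B_{u_h}(\vec\xi_h,\vec\eta_h)=F_{\varphi_h}(\vec\eta_h)\quad\forall\,\vec\eta_h\in\mathbb H_h,\qquad \mathbf C(\varphi_h,\psi_h)=G_{u_h,\varphi_h}(\psi_h)\quad\forall\,\psi_h\in\mathbf H^{\varphi}_{h,\Gamma_D},$$ has at least one solution $(\vec\xi_h,\varphi_h)$ with $(u_h,\varphi_h)\in W_r^h$, and there hold $$\|\vec\xi_h\|_{\mathbb H}\le C_{\mathcal A}\,r\,|\alpha|\,|g|\qquad\text{and}\qquad\|\varphi_h\|_{1,\Omega}\le\widetilde C_{\mathcal B}\big\{r\,\|u_h\|_{1,\Omega}+\|\varphi_D\|_{1/2,\Gamma_D}\big\}.$$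
   Context: Domain and notation. $n\in\{2,3\}$; $\Omega\subset\mathbb R^n$ is a bounded domain with polygonal/polyhedral boundary $\Gamma$; $\Gamma_D,\Gamma_N\subseteq\Gamma$, $\Gamma_D\cap\Gamma_N=\varnothing$, $|\Gamma_D|>0$, $\Gamma=\overline\Gamma_D\cup\overline\Gamma_N$. $\|\cdot\|_{s,\Omega}$, $|\cdot|_{s,\Omega}$ are the norm and seminorm of $H^s(\Omega)$ (also for vectors/tensors). $(\nabla v)_{ij}=\partial v_i/\partial x_j$, $e(v)=\frac12(\nabla v+(\nabla v)^{\mathrm t})$, $\omega(v)=\frac12(\nabla v-(\nabla v)^{\mathrm t})$, $(v\otimes w)_{ij}=v_iw_j$, $\tau^{\mathrm d}=\tau-\frac1n\mathrm{tr}(\tau)\mathbb I$, $\mathbf{div}$ is the row-wise divergence, $\|\tau\|_{\mathbf{div},\Omega}^2=\|\tau\|_{0,\Omega}^2+\|\mathbf{div}\,\tau\|_{0,\Omega}^2$. Spaces. $\mathbb L^2_{\mathrm{tr}}(\Omega)=\{r\in[L^2(\Omega)]^{n\times n}: r^{\mathrm t}=r,\ \mathrm{tr}\,r=0\}$; $\mathbb H_0(\mathbf{div};\Omega)=\{\tau\in[L^2(\Omega)]^{n\times n}:\mathbf{div}\,\tau\in[L^2(\Omega)]^n,\ \int_\Omega\mathrm{tr}\,\tau=0\}$; $\mathbf H_0^1(\Omega)=[H_0^1(\Omega)]^n$; $\mathbf H^1_{\Gamma_D}(\Omega)=\{\psi\in[H^1(\Omega)]^n:\psi|_{\Gamma_D}=0\}$;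 $\mathbb H=\mathbb L^2_{\mathrm{tr}}(\Omega)\times\mathbb H_0(\mathbf{div};\Omega)\times\mathbf H^1_0(\Omega)$ with $\|(r,\tau,v)\|_{\mathbb H}^2=\|r\|_{0,\Omega}^2+\|\tau\|_{\mathbf{div},\Omega}^2+\|v\|_{1,\Omega}^2$; $\mathbf H=\mathbf H_0^1(\Omega)\times[H^1(\Omega)]^n$ with $\|(w,\phi)\|_{\mathbf H}=\|w\|_{1,\Omega}+\|\phi\|_{1,\Omega}$. Data. $\gamma>0$; constant vectors $\alpha,g\in\mathbb R^n$; a diagonal $\mathbb K\in[L^\infty(\Omega)]^{n\times n}$ with $(\mathbb Kx)\cdot x\ge k_0|x|^2$ for all $x\in\mathbb R^n$, $k_0>0$; $\nu:\mathbb R^2\to\mathbb R$ with $0<\nu_1\le\nu\le\nu_2$ and Lipschitz with constant $L_\nu$, where $\nu(\phi):=\nu(\phi_1,\phi_2)$ for a vector function $\phi$; $\varphi_D\in[H^{1/2}(\Gamma_D)]^n$, with $\|\varphi_D\|_{1/2,\Gamma_D}=\inf\{\|\chi\|_{1,\Omega}:\chi\in[H^1(\Omega)]^n,\chi|_{\Gamma_D}=\varphi_D\}$; $E(\varphi_D)\in[H^1(\Omega)]^n$ is the unique extension of $\varphi_D$ attaining this infimum. Forms. For $\phi\in[H^1(\Omega)]^n$, $w\in\mathbf H_0^1(\Omega)$, $\vec\xi=(t,\sigma,u)$, $\vec\eta=(r,\tau,v)$ in $\mathbb H$: $$\begin{aligned}\mathbf A_\phi(\vec\xi,\vec\eta)=&\,2\int_\Omega\nu(\phi)t:\{r-\kappa_3\tau^{\mathrm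 d}\}+\int_\Omega t:\{\tau^{\mathrm d}-\kappa_1e(v)\}-\int_\Omega\sigma^{\mathrm d}:\{r-\kappa_3\tau^{\mathrm d}\}+(1-\kappa_2\gamma)\int_\Omega u\cdot\mathbf{div}\,\tau\\&-\int_\Omega v\cdot\mathbf{div}\,\sigma+\int_\Omega\omega(u):\tau-\int_\Omega\sigma:\omega(v)+\gamma\int_\Omega u\cdot v+\kappa_2\int_\Omega\mathbf{div}\,\sigma\cdot\mathbf{div}\,\tau+\kappa_1\int_\Omega e(u):e(v),\end{aligned}$$ $\mathbf B_w(\vec\xi,\vec\eta)=\int_\Omega(u\otimes w)^{\mathrm d}:\{\kappa_3\tau^{\mathrm d}-r\}$, $F_\phi(\vec\eta)=\int_\Omega(\alpha\cdot\phi)\,g\cdot\{v-\kappa_2\mathbf{div}\,\tau\}$, $\mathbf C(\chi,\psi)=\int_\Omega\mathbb K\nabla\chi:\nabla\psi$, $G_{w,\phi}(\psi)=-\int_\Omega(\nabla\phi)w\cdot\psi$. Parameter conditions. $\delta_1\in(0,1/\nu_2)$, $\delta_2\in(0,2/\gamma)$, $\delta_3\in(0,1)$, $\kappa_3\in(0,2\nu_1\delta_1/\nu_2)$, $\kappa_2\in(0,2\delta_2)$, $\kappa_1\in\big(0,2\delta_3(2\nu_1-\kappa_3\nu_2/\delta_1)\big)$. Discrete spaces. $\{\mathcal T_h\}_{h>0}$ is a regular family of triangulations of $\Omega$ by triangles/tetrahedra $K$, $h=\max_K h_K$, with every boundary edge/face contained in $\overline\Gamma_D$ or $\overline\Gamma_N$;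 $k\ge0$ is an integer; $\mathbf{RT}_k(K)=[P_k(K)]^n\oplus P_k(K)x$. $\mathbb H_h^t=\{r_h\in\mathbb L^2_{\mathrm{tr}}(\Omega): r_h|_K\in[P_k(K)]^{n\times n}\ \forall K\}$; $\mathbf H_h^\sigma=\{\tau_h\in\mathbb H_0(\mathbf{div};\Omega):$ each row of $\tau_h|_K$ lies in $\mathbf{RT}_k(K)\ \forall K\}$; $\mathbf H_h^u=\{v_h\in[C(\overline\Omega)]^n: v_h|_K\in[P_{k+1}(K)]^n\ \forall K,\ v_h=0\text{ on }\Gamma\}$; $\mathbf H_h^\varphi=\{\psi_h\in[C(\overline\Omega)]^n:\psi_h|_K\in[P_{k+1}(K)]^n\ \forall K\}$; $\mathbf H^\varphi_{h,\Gamma_D}=\{\psi_h\in\mathbf H_h^\varphi:\psi_h|_{\Gamma_D}=0\}$; $\mathbb H_h=\mathbb H_h^t\times\mathbf H_h^\sigma\times\mathbf H_h^u$; $\mathbf H_h=\mathbf H_h^u\times\mathbf H_h^\varphi$. $\mathcal I_h^{SZ}:[H^1(\Omega)]^n\to\mathbf H_h^\varphi$ is the Scott–Zhang interpolation operator of degree $k+1$ (chosen so that $\mathcal I_h^{SZ}(v)|_{\Gamma_D}$ depends only on $v|_{\Gamma_D}$), and $\varphi_{D,h}:=\mathcal I_h^{SZ}(E(\varphi_D))|_{\Gamma_D}$. Constants. $c_1(\Omega)=\|i\|^2$ with $i:[H^1(\Omega)]^n\to[L^4(\Omega)]^n$ the Sobolev embedding; $\alpha(\Omega)>0$ is a constant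 with $\mathbf A_\phi(\vec\xi,\vec\xi)\ge\alpha(\Omega)\|\vec\xi\|_{\mathbb H}^2$ for all $\vec\xi\in\mathbb H$ and $\phi\in[H^1(\Omega)]^n$ (it exists under the parameter conditions); $r_0=\alpha(\Omega)/(2c_1(\Omega)(2+\kappa_3^2)^{1/2})$; $C_{\mathcal A}=2\sqrt2(2+\kappa_2^2)^{1/2}/\alpha(\Omega)$; $c_{\rm gp}$ is the Poincaré constant, $\|\psi\|_{1,\Omega}\le c_{\rm gp}|\psi|_{1,\Omega}$ on $\mathbf H^1_{\Gamma_D}(\Omega)$; $\widetilde\alpha=k_0c_{\rm gp}^{-2}$; $\widetilde c>0$ is a constant, independent of $h$, with $\|\mathcal I_h^{SZ}(v)\|_{1,\Omega}\le\widetilde c\|v\|_{1,\Omega}$ for all $v\in[H^1(\Omega)]^n$; $\widetilde C_{\mathcal B}=\max\{\widetilde\alpha^{-1}c_1(\Omega),\ \widetilde c\,(\widetilde\alpha^{-1}\|\mathbb K\|_{\infty,\Omega}+1)\}$. *)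

(* Defs.v *)
(* Functions on Omega are represented by total functions on
   R^n whose values outside Omega are irrelevant, and elements of L^2-type
   spaces by Borel measurable representatives. *)
From HB Require Import structures.
From mathcomp Require Import all_boot all_order all_algebra.
From mathcomp Require Import all_classical all_reals all_analysis.
Set Implicit Arguments.
Unset Strict Implicit.
Unset Printing Implicit Defensive.
Import Order.TTheory GRing.Theory Num.Theory.
Import numFieldNormedType.Exports.
Local Open Scope classical_set_scope.
Local Open Scope ring_scope.

(* The sigma-algebra generated by the entries; for T = R it is the Borel one. *)
Section matrix_measurable.
Context (d : measure_display) (T : measurableType d) (p q : nat).

Definition mx_cylinders : set_system 'M[T]_(p, q) :=
  [set A | exists i j (B : set T),
     measurable B /\ A = (fun M : 'M[T]_(p, q) => M i j) @^-1` B].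

Definition mx_display : measure_display.
Proof. by constructor. Qed.

Let mx0 : <<s mx_cylinders >> set0.
Proof. exact: sigma_algebra0. Qed.

Let mxC A : <<s mx_cylinders >> A -> <<s mx_cylinders >> (~` A).
Proof. exact: sigma_algebraC. Qed.

Let mxU (F : (set 'M[T]_(p, q))^nat) :
  (forall i, <<s mx_cylinders >> (F i)) -> <<s mx_cylinders >> (\bigcup_i F i).
Proof. exact: sigma_algebra_bigcup. Qed.

HB.instance Definition _ := @isMeasurable.Build mx_display 'M[T]_(p, q)
  <<s mx_cylinders >> mx0 mxC mxU.

End matrix_measurable.

Lemma measurable_mx (d d' : measure_display) (X : measurableType d)
    (T : measurableType d') (p q : nat) (f : X -> 'M[T]_(p, q)) :
  (forall i j, measurable_fun [set: X] (fun x => f x i j)) ->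
  measurable_fun [set: X] f.
Proof.
move=> mf; apply: (@measurability _ _ _ _ _ _ (@mx_cylinders _ T p q)) => //.
move=> _ [_ [i [j [B [mB ->]]]] <-].
exact: (mf i j measurableT B mB).
Qed.

Lemma measurable_entry (d : measure_display) (T : measurableType d) (p q : nat)
    (i : 'I_p) (j : 'I_q) :
  measurable_fun [set: 'M[T]_(p, q)] (fun M : 'M[T]_(p, q) => M i j).
Proof.
move=> _ B mB; rewrite setTI; apply: sub_sigma_algebra.
by exists i, j, B.
Qed.

(* Lebesgue measure on R^n: (x, s) |-> (s, x) carries lambda^n x lambda to
   lambda^(n+1). *)
Section lebesgue_rV.
Context (R : realType).

Definition cons_rV (n : nat) (p : 'rV[R]_n * R) : 'rV[R]_n.+1 :=
  row_mx (p.2%:M : 'rV[R]_1) p.1.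

Lemma measurable_cons_rV (n : nat) :
  measurable_fun [set: ('rV[R]_n * R)%type] (@cons_rV n).
Proof.
apply: measurable_mx => i j; rewrite /cons_rV.
case: (split_ordP (j : 'I_(1 + n))) => k -> /=.
  under eq_fun do rewrite (row_mxEl (_ : 'rV_1) (_ : 'rV_n)) mxE !ord1 eqxx mulr1n.
  exact: measurable_snd.
under eq_fun do rewrite (row_mxEr (_ : 'rV_1) (_ : 'rV_n)).
exact: measurableT_comp (measurable_entry _ _) measurable_fst.
Qed.

Definition leb_succ (n : nat) (m : {measure set 'rV[R]_n -> \bar R}) :
    set 'rV[R]_n.+1 -> \bar R :=
  pushforward (m \x @lebesgue_measure R)%E (@cons_rV n).

Section leb_succ_measure.
Variables (n : nat) (m : {measure set 'rV[R]_n -> \bar R}).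

Let mc := @measurable_cons_rV n.

Let leb_succ0 : leb_succ m set0 = 0%E.
Proof. by rewrite /leb_succ /pushforward preimage_set0 measure0. Qed.

Let leb_succ_ge0 A : (0 <= leb_succ m A)%E.
Proof. exact: measure_ge0. Qed.

Let leb_succ_sigma_additive : semi_sigma_additive (leb_succ m).
Proof.
exact (@measure_semi_sigma_additive _ _ _
  (measure_function_pushforward__canonical__measure_function_Measure
    (m \x @lebesgue_measure R)%E mc)).
Qed.

HB.instance Definition _ := isMeasure.Build _ _ _ (leb_succ m)
  leb_succ0 leb_succ_ge0 leb_succ_sigma_additive.

End leb_succ_measure.

Fixpoint leb (n : nat) : {measure set 'rV[R]_n -> \bar R} :=
  if n is n'.+1 then leb_succ (leb n') else dirac (0 : 'rV[R]_0).

End lebesgue_rV.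
Arguments leb {R} n.

(* Euclidean structure of R^(p x q); the library norm of matrices is the
   maximum norm. *)
Section euclidean.
Context {R : realType}.

Definition frob {p q : nat} (A B : 'M[R]_(p, q)) : R :=
  \sum_i \sum_j A i j * B i j.

Definition enorm {p q : nat} (A : 'M[R]_(p, q)) : R := Num.sqrt (frob A A).

Definition dev {n : nat} (A : 'M[R]_n) : 'M[R]_n := A - (\tr A / n%:R)%:M.

Definition sympart {n : nat} (A : 'M[R]_n) : 'M[R]_n := 2^-1 *: (A + A^T).

Definition skewpart {n : nat} (A : 'M[R]_n) : 'M[R]_n := 2^-1 *: (A - A^T).

(* Vectors are rows, so that u^T w has entries u_i w_j. *)
Definition tens {n : nat} (u w : 'rV[R]_n) : 'M[R]_n := u^T *m w.

(* (A w)_i = sum_j A_ij w_j for the row vector w. *)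
Definition mxapp {n : nat} (A : 'M[R]_n) (w : 'rV[R]_n) : 'rV[R]_n :=
  w *m A^T.

End euclidean.

Section sobolev.
Context {R : realType} {n : nat}.
Implicit Types (Omega : set 'rV[R]_n).

Definition L2 Omega {p q : nat} (f : 'rV[R]_n -> 'M[R]_(p, q)) : Prop :=
  forall i j, measurable_fun Omega (fun x => f x i j) /\
    (leb n).-integrable Omega (fun x => (f x i j ^+ 2)%:E).

Definition L2norm Omega {p q : nat} (f : 'rV[R]_n -> 'M[R]_(p, q)) : R :=
  Num.sqrt (\int[leb n]_(x in Omega) frob (f x) (f x)).

Definition partials (s : seq 'I_n) (f : 'rV[R]_n -> R) : 'rV[R]_n -> R :=
  foldr (fun j g => 'D_(delta_mx 0 j) g) f s.

Definition smooth (f : 'rV[R]_n -> R) : Prop :=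
  forall s : seq 'I_n, continuous (partials s f) /\
    forall j x, derivable (partials s f) x (delta_mx 0 j).

Definition test_fun Omega (theta : 'rV[R]_n -> R) : Prop :=
  smooth theta /\
  exists K : set 'rV[R]_n, [/\ compact K, K `<=` Omega &
    forall x, ~ K x -> theta x = 0].

Definition is_wgrad Omega {p : nat} (v : 'rV[R]_n -> 'rV[R]_p)
    (G : 'rV[R]_n -> 'M[R]_(p, n)) : Prop :=
  forall i j theta, test_fun Omega theta ->
    \int[leb n]_(x in Omega) (v x 0 i * 'D_(delta_mx 0 j) theta x) =
    - \int[leb n]_(x in Omega) (G x i j * theta x).

Definition is_wdiv Omega (tau : 'rV[R]_n -> 'M[R]_n)
    (d : 'rV[R]_n -> 'rV[R]_n) : Prop :=
  forall i theta, test_fun Omega theta ->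
    \int[leb n]_(x in Omega)
      (\sum_j tau x i j * 'D_(delta_mx 0 j) theta x) =
    - \int[leb n]_(x in Omega) (d x 0 i * theta x).

(* Representatives of the weak gradient and the weak row-wise divergence:
   meaningful when such L^2 fields exist, and then unique a.e. *)
Definition wgrad Omega {p : nat} (v : 'rV[R]_n -> 'rV[R]_p) :
    'rV[R]_n -> 'M[R]_(p, n) :=
  get [set G | L2 Omega G /\ is_wgrad Omega v G].

Definition wdiv Omega (tau : 'rV[R]_n -> 'M[R]_n) : 'rV[R]_n -> 'rV[R]_n :=
  get [set d | L2 Omega d /\ is_wdiv Omega tau d].

Definition H1 Omega {p : nat} (v : 'rV[R]_n -> 'rV[R]_p) : Prop :=
  L2 Omega v /\ exists G, L2 Omega G /\ is_wgrad Omega v G.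

Definition H1semi Omega {p : nat} (v : 'rV[R]_n -> 'rV[R]_p) : R :=
  L2norm Omega (wgrad Omega v).

Definition H1norm Omega {p : nat} (v : 'rV[R]_n -> 'rV[R]_p) : R :=
  Num.sqrt (L2norm Omega v ^+ 2 + H1semi Omega v ^+ 2).

Definition Hdivnorm Omega (tau : 'rV[R]_n -> 'M[R]_n) : R :=
  Num.sqrt (L2norm Omega tau ^+ 2 + L2norm Omega (wdiv Omega tau) ^+ 2).

Definition L4norm Omega {p : nat} (v : 'rV[R]_n -> 'rV[R]_p) : \bar R :=
  Lnorm (leb n) 4%:E ((fun x => (enorm (v x))%:E) \_ Omega).

(* Operator norm of the embedding of [H^1(Omega)]^n in [L^4(Omega)]^n. *)
Definition embnorm Omega : \bar R :=
  ereal_sup [set L4norm Omega v | v in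
    [set v : 'rV[R]_n -> 'rV[R]_n | H1 Omega v /\ H1norm Omega v <= 1]].

Definition Linfty Omega {p q : nat} (K : 'rV[R]_n -> 'M[R]_(p, q)) : Prop :=
  forall i j, measurable_fun Omega (fun x => K x i j) /\
    (Lnorm (leb n) +oo ((fun x => (K x i j)%:E) \_ Omega) < +oo)%E.

Definition Linftynorm Omega {p q : nat} (K : 'rV[R]_n -> 'M[R]_(p, q)) : R :=
  \big[Num.max/0]_i \big[Num.max/0]_j
    fine (Lnorm (leb n) +oo ((fun x => (K x i j)%:E) \_ Omega)).

End sobolev.

(* A simplex with vertices S_0, ..., S_d is the sequence S of its vertices. *)
Section simplices.
Context {R : realType} {n : nat}.
Implicit Types (S : seq 'rV[R]_n).

Definition hull S : set 'rV[R]_n :=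
  [set x | exists l : 'I_(size S) -> R,
    [/\ forall i, 0 <= l i, \sum_i l i = 1 & x = \sum_i l i *: S`_i]].

Definition edge_mx S : 'M[R]_((size S).-1, n) :=
  \matrix_(i, j) (S`_i.+1 - S`_0) 0 j.

Definition affine_indep S : Prop := S <> [::] /\ row_free (edge_mx S).

Definition ref_simplex {d : nat} : set 'rV[R]_d :=
  [set t | (forall i, 0 <= t 0 i) /\ \sum_i t 0 i <= 1].

Definition param S (t : 'rV[R]_(size S).-1) : 'rV[R]_n := S`_0 + t *m edge_mx S.
Arguments param S t : clear implicits.

(* Integral over S with respect to the (size S - 1)-dimensional surface
   measure; sqrt (det (M M^T)) is the area element of t |-> S_0 + t M. *)
Definition simplex_int S (f : 'rV[R]_n -> R) : R :=
  Num.sqrt (\det (edge_mx S *m (edge_mx S)^T)) *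
  \int[leb (size S).-1]_(t in ref_simplex) f (param S t).

Definition simplex_negligible S (N : set 'rV[R]_n) : Prop :=
  (leb (size S).-1).-negligible [set t | ref_simplex t /\ N (param S t)].

Definition diam (A : set 'rV[R]_n) : R :=
  sup [set r | exists x y, [/\ A x, A y & r = enorm (x - y)]].

End simplices.
Arguments param {R n} S t.

Section polyhedral_domain.
Context {R : realType} {n : nat}.
Implicit Types (Omega GD GN : set 'rV[R]_n).

Definition frontier Omega : set 'rV[R]_n := closure Omega `\` interior Omega.

Definition face_in (A : set 'rV[R]_n) (F : seq 'rV[R]_n) : Prop :=
  [/\ size F = n, affine_indep F & hull F `<=` A].

Definition polyhedral Omega : Prop :=
  [/\ open Omega, connected Omega, bounded_set Omega, Omega !=set0 &
    exists s : seq (seq 'rV[R]_n),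
      (forall F, F \in s -> face_in (frontier Omega) F) /\
      frontier Omega = \bigcup_(F in [set` s]) hull F].

Definition boundary_parts Omega GD GN : Prop :=
  [/\ GD `<=` frontier Omega, GN `<=` frontier Omega, GD `&` GN = set0,
    (exists F, face_in (frontier Omega) F /\ ~ simplex_negligible F GD) &
    frontier Omega = closure GD `|` closure GN].

(* g is the trace of v on the (n-1)-simplex F contained in the closure of
   Omega: the pair (v, g) is a limit in H^1(Omega) x L^2(F) of pairs
   (w, w|_F), w in H^1(Omega) and continuous on the closure of Omega. *)
Definition is_trace Omega (F : seq 'rV[R]_n) {p : nat}
    (v g : 'rV[R]_n -> 'rV[R]_p) : Prop :=
  (forall i,
     measurable_fun ref_simplex (fun t => g (param F t) 0 i) /\
     (leb (size F).-1).-integrable ref_simplex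
       (fun t => (g (param F t) 0 i ^+ 2)%:E)) /\
  exists w : nat -> 'rV[R]_n -> 'rV[R]_p,
    [/\ forall m, H1 Omega (w m) /\ {within closure Omega, continuous (w m)},
      (fun m => H1norm Omega (fun x => w m x - v x)) @ \oo --> (0 : R) &
      (fun m => simplex_int F (fun x => enorm (w m x - g x) ^+ 2)) @ \oo -->
        (0 : R)].

(* v|_D = g for D contained in the boundary. *)
Definition trace_on Omega (D : set 'rV[R]_n) {p : nat}
    (v g : 'rV[R]_n -> 'rV[R]_p) : Prop :=
  forall F, face_in (frontier Omega) F ->
    exists gF, is_trace Omega F v gF /\
      simplex_negligible F [set x | D x /\ gF x <> g x].

Definition H1D Omega (D : set 'rV[R]_n) {p : nat} (v : 'rV[R]_n -> 'rV[R]_p) :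
    Prop :=
  H1 Omega v /\ trace_on Omega D v (fun=> 0).

Definition H10 Omega {p : nat} (v : 'rV[R]_n -> 'rV[R]_p) : Prop :=
  H1D Omega (frontier Omega) v.

Definition extensions Omega (D : set 'rV[R]_n) (g : 'rV[R]_n -> 'rV[R]_n) :
    set ('rV[R]_n -> 'rV[R]_n) :=
  [set chi | H1 Omega chi /\ trace_on Omega D chi g].

Definition Hhalf Omega D (g : 'rV[R]_n -> 'rV[R]_n) : Prop :=
  extensions Omega D g !=set0.

Definition Hhalfnorm Omega D (g : 'rV[R]_n -> 'rV[R]_n) : R :=
  inf [set H1norm Omega chi | chi in extensions Omega D g].

Definition is_min_extension Omega D (g E : 'rV[R]_n -> 'rV[R]_n) : Prop :=
  extensions Omega D g E /\ H1norm Omega E = Hhalfnorm Omega D g.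

End polyhedral_domain.

Section continuous_problem.
Context {R : realType} {n : nat}.
Implicit Types (Omega : set 'rV[R]_n).

Definition L2tr Omega (r : 'rV[R]_n -> 'M[R]_n) : Prop :=
  L2 Omega r /\
  {ae leb n, forall x, Omega x -> (r x)^T = r x /\ \tr (r x) = 0}.

Definition H0div Omega (tau : 'rV[R]_n -> 'M[R]_n) : Prop :=
  [/\ L2 Omega tau, exists d, L2 Omega d /\ is_wdiv Omega tau d &
    \int[leb n]_(x in Omega) \tr (tau x) = 0].

Definition triple : Type :=
  (('rV[R]_n -> 'M[R]_n) * ('rV[R]_n -> 'M[R]_n) * ('rV[R]_n -> 'rV[R]_n))%type.

Definition HH Omega (eta : triple) : Prop :=
  let: (r, tau, v) := eta in [/\ L2tr Omega r, H0div Omega tau & H10 Omega v].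

Definition HHnorm Omega (eta : triple) : R :=
  let: (r, tau, v) := eta in
  Num.sqrt (L2norm Omega r ^+ 2 + Hdivnorm Omega tau ^+ 2 + H1norm Omega v ^+ 2).

(* The first two components of a vector of R^n, n >= 2. *)
Definition first_two (y : 'rV[R]_n) : 'rV[R]_2 := y *m pid_mx 2.

Definition form_A Omega (nu : 'rV[R]_2 -> R) (gamma kappa1 kappa2 kappa3 : R)
    (phi : 'rV[R]_n -> 'rV[R]_n) (xi eta : triple) : R :=
  let: (t, sigma, u) := xi in
  let: (r, tau, v) := eta in
  let e w x := sympart (wgrad Omega w x) in
  let omega w x := skewpart (wgrad Omega w x) in
  let div := wdiv Omega in
  2 * (\int[leb n]_(x in Omega)
        (nu (first_two (phi x)) * frob (t x) (r x - kappa3 *: dev (tau x))))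
  + \int[leb n]_(x in Omega) frob (t x) (dev (tau x) - kappa1 *: e v x)
  - \int[leb n]_(x in Omega) frob (dev (sigma x)) (r x - kappa3 *: dev (tau x))
  + (1 - kappa2 * gamma) * (\int[leb n]_(x in Omega) frob (u x) (div tau x))
  - \int[leb n]_(x in Omega) frob (v x) (div sigma x)
  + \int[leb n]_(x in Omega) frob (omega u x) (tau x)
  - \int[leb n]_(x in Omega) frob (sigma x) (omega v x)
  + gamma * (\int[leb n]_(x in Omega) frob (u x) (v x))
  + kappa2 * (\int[leb n]_(x in Omega) frob (div sigma x) (div tau x))
  + kappa1 * (\int[leb n]_(x in Omega) frob (e u x) (e v x)).

Definition form_B Omega (kappa3 : R) (w : 'rV[R]_n -> 'rV[R]_n)
    (xi eta : triple) : R :=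
  let: (t, sigma, u) := xi in
  let: (r, tau, v) := eta in
  \int[leb n]_(x in Omega)
    frob (dev (tens (u x) (w x))) (kappa3 *: dev (tau x) - r x).

Definition form_F Omega (kappa2 : R) (alpha g : 'rV[R]_n)
    (phi : 'rV[R]_n -> 'rV[R]_n) (eta : triple) : R :=
  let: (r, tau, v) := eta in
  \int[leb n]_(x in Omega)
    (frob alpha (phi x) * frob g (v x - kappa2 *: wdiv Omega tau x)).

Definition form_C Omega (K : 'rV[R]_n -> 'M[R]_n)
    (chi psi : 'rV[R]_n -> 'rV[R]_n) : R :=
  \int[leb n]_(x in Omega)
    frob (K x *m wgrad Omega chi x) (wgrad Omega psi x).

Definition form_G Omega (w phi psi : 'rV[R]_n -> 'rV[R]_n) : R :=
  - \int[leb n]_(x in Omega) frob (mxapp (wgrad Omega phi x) (w x)) (psi x).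

End continuous_problem.

Section discrete_spaces.
Context {R : realType} {n : nat}.
Implicit Types (Omega GD GN : set 'rV[R]_n) (T : seq (seq 'rV[R]_n)).

Definition is_poly (k : nat) (f : 'rV[R]_n -> R) : Prop :=
  exists c : {ffun 'I_n -> 'I_k.+1} -> R, forall x,
    f x = \sum_(a : {ffun 'I_n -> 'I_k.+1} | (\sum_i a i <= k)%N)
            c a * \prod_i x 0 i ^+ a i.

Definition is_polymx (k : nat) {p q : nat} (f : 'rV[R]_n -> 'M[R]_(p, q)) :
    Prop :=
  forall i j, is_poly k (fun x => f x i j).

Definition face_of (K F : seq 'rV[R]_n) : Prop :=
  [/\ size F = n, uniq F & {subset F <= K}].

Definition triangulation Omega T : Prop :=
  [/\ forall K, K \in T -> size K = n.+1 /\ affine_indep K,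
    closure Omega = \bigcup_(K in [set` T]) hull K &
    forall K K', K \in T -> K' \in T ->
      hull K `&` hull K' = hull [seq x <- K | x \in K']].

Definition mesh_compatible Omega GD GN T : Prop :=
  forall K F, K \in T -> face_of K F -> hull F `<=` frontier Omega ->
    hull F `<=` closure GD \/ hull F `<=` closure GN.

Definition mesh_size T : R := \big[Num.max/0]_(K <- T) diam (hull K).

Definition shape_regular (s : R) T : Prop :=
  forall K, K \in T -> exists (c : 'rV[R]_n) (rho : R),
    [/\ 0 < rho, [set x | enorm (x - c) <= rho] `<=` hull K &
      diam (hull K) <= s * rho].

Definition regular_family Omega GD GN (hs : set R)
    (Th : R -> seq (seq 'rV[R]_n)) : Prop :=
  (forall h, hs h -> [/\ 0 < h, triangulation Omega (Th h),
     mesh_compatible Omega GD GN (Th h) & mesh_size (Th h) = h]) /\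
  exists s, forall h, hs h -> shape_regular s (Th h).

Definition Ht Omega T (k : nat) (r : 'rV[R]_n -> 'M[R]_n) : Prop :=
  L2tr Omega r /\
  forall K, K \in T -> exists P : 'rV[R]_n -> 'M[R]_n, is_polymx k P /\
    {ae leb n, forall x, hull K x -> r x = P x}.

(* Row i of P + q x is P_i + q_i x. *)
Definition Hsigma Omega T (k : nat) (tau : 'rV[R]_n -> 'M[R]_n) : Prop :=
  H0div Omega tau /\
  forall K, K \in T ->
    exists (P : 'rV[R]_n -> 'M[R]_n) (q : 'rV[R]_n -> 'cV[R]_n),
      [/\ is_polymx k P, is_polymx k q &
        {ae leb n, forall x, hull K x -> tau x = P x + q x *m x}].

Definition Hphi Omega T (k : nat) (psi : 'rV[R]_n -> 'rV[R]_n) : Prop :=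
  {within closure Omega, continuous psi} /\
  forall K, K \in T -> exists P : 'rV[R]_n -> 'rV[R]_n, is_polymx k.+1 P /\
    forall x, hull K x -> psi x = P x.

Definition HphiD Omega GD T (k : nat) (psi : 'rV[R]_n -> 'rV[R]_n) : Prop :=
  Hphi Omega T k psi /\ forall x, GD x -> psi x = 0.

Definition Hu Omega T (k : nat) (v : 'rV[R]_n -> 'rV[R]_n) : Prop :=
  HphiD Omega (frontier Omega) T k v.

Definition HHh Omega T (k : nat) (eta : triple) : Prop :=
  let: (r, tau, v) := eta in
  [/\ Ht Omega T k r, Hsigma Omega T k tau & Hu Omega T k v].

(* Lagrange nodes of degree m of the simplex S. *)
Definition nodes (m : nat) (S : seq 'rV[R]_n) : set 'rV[R]_n :=
  [set x | exists a : 'I_(size S) -> nat,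
    (\sum_i a i = m)%N /\ x = \sum_i ((a i)%:R / m%:R) *: S`_i].

(* Each node a is assigned a simplex S a: the cell whose interior contains a,
   or else a face of the mesh containing a, which lies on the boundary if a
   does (if a is interior to a face, that face is the only one containing a). *)
Definition SZ_choice Omega T (m : nat) (S : 'rV[R]_n -> seq 'rV[R]_n) : Prop :=
  forall a, (exists2 K, K \in T & nodes m K a) ->
    (S a \in T /\ interior (hull (S a)) a) \/
    [/\ forall K, K \in T -> ~ interior (hull K) a,
      exists2 K, K \in T & face_of K (S a),
      hull (S a) a &
      frontier Omega a -> hull (S a) `<=` frontier Omega].

(* psi is the element of the L^2(S)-dual basis of P_m(S) attached to the
   node a. *)
Definition SZ_dual (m : nat) (S : seq 'rV[R]_n) (a : 'rV[R]_n)
    (psi : 'rV[R]_n -> R) : Prop :=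
  is_poly m psi /\
  forall q, is_poly m q -> simplex_int S (fun x => psi x * q x) = q a.

Definition SZ_restriction Omega (S : seq 'rV[R]_n)
    (v g : 'rV[R]_n -> 'rV[R]_n) : Prop :=
  if size S == n.+1 then g = v else is_trace Omega S v g.

(* Scott-Zhang operator of degree k + 1, whose values on GD depend on v|_GD
   only. A function of Hphi is determined by its values at the nodes. *)
Definition scott_zhang Omega GD T (k : nat)
    (I : ('rV[R]_n -> 'rV[R]_n) -> 'rV[R]_n -> 'rV[R]_n) : Prop :=
  (exists S, SZ_choice Omega T k.+1 S /\
    forall v, H1 Omega v -> Hphi Omega T k (I v) /\
      forall a, (exists2 K, K \in T & nodes k.+1 K a) ->
        exists psi g, [/\ SZ_dual k.+1 (S a) a psi,
          SZ_restriction Omega (S a) v g &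
          forall i, I v a 0 i = simplex_int (S a) (fun x => psi x * g x 0 i)]) /\
  forall v w, H1 Omega v -> H1 Omega w ->
    trace_on Omega GD (fun x => v x - w x) (fun=> 0) ->
    forall x, GD x -> I v x = I w x.

End discrete_spaces.

(* Main.v *)
Require Import Defs.
From mathcomp Require Import all_boot all_order all_algebra.
From mathcomp Require Import zify.
Set Implicit Arguments.
Unset Strict Implicit.
Unset Printing Implicit Defensive.

(* Null functions apart, the discrete spaces are finite-dimensional, and the
   coordinates of (xi, phi - E), with E the interpolant of the extended boundary
   datum, range over some R^(d1 + d2). There the residuals of the two equations,
   tested with orthonormal bases, form a continuous vector field. Before they
   enter the coefficients, u and phi are multiplied by r / max(r, |u| + |phi|);
   the terms B, F and G are then dominated on a large sphere by the coercive
   forms A and C, so the field points outward there and has a zero by Brouwer's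
   theorem, itself obtained from Scarf's lemma. Testing the equations with the
   solution gives the two a priori bounds, and these together with the smallness
   of the data give |u| + |phi| <= r, so that the factor is 1.

   The L^4 embedding controls the quadratic terms: |u (x) w|_0 <= c1 |u|_1 |w|_1.
   Bilinearity of the forms rests on the a.e. uniqueness of weak derivatives, and
   coercivity on the discrete functions being H^1 functions with trace equal to
   their restriction. *)

(** * Scarf's lemma and Brouwer's fixed point theorem *)

(** The scaling is needed twice. Coercivity of [form_A] absorbs [form_B] only while the convecting
    velocity has norm at most r, where c1 sqrt(2 + kappa3^2) r <= alpha(Omega)/2; and [form_G]
    tested with phi - E grows cubically, so on a large sphere it would beat the quadratic lower
    bound of [form_C]. With arguments of norm at most r both become harmless, and the factor s stays
    continuous in the coordinates. The factor must not spoil the final estimates either. As s <= 1,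
    one has s|u| <= |u| and s|phi| <= r, hence |G| <= c1 r |u| |psi|: this is the term r|u| of the
    claimed bound, so the bounds of the truncated problem already are those of the theorem. The
    coupled system is treated as a single vector field, so neither equation has to be solved on its
    own. Since fields are total functions and weak derivatives are picked by a choice operator,
    there is no Hilbert space at hand: norms are seminorms on predicates, linearity of the
    derivatives holds almost everywhere, orthonormal families span up to null elements, and the
    residuals must be shown to vanish on null test functions. *)

Section dominance.
Variables (I U : finType) (r : I -> U -> nat).
Hypothesis r_inj : forall i, injective (r i).
Implicit Types (D E : {set U}).

(** Dominance in the sense of Scarf for the orders [r i]: no point lies strictly above the least
    element of D in every order at once. *)
Definition dominant D : bool :=
  [forall y, exists i, [forall x in D, r i y <= r i x]].

Lemma dominantP D :
  reflect (forall y, exists i, forall x, x \in D -> r i y <= r i x) (dominant D).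
Proof.
apply: (iffP forallP) => H y.
  have /existsP[i /forall_inP Hi] := H y.
  by exists i.
by have [i Hi] := H y; apply/existsP; exists i; apply/forall_inP.
Qed.

Lemma sub_dominant D E : E \subset D -> dominant D -> dominant E.
Proof.
move=> /subsetP sED /dominantP dD; apply/dominantP => y.
by have [i Hi] := dD y; exists i => x /sED; exact: Hi.
Qed.

Definition least (x0 : U) D (i : I) : U := [arg min_(x < x0 in D) r i x].

Lemma leastP x0 D i : x0 \in D ->
  least x0 D i \in D /\ forall x, x \in D -> r i (least x0 D i) <= r i x.
Proof. by move=> x0D; rewrite /least; case: arg_minnP. Qed.

(** An element x of D is itself dominated in some order i, and being in D it is then the least
    element of D in that order. So a dominant set has at most as many elements as there are
    orders. *)
Lemma dominant_least_im x0 D : x0 \in D -> dominant D ->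
  [set least x0 D i | i in I] = D.
Proof.
move=> x0D /dominantP dD; apply/setP => x; apply/imsetP/idP.
  by move=> [i _ ->]; have [] := leastP i x0D.
move=> xD; have [i Hi] := dD x; exists i => //.
have [lD lm] := leastP i x0D.
apply: (r_inj (i := i)); apply/eqP; rewrite eqn_leq lm // andbT; exact: Hi.
Qed.

(** The pivot step. With one element fewer than there are orders, exactly one pair of orders a, b
    shares its minimum. A point x whose addition keeps dominance becomes the minimum of exactly one
    order i and changes no other minimum, which forces i to be a or b. Dominance then forces x to be
    the i-greatest among the points above all other minima. The last hypothesis says that such
    points exist. *)
Lemma wall_extensions E : E != set0 -> #|E|.+1 = #|I| -> dominant E ->
  (forall i, exists y, forall k, k != i -> exists2 x, x \in E & r k x < r k y) ->
  #|[set x | x \notin E & dominant (x |: E)]| = 2.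
Proof.
move=> /set0Pn[x0 x0E] cE dE slack.
set m := least x0 E.
have mP i := leastP i x0E.
have mim : [set m i | i in I] = E by exact: dominant_least_im.
have [a [b [ab mab]]] : exists a b, a != b /\ m a = m b.
  have /injectivePn[a [b ab mab]] : ~~ injectiveb m.
    apply/negP => /injectiveP mi.
    have e : #|E| = #|I| by rewrite -mim card_imset.
    by have := ltnn #|E|; rewrite cE e leqnn.
  by exists a, b.
have domE : forall y, exists i, r i y <= r i (m i).
  move/dominantP: (dE) => dE' y; have [i Hi] := dE' y; exists i.
  by apply: Hi; have [] := mP i.
(* Points whose addition leaves the minima of all orders other than i in place. *)
pose M i := [set y | [forall k, (k != i) ==> (r k (m k) < r k y)]].
have MP i y : reflect (forall k, k != i -> r k (m k) < r k y) (y \in M i).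
  by rewrite inE; apply: (iffP forall_inP).
have Mex i : exists y, y \in M i.
  have [y Hy] := slack i; exists y; apply/MP => k ki.
  have [x xE xy] := Hy _ ki; apply: leq_ltn_trans xy.
  by have [_] := mP k; apply.
pose top i := [arg max_(x > xchoose (Mex i) in M i) r i x].
have topP i : top i \in M i /\ forall y, y \in M i -> r i y <= r i (top i).
  by rewrite /top; case: arg_maxnP => //; exact: xchooseP.
have good i j : i != j -> m i = m j ->
    top i \notin E /\ dominant (top i |: E).
  move=> ij mij; have [/MP tM tm] := topP i; split.
    apply/negP; rewrite -mim => /imsetP[k _ tk].
    have [ki|ki] := eqVneq k i; last by have := tM k ki; rewrite tk ltnn.
    have := tM j; rewrite eq_sym ij => /(_ isT).
    by rewrite tk ki mij ltnn.
  apply/dominantP => y; have [/[dup] yM /MP yM'|yM] := boolP (y \in M i).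
    exists i => x; rewrite !inE => /orP[/eqP->|xE]; first exact: tm.
    have [k Hk] := domE y; have [ki|ki] := eqVneq k i.
      by rewrite -ki; apply: leq_trans Hk _; have [_] := mP k; apply.
    by have := yM' k ki; rewrite ltnNge Hk.
  move: yM; rewrite inE negb_forall => /existsP[k].
  rewrite negb_imply -leqNgt => /andP[ki yk]; exists k => x.
  rewrite !inE => /orP[/eqP->|xE]; last first.
    by apply: leq_trans yk _; have [_] := mP k; apply.
  by apply: leq_trans yk _; apply/ltnW/tM.
have -> : [set x | x \notin E & dominant (x |: E)] = [set top a; top b].
  apply/setP => x; rewrite !inE; apply/idP/idP; last first.
    case/orP => /eqP ->; apply/andP; first exact: (good a b).
    by apply: (good b a); rewrite // eq_sym.
  move=> /andP[xE dx].
  have xD : x \in x |: E by rewrite setU11.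
  set m' := least x (x |: E).
  have m'P i := leastP i xD.
  have m'im : [set m' i | i in I] = x |: E by exact: dominant_least_im.
  have m'inj : injective m'.
    have mi : {in I &, injective m'}.
      by apply/imset_injP; rewrite m'im cardsU1 xE /= add1n cE.
    by move=> i j; exact: mi.
  have /imsetP[i _ xi] : x \in [set m' i | i in I] by rewrite m'im.
  have m'E k : k != i -> m' k = m k.
    move=> ki; have [m'D m'le] := m'P k.
    move: m'D; rewrite in_setU1 => /orP[/eqP m'x|m'E].
      by case/negP: ki; apply/eqP/m'inj; exact: etrans m'x xi.
    have [mE mle] := mP k.
    apply: (@r_inj k); apply/eqP; rewrite eqn_leq mle // m'le //.
    by rewrite in_setU1 mE orbT.
  have xM : x \in M i.
    apply/MP => k ki; rewrite -m'E // ltn_neqAle.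
    have [_ -> //] := m'P k; rewrite andbT (inj_eq (@r_inj k)).
    by rewrite xi (inj_eq m'inj).
  have xtop : x = top i.
    have [tM tm] := topP i.
    apply: (@r_inj i); apply/eqP; rewrite eqn_leq tm //=.
    move/dominantP: dx => /(_ (top i)) [k Hk].
    have [ki|ki] := eqVneq k i; first by move: Hk; rewrite ki => -> //; rewrite setU11.
    have [mE _] := mP k.
    by move/MP: tM => /(_ k ki); rewrite ltnNge Hk // in_setU1 mE orbT.
  have [ai|ai] := eqVneq a i; first by rewrite xtop ai eqxx.
  have [bi|bi] := eqVneq b i; first by rewrite xtop bi eqxx orbT.
  by move: ab; rewrite -(inj_eq m'inj) !m'E // mab eqxx.
(* A common value of [top a] and [top b] would lie above the minimum in every order, since a and b
   differ, against dominance of E. *)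
rewrite cards2; case: eqVneq => // tab.
have [/MP tMa _] := topP a; have [/MP tMb _] := topP b.
have [k Hk] := domE (top a).
have [ka|ka] := eqVneq k a.
  by have := tMb k; rewrite -tab ltnNge Hk ka ab => /(_ isT).
by have := tMa k ka; rewrite ltnNge Hk.
Qed.

End dominance.

Section scarf.
Variables (T I : finType) (r : I -> T -> nat) (c : T -> I) (i0 : I) (t0 : T).
Hypothesis r_inj : forall i, injective (r i).

(* One slack point per index i: it lies below everything for order i and above
   all of T for the other orders, so a pair (s, C) with #|s| = #|C| becomes the
   set of the s-points and of the slacks outside C. *)
Definition slack_rank (i : I) (u : T + I) : nat :=
  match u with
  | inl t => (r i t).+1
  | inr j => if j == i then 0 else (\max_t r i t).+2 + enum_rank j
  end.

Definition slack_label (u : T + I) : I :=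
  match u with inl t => c t | inr j => j end.

Lemma slack_rank_inj i : injective (slack_rank i).
Proof.
have bnd t : r i t <= \max_t r i t by apply: (leq_bigmax (F := r i)).
move=> [t|j] [t'|j'] /=.
- by move=> [] /r_inj ->.
- by case: eqP => // _ e; have := bnd t; lia.
- by case: eqP => // _ e; have := bnd t'; lia.
- case: eqP => [->|_]; case: eqP => [->|_] //.
  by move/addnI/ord_inj/enum_rank_inj ->.
Qed.

Lemma slack_rank_lt (i j : I) (t : T) : j != i ->
  slack_rank i (inl t) < slack_rank i (inr j).
Proof.
have : r i t <= \max_t r i t by apply: (leq_bigmax (F := r i)).
by move=> b /negPf ji; rewrite /= ji; lia.
Qed.

Notation dom := (dominant slack_rank).
Notation lab D := (slack_label @: (D : {set T + I})).

(** The doors and rooms of a Sperner-type parity argument. A wall is a dominant set one element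
    short whose labels miss [i0] only; a cell is a full-size dominant set. [E0], made of all slacks
    but that of [i0], is the one door that leads outside. *)
Let walls := [set E : {set T + I} |
  [&& dom E, lab E == [set~ i0] & #|E|.+1 == #|I|]].
Let cells := [set D : {set T + I} | dom D & #|D| == #|I|].

Let E0 : {set T + I} := [set inr j | j in [set~ i0]].

Let E0P u : (u \in E0) = if u is inr j then j != i0 else false.
Proof.
case: u => [t|j]; first by apply/imsetP => -[].
by rewrite mem_imset ?inE // => ? ? [].
Qed.

Let E0_wall : E0 \in walls.
Proof.
rewrite inE; apply/and3P; split.
- apply/dominantP => -[t|j].
    exists i0 => -[t'|j']; rewrite E0P // => j'i; apply: ltnW.
    exact: slack_rank_lt.
  have [->|ji] := eqVneq j i0; first by exists i0 => x _ /=; rewrite eqxx.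
  by exists j => x _ /=; rewrite eqxx.
- apply/eqP/setP => i; rewrite !inE; apply/imsetP/idP => [[u]|ii0].
    by rewrite E0P; case: u => // j ji ->.
  by exists (inr i); rewrite ?E0P.
rewrite card_imset; last by move=> ? ? [].
by rewrite cardsC1 prednK //; apply/card_gt0P; exists i0.
Qed.

(** The slack of [i0] cannot be added: all slacks together have rank 0 each in their own order and
    dominate no point of T. So the new point comes from T, and it must be the greatest one in order
    [i0]. *)
Let E0_ext : #|[set x | x \notin E0 & dom (x |: E0)]| = 1.
Proof.
pose t1 := [arg max_(t > t0) r i0 t].
have t1P t : r i0 t <= r i0 t1 by rewrite /t1; case: arg_maxnP => // ? _; apply.
suff -> : [set x | x \notin E0 & dom (x |: E0)] = [set inl t1] by rewrite cards1.
apply/setP => u; rewrite !inE E0P; apply/andP/eqP => [[uE /dominantP du]|->].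
  have [k Hk] := du (inl t1).
  have ki : k = i0.
    apply/eqP; apply: contraT => ki.
    have := Hk (inr k); rewrite in_setU1 E0P ki orbT => /(_ isT) /=.
    by rewrite eqxx.
  case: u uE du Hk => [t|j] uE du Hk.
    congr inl; apply: (@r_inj i0); apply/eqP; rewrite eqn_leq t1P /=.
    by have := Hk (inl t); rewrite setU11 ki => /(_ isT).
  move: uE => /negPn/eqP ji.
  by have := Hk (inr j); rewrite setU11 ki ji /= eqxx => /(_ isT).
split=> //; apply/dominantP => -[t|j].
  exists i0 => x; rewrite in_setU1 E0P => /orP[/eqP->|]; first exact: t1P.
  by case: x => // j ji; apply/ltnW/slack_rank_lt.
have [->|ji] := eqVneq j i0; first by exists i0 => x _ /=; rewrite eqxx.
by exists j => x _ /=; rewrite eqxx.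
Qed.

(** The slack of i serves as the candidate required by [wall_extensions]: in every order k other
    than i it lies above any point of T and above the slack of k. If E contains no point of T, its
    labels put it inside [E0], and its size makes it equal to [E0]. *)
Let wall_ext E : E \in walls -> E != E0 ->
  #|[set x | x \notin E & dom (x |: E)]| = 2.
Proof.
rewrite inE => /and3P[dE /eqP lE /eqP cE] EE0.
have E0_n0 : E != set0.
  apply: contraNneq EE0 => E_0; rewrite E_0; apply/eqP/esym/eqP.
  rewrite -cards_eq0 -eqSS; move: E0_wall; rewrite inE => /and3P[_ _ /eqP ->].
  by rewrite -cE E_0 cards0.
apply: wall_extensions => // [|i]; first exact: slack_rank_inj.
exists (inr i) => k ki.
have [/existsP[t tE]|] := boolP [exists t, inl t \in E].
  by exists (inl t) => //; apply: slack_rank_lt; rewrite eq_sym.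
rewrite negb_exists => /forallP noT.
exists (inr k); last first.
  by rewrite /= eqxx eq_sym (negPf ki) addSn.
suff EE : E = E0 by rewrite EE eqxx in EE0.
have sub : E \subset E0.
  apply/subsetP => -[t|j] uE; first by have := noT t; rewrite uE.
  rewrite E0P; have : slack_label (inr j) \in lab E by apply: imset_f.
  by rewrite lE !inE.
apply/eqP; rewrite eqEcard sub -ltnS cE.
by move: E0_wall; rewrite inE => /and3P[_ _ /eqP ->]; rewrite leqnn.
Qed.

(** If removing x leaves the labels other than [i0], each exactly once, then the label of x repeats
    that of a single x', since a label [i0] would make D rainbow. Only the removals of x and of x'
    give walls, so there are two such faces or none. *)
Let cell_faces D : D \in cells -> lab D != setT ->
  ~~ odd #|[set x in D | D :\ x \in walls]|.
Proof.
rewrite inE => /andP[dD /eqP cD] nr.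
set S := [set x in D | _].
have [->|/set0Pn[x]] := eqVneq S set0; first by rewrite cards0.
have SP y : y \in S -> y \in D /\ lab (D :\ y) = [set~ i0].
  by rewrite !inE => /andP[-> /and3P[_ /eqP]].
have cDy y : y \in D -> #|D :\ y|.+1 = #|I|.
  by move=> yD; rewrite -cD (cardsD1 y D) yD.
move=> /[dup] xS /SP[xD lx].
have linj y : y \in S -> {in D :\ y &, injective slack_label}.
  move=> /[dup] yS /SP[yD ly]; apply/imset_injP; rewrite ly -eqSS cDy //.
  by rewrite cardsC1 prednK //; apply/card_gt0P; exists i0.
have li0 : slack_label x != i0.
  apply: contraNneq nr => lxi; apply/eqP/setP => i; rewrite inE.
  have [->|ii0] := eqVneq i i0; first by rewrite -lxi imset_f.
  have : i \in lab (D :\ x) by rewrite lx !inE.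
  by move=> /imsetP[y]; rewrite !inE => /andP[_ yD] ->; rewrite imset_f.
have : slack_label x \in lab (D :\ x) by rewrite lx !inE.
move=> /imsetP[x' x'D exx'].
have /andP[x'x x'D'] : (x' != x) && (x' \in D) by move: x'D; rewrite !inE.
suff -> : S = [set x; x'] by rewrite cards2 eq_sym x'x.
apply/setP => y; rewrite in_set2; apply/idP/orP => [yS|[/eqP-> //|/eqP->]].
  have [-> |yx] := eqVneq y x; [by left|right].
  apply: contraT => yx'; have := linj y yS x x'; rewrite !inE xD x'D'.
  rewrite ![_ == y]eq_sym yx yx' => /(_ isT isT exx') /eqP.
  by rewrite eq_sym (negPf x'x).
rewrite !inE x'D' (sub_dominant _ dD) ?subsetDl //= cDy // eqxx andbT.
rewrite -lx; apply/eqP/setP => i; apply/imsetP/imsetP => -[z].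
  rewrite !inE => /andP[zx' zD] ->.
  have [->|zx] := eqVneq z x; first by exists x'.
  by exists z => //; rewrite !inE zx.
rewrite !inE => /andP[zx zD] ->.
have [->|zx'] := eqVneq z x'; first by exists x; rewrite // !inE eq_sym x'x.
by exists z => //; rewrite !inE zx'.
Qed.

Lemma exists_rainbow_dominant : exists2 D, dom D & lab D = setT.
Proof.
have [/existsP[D /andP[]]|] := boolP [exists D, (D \in cells) && (lab D == setT)].
  by rewrite inE => /andP[dD _] /eqP lD; exists D.
rewrite negb_exists => /forallP none.
pose cnt := \sum_(E in walls) #|[set x | x \notin E & dom (x |: E)]|.
(* Counted by walls: [E0] contributes 1 and every other wall 2. *)
have odd_cnt : odd cnt.
  rewrite /cnt (bigD1 E0) //= E0_ext.
  rewrite (eq_bigr (fun=> 2)); last by move=> E /andP[? ?]; exact: wall_ext.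
  by rewrite sum_nat_const muln2 oddD odd_double.
suff : ~~ odd cnt by rewrite odd_cnt.
(* Counted by cells: a pair (E, x) corresponds to the cell D = x |: E, which by assumption is not
   rainbow and so has an even number of wall faces. *)
have -> : cnt = \sum_(D in cells) #|[set x in D | D :\ x \in walls]|.
  rewrite /cnt.
  under eq_bigr do rewrite -sum1_card.
  under [RHS]eq_bigr do rewrite -sum1_card.
  rewrite (exchange_big_dep predT) //= [RHS](exchange_big_dep predT) //=.
  apply: eq_bigr => x _.
  rewrite (reindex_onto (fun D => D :\ x) (fun E => x |: E)) /=; last first.
    by move=> E /andP[_]; rewrite inE => /andP[xE _]; rewrite setU1K.
  apply: eq_bigl => D; rewrite [x \in [set _ | _ & dom _]]inE.
  rewrite [x \in [set x in D | _]]inE setD11 /=.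
  have [xD|xD] := boolP (x \in D); last first.
    rewrite andbF; apply/negP => /andP[_ /eqP e].
    by move: xD; rewrite -e setU11.
  rewrite setD1K // eqxx andbT /=.
  have -> : (D \in cells) = dom D && (#|D| == #|I|) by rewrite inE.
  have [|] := boolP (D :\ x \in walls); last by rewrite andbF.
  rewrite inE => /and3P[_ _]; rewrite (cardsD1 x D) xD add1n => ->.
  by rewrite !andbT.
rewrite (big_morph odd oddD (erefl _)) big1 // => D Dc; apply/negbTE/cell_faces => //.
by have := none D; rewrite Dc.
Qed.

(** Let C collect the indices whose slack is absent from a rainbow dominant set. A slack that is
    present has rank 0 in its own order, so no point of T can be dominated there; the dominating
    index lies in C. Labels in C can only come from points of T. *)
Theorem scarf : exists (s : {set T}) (C : {set I}),
  [/\ C != set0, c @: s = C &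
    forall y, exists2 i, i \in C & forall x, x \in s -> r i y <= r i x].
Proof.
have [D /dominantP dD lD] := exists_rainbow_dominant.
pose s := [set t | inl t \in D]; pose C := [set i | inr i \notin D].
have dC y : exists2 i, i \in C & forall x, x \in s -> r i y <= r i x.
  have [i Hi] := dD (inl y); exists i.
    by rewrite inE; apply/negP => /Hi /=; rewrite eqxx.
  by move=> x; rewrite inE => /Hi.
have sC : C \subset c @: s.
  apply/subsetP => i; rewrite inE => iD.
  have : i \in lab D by rewrite lD inE.
  move=> /imsetP[[t|j] uD /= ei]; last by rewrite ei uD in iD.
  by rewrite ei imset_f // inE.
(* Points labelled outside C are dropped so that the labels are exactly C; a smaller s is still
   dominating. *)
exists (s :&: c @^-1: C), C; split.
- by have [i iC _] := dC t0; apply/set0Pn; exists i.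
- apply/setP => i; apply/imsetP/idP => [[t]|iC].
    by rewrite !inE => /andP[_ ?] ->.
  have /imsetP[t ts ei] := subsetP sC i iC.
  by exists t => //; rewrite !inE in iC ts *; rewrite ts -ei.
move=> y; have [i iC Hi] := dC y; exists i => // x.
by rewrite inE => /andP[xs _]; apply: Hi.
Qed.

End scarf.

(** * Labelled integer points of a simplex *)

Section simplex_grid.
Variables (N m : nat).

Definition grid : predArgType :=
  {x : {ffun 'I_N -> 'I_m.+1} | \sum_i (x i : nat) == m}.

Definition gridco (x : grid) (i : 'I_N) : nat := val x i.

Lemma sum_gridco x : \sum_i gridco x i = m.
Proof. exact/eqP/(valP x). Qed.

Lemma grid_of (f : 'I_N -> nat) : \sum_i f i = m ->
  exists x : grid, forall i, gridco x i = f i.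
Proof.
move=> sf.
have fm i : f i < m.+1 by rewrite -sf (bigD1 i) //= ltnS leq_addr.
pose x : {ffun 'I_N -> 'I_m.+1} := [ffun j => inord (f j)].
have E i : x i = f i :> nat by rewrite ffunE inordK.
have s : \sum_i (x i : nat) == m.
  by rewrite -[X in _ == X]sf; apply/eqP/eq_bigr => i _; rewrite E.
by exists (exist _ x s) => i; rewrite /gridco /= E.
Qed.

(* Ties between equal coordinates are broken by the enumeration of the grid. *)
Definition grid_rank (i : 'I_N) (x : grid) : nat :=
  gridco x i * #|grid| + enum_rank x.

Lemma grid_rank_inj i : injective (grid_rank i).
Proof.
move=> x y /(congr1 (modn^~ #|grid|)).
by rewrite /grid_rank !modnMDl !modn_small //; move/ord_inj/enum_rank_inj.
Qed.

Lemma grid_rank_le i x y : grid_rank i x <= grid_rank i y -> gridco x i <= gridco y i.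
Proof.
rewrite /grid_rank leqNgt => H; rewrite leqNgt; apply: contra H => yx.
apply: (@leq_trans (gridco y i * #|grid| + #|grid|)).
  by rewrite ltn_add2l ltn_ord.
by apply: leq_trans (leq_addr _ _); rewrite -mulSnr leq_mul2r yx orbT.
Qed.

(** Let a i be the least i-th coordinate on the set s of Scarf's lemma. If the numbers a i + 1 over
    C had sum at most m, some grid point would exceed all these minima and escape dominance. Hence
    the minima over C add up to more than m - N. This pins the coordinates of each point of s within
    N of the minima on C, and below N off C, so all points of s are close to one another and carry
    all labels of C. *)
Lemma grid_labelling (c : grid -> 'I_N) (t0 : grid) (i0 : 'I_N) :
  exists x : grid, forall i, gridco x i <= N \/
    exists2 z, c z = i &
      forall j, gridco x j <= gridco z j + N /\ gridco z j <= gridco x j + N.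
Proof.
have [s [C [/set0Pn[i1 i1C] cs dC]]] := scarf c i0 t0 grid_rank_inj.
have [x0 x0s] : exists x, x \in s.
  by move: i1C; rewrite -cs => /imsetP[x xs _]; exists x.
pose l i := [arg min_(x < x0 in s) gridco x i].
have lP i : l i \in s /\ forall x, x \in s -> gridco (l i) i <= gridco x i.
  by rewrite /l; case: arg_minnP.
pose a i := gridco (l i) i.
have big : m < \sum_(i in C) (a i).+1.
  rewrite ltnNge; apply/negP => sm.
  (* The forbidden grid point: one unit above each minimum, with the remaining mass put on [i1], an
     index of C. *)
  pose f i := (if i \in C then (a i).+1 else 0) +
    (if i == i1 then m - \sum_(i in C) (a i).+1 else 0).
  have [|y yf] := @grid_of f.
    by rewrite /f big_split /= -big_mkcond -big_mkcond /= big_pred1_eq subnKC.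
  have [i iC] := dC y; have [ls _] := lP i.
  by move=> /(_ _ ls) /grid_rank_le; rewrite yf /f iC -/(a i); lia.
have big' : m < \sum_(i in C) a i + N.
  apply: leq_trans big _; under eq_bigr do rewrite -addn1.
  by rewrite big_split /= sum1_card leq_add2l -[X in _ <= X]card_ord max_card.
have sumC x : \sum_(i in C) gridco x i <= m.
  by rewrite -[X in _ <= X](sum_gridco x) [X in _ <= X](bigID (mem C)) /= leq_addr.
have upC x i : x \in s -> i \in C -> gridco x i <= a i + N.
  move=> xs iC; have := sumC x; move: big'.
  rewrite (bigD1 i) //= [\sum_(j in C) gridco x j](bigD1 i) //=.
  have : \sum_(j in C | j != i) a j <= \sum_(j in C | j != i) gridco x j.
    by apply: leq_sum => j _; have [_] := lP j; apply.
  have aux p q u v : p <= q -> m < u + p + N -> v + q <= m -> v <= u + N by lia.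
  exact: aux.
have upN x i : x \in s -> i \notin C -> gridco x i <= N.
  move=> xs iC; have : gridco x i + \sum_(j in C) a j <= m.
    rewrite -[X in _ <= X](sum_gridco x) [X in _ <= X](bigD1 i) //= leq_add2l.
    rewrite big_mkcond [X in _ <= X]big_mkcond /=; apply: leq_sum => j _.
    case: ifP => // jC; have [_ /(_ x xs)] := lP j.
    by case: eqVneq => // ji; rewrite -ji jC in iC.
  have aux u v : m < v + N -> u + v <= m -> u <= N by lia.
  exact: aux.
have close x z j : x \in s -> z \in s -> gridco x j <= gridco z j + N.
  move=> xs zs; have [jC|jC] := boolP (j \in C).
    apply: leq_trans (upC _ _ xs jC) _; rewrite leq_add2r.
    by have [_] := lP j; apply.
  by apply: leq_trans (upN _ _ xs jC) _; exact: leq_addl.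
exists x0 => i; have [iC|iC] := boolP (i \in C); last by left; exact: upN.
right; move: iC; rewrite -cs => /imsetP[z zs ->].
by exists z => // j; split; exact: close.
Qed.

End simplex_grid.

From mathcomp Require Import all_classical all_reals all_analysis.
From mathcomp Require Import measurable_realfun ess_sup_inf.
From mathcomp Require Import ring lra.
Import Order.TTheory GRing.Theory Num.Theory.
Import numFieldNormedType.Exports.
Local Open Scope classical_set_scope.
Local Open Scope ring_scope.

(** * Continuity and closed sets for matrix-valued maps *)

Section row_topology.
Context {R : realType}.

Lemma continuous_mx (X : topologicalType) (p q : nat) (f : X -> 'M[R]_(p, q)) :
  (forall i j, continuous (fun x => f x i j)) -> continuous f.
Proof.
move=> cf x; apply/cvg_ballP => e e0.
have H : \forall y \near x, forall ij : 'I_p * 'I_q,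
    ball (f x ij.1 ij.2) e (f y ij.1 ij.2).
  apply: filter_forall => -[i j] /=.
  by have /cvg_ballP /(_ e e0) := cf i j x.
by near=> y; split => // i j; exact: (near H y _ (i, j)).
Unshelve. all: by end_near. Qed.

Lemma entry_le_norm (p q : nat) (x : 'M[R]_(p, q)) i j : `|x i j| <= `|x|.
Proof.
rewrite [leRHS]/Num.Def.normr /= mx_normrE.
exact: (le_bigmax _ (fun ij : 'I_p * 'I_q => `|x ij.1 ij.2|) (i, j)).
Qed.

Lemma norm_mx_le (p q : nat) (x : 'M[R]_(p, q)) e : 0 <= e ->
  (forall i j, `|x i j| <= e) -> `|x| <= e.
Proof.
by move=> e0 H; rewrite /Num.Def.normr /= mx_normrE; apply: bigmax_le => // -[i j] _ /=.
Qed.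

Lemma norm_mx_lt (p q : nat) (x : 'M[R]_(p, q)) e : 0 < e ->
  (forall i j, `|x i j| < e) -> `|x| < e.
Proof.
by move=> e0 H; rewrite /Num.Def.normr /= mx_normrE; apply: bigmax_lt => // -[i j] _ /=.
Qed.

Lemma continuous_entry (X : topologicalType) (p q : nat) (f : X -> 'M[R]_(p, q))
    i j : continuous f -> continuous (fun x => f x i j).
Proof.
move=> cf x; apply: (@continuous_comp _ _ _ f (fun M : 'M[R]_(p, q) => M i j)).
  exact: cf.
exact: coord_continuous.
Qed.

Lemma continuous_compf (X Y Z : topologicalType) (f : X -> Y) (g : Y -> Z) :
  continuous f -> continuous g -> continuous (g \o f).
Proof. by move=> cf cg x; apply: continuous_comp; [exact: cf|exact: cg]. Qed.

Lemma continuous_addf (X : topologicalType) (f g : X -> R) :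
  continuous f -> continuous g -> continuous (fun x => f x + g x).
Proof. by move=> cf cg x; apply: cvgD; [exact: cf|exact: cg]. Qed.

Lemma continuous_subf (X : topologicalType) (f g : X -> R) :
  continuous f -> continuous g -> continuous (fun x => f x - g x).
Proof. by move=> cf cg x; apply: cvgB; [exact: cf|exact: cg]. Qed.

Lemma continuous_mulf (X : topologicalType) (f g : X -> R) :
  continuous f -> continuous g -> continuous (fun x => f x * g x).
Proof. by move=> cf cg x; apply: cvgM; [exact: cf|exact: cg]. Qed.

Lemma continuous_invf (X : topologicalType) (f : X -> R) :
  (forall x, f x != 0) -> continuous f -> continuous (fun x => (f x)^-1).
Proof. by move=> f0 cf x; apply: cvgV; [exact: f0|exact: cf]. Qed.

Lemma continuous_maxf (X : topologicalType) (f g : X -> R) :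
  continuous f -> continuous g -> continuous (fun x => Num.max (f x) (g x)).
Proof.
by move=> cf cg x; apply: (@continuous_max _ _ f g x); [exact: cf|exact: cg].
Qed.

Lemma continuous_sum (X : topologicalType) (I : Type) (s : seq I) (P : pred I)
    (f : I -> X -> R) :
  (forall i, continuous (f i)) -> continuous (fun x => \sum_(i <- s | P i) f i x).
Proof.
move=> cf; elim: s => [|a s IH].
  rewrite (_ : (fun _ => _) = cst 0); first by move=> x; exact: cvg_cst.
  by apply/funext => x; rewrite big_nil.
case Pa: (P a); last first.
  rewrite (_ : (fun _ => _) = (fun x => \sum_(i <- s | P i) f i x)) //.
  by apply/funext => x; rewrite big_cons Pa.
rewrite (_ : (fun _ => _) =
    (fun x => f a x + \sum_(i <- s | P i) f i x)); last first.
  by apply/funext => x; rewrite big_cons Pa.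
by move=> x; apply: cvgD; [exact: cf|exact: IH].
Qed.

Lemma closed_le_fun (X : topologicalType) (f g : X -> R) :
  continuous f -> continuous g -> closed [set x | f x <= g x].
Proof.
move=> cf cg.
rewrite (_ : [set x | _] = (fun x => g x - f x) @^-1` [set y | 0 <= y]).
  apply: closed_comp => [x _|]; last exact: closed_ge.
  by apply: cvgB; [exact: cg|exact: cf].
by apply/seteqP; split=> x /=; rewrite subr_ge0.
Qed.

Lemma closed_eq_fun (X : topologicalType) (f g : X -> R) :
  continuous f -> continuous g -> closed [set x | f x = g x].
Proof.
move=> cf cg.
rewrite (_ : [set x | _] = [set x | f x <= g x] `&` [set x | g x <= f x]).
  by apply: closedI; exact: closed_le_fun.
apply/seteqP; split=> x /=; first by move=> ->.
by move=> [? ?]; apply/eqP; rewrite eq_le; apply/andP.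
Qed.

End row_topology.

(** * Brouwer's theorem on the simplex and for bounded maps *)

Section brouwer.
Context {R : realType}.

Definition std_simplex (N : nat) : set 'rV[R]_N :=
  [set x | (forall i, 0 <= x 0 i) /\ \sum_i x 0 i = 1].

Lemma std_simplex_le1 (N : nat) (x : 'rV[R]_N) i : std_simplex x -> x 0 i <= 1.
Proof.
move=> [x0 x1]; rewrite -x1 (bigD1 i) //= lerDl.
exact: sumr_ge0.
Qed.

Lemma compact_std_simplex (N : nat) : compact (@std_simplex N).
Proof.
apply: bounded_closed_compact.
  exists 1; split; first exact: num_real.
  move=> M M1 x xS; apply: le_trans (ltW M1).
  apply: norm_mx_le => // i j; rewrite ord1 ger0_norm ?std_simplex_le1 //.
  by case: xS => + _; apply.
rewrite (_ : @std_simplex N = (\bigcap_i [set x : 'rV[R]_N | 0 <= x 0 i]) `&`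
    [set x : 'rV[R]_N | \sum_i x 0 i = 1]); last first.
  by apply/seteqP; split => x [x0 x1]; split => // i; [move=> _|]; exact: x0.
apply: closedI.
  apply: closed_bigI => i _; apply: (closed_le_fun (f := cst 0)).
    exact: cst_continuous.
  exact: coord_continuous.
apply: (closed_eq_fun (g := cst 1)); last exact: cst_continuous.
by apply: continuous_sum => i; exact: coord_continuous.
Qed.

Lemma exists_decreasing_coord (N : nat) (x y : 'rV[R]_N) :
  std_simplex x -> std_simplex y -> y <> x -> exists i, y 0 i < x 0 i.
Proof.
move=> [_ x1] [_ y1] yx; apply: contrapT => H; apply: yx.
have {}H i : x 0 i <= y 0 i by rewrite leNgt; apply/negP => ?; apply: H; exists i.
apply/rowP => i; apply/eqP; rewrite eq_le H andbT leNgt; apply/negP => xy.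
suff : \sum_i x 0 i < \sum_i y 0 i by rewrite x1 y1 ltxx.
by rewrite (bigD1 i) // [ltRHS](bigD1 i) //=; apply: ltr_leD => //; apply: ler_sum.
Qed.

Lemma exists_increasing_coord (N : nat) (x y : 'rV[R]_N.+1) :
  std_simplex x -> std_simplex y -> exists i, x 0 i <= y 0 i.
Proof.
move=> xS yS; have [->|/eqP yx] := eqVneq y x; first by exists 0.
have /exists_decreasing_coord : x <> y by move=> /esym.
by move=> /(_ yS xS)[i xi]; exists i; exact: ltW.
Qed.

(** Without a fixed point, every x has a coordinate that strictly decreases under f in a whole
    neighbourhood of x, and compactness makes the size of that neighbourhood uniform. Labelling a
    fine grid by coordinates that do not decrease then produces a grid point near which no
    coordinate decreases by a definite amount. *)
Lemma brouwer_simplex (N : nat) (f : 'rV[R]_N.+1 -> 'rV[R]_N.+1) :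
  continuous f -> (forall x, std_simplex x -> std_simplex (f x)) ->
  exists x, f x = x.
Proof.
move=> cf fS; apply: contrapT => nofix.
have {}nofix x : f x <> x by move=> fx; apply: nofix; exists x.
(* Grid points with denominator m + 1 whose coordinates differ by at most N + 1 units are at this
   distance; N + 1 is the number of coordinates. *)
pose eps (m : nat) : R := N.+1%:R / m.+1%:R.
(* Some coordinate drops by more than [eps m] at every point within [eps m] of x. *)
pose P (m : nat) (x : 'rV[R]_N.+1) := ~ forall i,
  exists z, [/\ `|z - x| <= eps m & z 0 i - eps m <= f z 0 i].
have eps_small (r : R) : 0 < r -> \forall m \near \oo, eps m < r.
  move=> r0; near=> m.
  rewrite /eps ltr_pdivrMr // mulrC -ltr_pdivrMr //.
  apply: (@lt_le_trans _ _ m%:R); last by rewrite ler_nat.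
  near: m; exact: nbhs_infty_gtr.
have : \forall m \near \oo, (@std_simplex N.+1) `<=` P m.
  have /compact_near_coveringP := @compact_std_simplex N.+1; apply => x xS.
  have [i fi] := exists_decreasing_coord xS (fS _ xS) (nofix x).
  pose d := (x 0 i - f x 0 i) / 2.
  have d0 : 0 < d by rewrite divr_gt0 // subr_gt0.
  pose h (z : 'rV[R]_N.+1) := z 0 i - f z 0 i.
  have ch : continuous h.
    apply: continuous_subf; first exact: coord_continuous.
    exact: continuous_entry.
  have : \forall z \near x, d < h z.
    by apply: (cvgr_gt _ (ch x)); rewrite /d /h; lra.
  move=> /nbhs_ballP[r /= r0 Hr].
  exists (ball x (r / 2), [set m | eps m < r / 2 /\ eps m < d]) => /=.
    split; first by apply: nbhsx_ballx; lra.
    by apply: filterI; apply: eps_small; lra.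
  move=> -[y m] /= [yx [m1 m2]] H.
  have [z [zy fz]] := H i.
  have : d < h z.
    apply: Hr; rewrite -ball_normE /= in yx *.
    have -> : x - z = (x - y) - (z - y) by rewrite opprB addrA subrK.
    apply: le_lt_trans (ler_normB _ _) _.
    by rewrite (splitr r); apply: ltr_leD => //; apply: le_trans zy (ltW m1).
  rewrite /h; lra.
move=> [m0 _ Hm].
have {Hm} : (@std_simplex N.+1) `<=` P m0 by apply: Hm => /=.
pose M := m0.+1.
have M0 : 0 < M%:R :> R by rewrite ltr0n.
pose p (x : grid N.+1 M) : 'rV[R]_N.+1 := \row_i ((gridco x i)%:R / M%:R).
have pS x : std_simplex (p x).
  split => [i|]; first by rewrite mxE divr_ge0.
  under eq_bigr do rewrite mxE.
  by rewrite -mulr_suml -natr_sum sum_gridco divff // lt0r_neq0.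
have lab x : exists i, p x 0 i <= f (p x) 0 i.
  by apply: exists_increasing_coord; [exact: pS|exact/fS/pS].
have [c cP] := choice lab.
have [t0 _] : exists x : grid N.+1 M,
    forall i, gridco x i = if i == ord0 then M else 0%N.
  by apply: grid_of; rewrite -big_mkcond big_pred1_eq.
have [x Hx] := grid_labelling c t0 0.
move=> /(_ (p x) (pS x)); apply => i.
have eps0 : 0 <= eps m0 by rewrite divr_ge0.
have [xi|[z cz xz]] := Hx i.
  (* A coordinate of at most [eps m0] cannot drop by more than [eps m0], as f keeps it nonnegative;
     x itself is the witness. *)
  exists (p x); rewrite subrr normr0; split => //.
  apply: (@le_trans _ _ 0); last by case: (fS _ (pS x)) => + _; apply.
  by rewrite subr_le0 mxE ler_pM2r ?invr_gt0 // ler_nat.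
exists (p z); split; last first.
  have := cP z; rewrite cz; apply: le_trans; by rewrite gerBl.
apply: norm_mx_le => // a j; rewrite ord1 !mxE -mulrBl normrM.
rewrite [X in _ * X]gtr0_norm ?invr_gt0 // ler_pM2r ?invr_gt0 //.
rewrite ler_norml lerBrDr lerBlDr addrC lerBlDr -!natrD !ler_nat.
by have [? ?] := xz j; rewrite addnC; apply/andP; split=> //; rewrite addnC.
Unshelve. all: by end_near. Qed.

(** The values of f lie in the cube of half-side M, which [G] places affinely inside the standard
    simplex with left inverse [L]; the fixed point of G f L is mapped back by [L]. The scale c = 2 M
    (d + 1) makes the d image coordinates sum to at most d / (d + 1), leaving room for the slack
    coordinate 0. *)
Theorem brouwer_bounded (d : nat) (f : 'rV[R]_d -> 'rV[R]_d) (M : R) :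
  continuous f -> (forall x i, `|f x 0 i| <= M) -> exists x, f x = x.
Proof.
move=> cf fM; have [M0|M0] := lerP M 0.
  exists 0; apply/rowP => i; rewrite mxE; apply/eqP; rewrite -normr_le0.
  exact: le_trans (fM _ _) M0.
pose c : R := 2 * M * d.+1%:R.
have c0 : 0 < c by rewrite /c !mulr_gt0.
pose L (x : 'rV[R]_d.+1) : 'rV[R]_d := \row_i (c * x 0 (lift ord0 i) - M).
pose G (y : 'rV[R]_d) : 'rV[R]_d.+1 := \row_i
  if unlift ord0 i is Some j then (y 0 j + M) / c
  else 1 - \sum_j (y 0 j + M) / c.
have LG y : L (G y) = y.
  apply/rowP => i; rewrite !mxE liftK mulrC divfK ?addrK //.
  exact: lt0r_neq0.
have cL : continuous L.
  apply: continuous_mx => i j.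
  rewrite (_ : (fun _ => _) = fun x : 'rV[R]_d.+1 => c * x 0 (lift ord0 j) - M).
    apply: continuous_subf; last exact: cst_continuous.
    apply: continuous_mulf; [exact: cst_continuous|exact: coord_continuous].
  by apply/funext => x; rewrite mxE.
have cG : continuous G.
  apply: continuous_mx => i j.
  rewrite (_ : (fun _ => _) = fun y : 'rV[R]_d => if unlift ord0 j is Some k
    then (y 0 k + M) / c else 1 - \sum_k (y 0 k + M) / c); last first.
    by apply/funext => y; rewrite mxE.
  have ck k : continuous (fun y : 'rV[R]_d => (y 0 k + M) / c).
    apply: continuous_mulf; last exact: cst_continuous.
    by apply: continuous_addf; [exact: coord_continuous|exact: cst_continuous].
  case: (unlift ord0 j) => [k|]; first exact: ck.
  apply: continuous_subf; first exact: cst_continuous.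
  exact: (continuous_sum (f := fun k (y : 'rV[R]_d) => (y 0 k + M) / c)).
have [x xfix] : exists x, (G \o f \o L) x = x.
  apply: brouwer_simplex => [|x _].
    by apply: continuous_compf => //; exact: continuous_compf.
  set y := f (L x).
  have yM i : 0 <= y 0 i + M <= 2 * M.
    by have := fM (L x) i; rewrite -/y ler_norml => /andP[? ?]; apply/andP; split; lra.
  have yS : \sum_j (y 0 j + M) / c <= 1.
    rewrite -mulr_suml ler_pdivrMr // mul1r.
    apply: (@le_trans _ _ (\sum_(j < d) 2 * M)).
      by apply: ler_sum => j _; have /andP[] := yM j.
    rewrite sumr_const card_ord -[leLHS]mulr_natr /c ler_pM2l ?mulr_gt0 //.
    by rewrite ler_nat.
  split => [i|]; rewrite /= -/y.
    rewrite mxE; case: unliftP => [j _|_]; last by rewrite subr_ge0.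
    by have /andP[? _] := yM j; apply: divr_ge0 => //; exact: ltW.
  rewrite big_ord_recl mxE unlift_none.
  under [X in _ + X]eq_bigr do rewrite mxE liftK.
  by rewrite subrK.
by exists (L x); rewrite -[in RHS]xfix /= LG.
Qed.

End brouwer.

(** * Semi-inner products and outward vector fields *)

Section semi_inner_product.
Context {R : realType} (V : lmodType R).

(* A symmetric bilinear positive semidefinite form on the subspace S of V;
   nothing is known about its values outside S. *)
Record semi_ip (S : V -> Prop) (ip : V -> V -> R) : Prop := SemiIp {
  sip0 : S 0;
  sipS : forall a u v, S u -> S v -> S (a *: u + v);
  sipC : forall u v, S u -> S v -> ip u v = ip v u;
  sipL : forall a u v w, S u -> S v -> S w ->
    ip (a *: u + v) w = a * ip u w + ip v w;
  sip_ge0 : forall u, S u -> 0 <= ip u u }.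

Variables (S : V -> Prop) (ip : V -> V -> R) (H : semi_ip S ip).

Definition sipn (u : V) : R := Num.sqrt (ip u u).

Lemma sipSD u v : S u -> S v -> S (u + v).
Proof. by move=> su sv; rewrite -[u]scale1r; exact: (sipS H). Qed.

Lemma sipSZ a u : S u -> S (a *: u).
Proof. by move=> su; rewrite -[_ *: _]addr0; apply: (sipS H) => //; exact: (sip0 H). Qed.

Lemma sipS_sum (I : Type) (s : seq I) (P : pred I) (f : I -> V) :
  (forall i, S (f i)) -> S (\sum_(i <- s | P i) f i).
Proof.
move=> Sf; elim/big_ind: _ => //; first exact: (sip0 H).
exact: sipSD.
Qed.

Lemma sipDl u v w : S u -> S v -> S w -> ip (u + v) w = ip u w + ip v w.
Proof. by move=> su sv sw; rewrite -{1}[u]scale1r (sipL H) // mul1r. Qed.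

Lemma sip0l w : S w -> ip 0 w = 0.
Proof.
move=> sw; have s0 := sip0 H; apply: (addrI (ip 0 w)).
by rewrite -sipDl // !addr0.
Qed.

Lemma sipZl a u w : S u -> S w -> ip (a *: u) w = a * ip u w.
Proof.
by move=> su sw; rewrite -[a *: u]addr0 (sipL H) ?sip0l ?addr0 //; exact: (sip0 H).
Qed.

Lemma sip_suml (I : Type) (s : seq I) (P : pred I) (f : I -> V) w :
  (forall i, S (f i)) -> S w ->
  ip (\sum_(i <- s | P i) f i) w = \sum_(i <- s | P i) ip (f i) w.
Proof.
move=> Sf sw; elim: s => [|a s IH]; first by rewrite !big_nil sip0l.
by rewrite !big_cons; case: (P a); rewrite ?sipDl ?IH //; exact: sipS_sum.
Qed.

Lemma sipDr u v w : S u -> S v -> S w -> ip w (u + v) = ip w u + ip w v.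
Proof.
move=> su sv sw; rewrite (sipC H) //; last exact: sipSD.
by rewrite sipDl // (sipC H su sw) (sipC H sv sw).
Qed.

Lemma sipZr a u w : S u -> S w -> ip w (a *: u) = a * ip w u.
Proof.
by move=> su sw; rewrite (sipC H) ?sipZl ?(sipC H su sw) //; exact: sipSZ.
Qed.

Lemma sip_sqr (a : R) u v : S u -> S v ->
  ip (a *: u + v) (a *: u + v) = a ^+ 2 * ip u u + 2 * a * ip u v + ip v v.
Proof.
move=> su sv; have suv : S (a *: u + v) by exact: (sipS H).
rewrite (sipL H) // (sipC H su suv) (sipC H sv suv) !(sipL H) // (sipC H sv su).
ring.
Qed.

Lemma sip_cs u v : S u -> S v -> ip u v ^+ 2 <= ip u u * ip v v.
Proof.
move=> su sv; have uu := sip_ge0 H su; have vv := sip_ge0 H sv.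
have Q a := sip_ge0 H (sipS H a su sv).
have [uu0|uu1] := eqVneq (ip u u) 0.
  suff -> : ip u v = 0 by rewrite expr0n /= mulr_ge0.
  apply/eqP; apply: contraT => uv0.
  (* When ip u u = 0 the square is affine in the coefficient of u; this coefficient gives it the
     value -1. *)
  have := Q (- (ip v v + 1) / (2 * ip u v)).
  rewrite sip_sqr // uu0 mulr0 add0r.
  have -> : 2 * (- (ip v v + 1) / (2 * ip u v)) * ip u v = - (ip v v + 1) by field.
  by move=> ?; exfalso; lra.
(* The minimiser of the quadratic. *)
have := Q (- ip u v / ip u u); rewrite sip_sqr //.
have -> : (- ip u v / ip u u) ^+ 2 * ip u u + 2 * (- ip u v / ip u u) * ip u v +
  ip v v = (ip u u * ip v v - ip u v ^+ 2) / ip u u by field.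
by rewrite pmulr_lge0 ?subr_ge0 // invr_gt0 lt_def uu1.
Qed.

Lemma sipn_ge0 u : 0 <= sipn u.
Proof. exact: sqrtr_ge0. Qed.

Lemma sipn_sqr u : S u -> sipn u ^+ 2 = ip u u.
Proof. by move=> su; rewrite sqr_sqrtr // (sip_ge0 H). Qed.

Lemma sip_csn u v : S u -> S v -> `|ip u v| <= sipn u * sipn v.
Proof.
move=> su sv; rewrite -ler_sqr ?nnegrE ?mulr_ge0 ?sipn_ge0 //.
by rewrite real_normK ?num_real // exprMn !sipn_sqr // sip_cs.
Qed.

Lemma sipnZ a u : S u -> sipn (a *: u) = `|a| * sipn u.
Proof.
move=> su; rewrite /sipn sipZl ?sipZr //; last exact: sipSZ.
by rewrite mulrA -expr2 sqrtrM ?sqr_ge0 // sqrtr_sqr.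
Qed.

Lemma sipnD u v : S u -> S v -> sipn (u + v) <= sipn u + sipn v.
Proof.
move=> su sv; rewrite -ler_sqr ?nnegrE ?addr_ge0 ?sipn_ge0 //.
rewrite sipn_sqr; last exact: sipSD.
have := sip_sqr 1 su sv; rewrite scale1r => ->.
rewrite sqrrD !sipn_sqr // expr1n mul1r mulr1 lerD2r lerD2l -[(_ * _) *+ 2]mulr_natl.
by rewrite ler_pM2l //; apply: le_trans (ler_norm _) _; exact: sip_csn.
Qed.

Lemma sipn0 : sipn 0 = 0.
Proof. by rewrite /sipn sip0l ?sqrtr0 //; exact: (sip0 H). Qed.

Lemma sip_null u v : S u -> S v -> sipn u = 0 -> ip u v = 0.
Proof.
move=> su sv u0; apply/eqP; rewrite -normr_le0.
by apply: le_trans (sip_csn su sv) _; rewrite u0 mul0r.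
Qed.

(* The family is extended as long as some element of S is not in its span, which
   must stop before the dimension bound m. *)
Lemma orthonormal_basis (m : nat) :
  (forall f : 'I_m -> V, (forall i, S (f i)) ->
    exists2 c : 'I_m -> R, exists i, c i != 0 & sipn (\sum_i c i *: f i) = 0) ->
  exists d (e : 'I_d -> V), [/\ forall i, S (e i),
    forall i j, ip (e i) (e j) = (i == j)%:R &
    forall v, S v -> sipn (v - \sum_i ip v (e i) *: e i) = 0].
Proof.
move=> dep; apply: contrapT => none.
(* If no orthonormal family spans up to null elements, families of every size exist; one of size m
   contradicts [dep], since pairing a null combination with e i recovers the coefficient c i. *)
suff /(_ m) [e [Se eo]] : forall d, exists e : 'I_d -> V,
    (forall i, S (e i)) /\ forall i j, ip (e i) (e j) = (i == j)%:R.
  have [c [i ci] cn] := dep e Se.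
  have Sc : S (\sum_i c i *: e i) by apply: sipS_sum => j; exact: sipSZ.
  have := sip_null Sc (Se i) cn.
  rewrite sip_suml //; last by move=> j; exact: sipSZ.
  rewrite (bigD1 i) //= big1 => [|j ji]; last first.
    by rewrite sipZl // eo (negPf ji) mulr0.
  by rewrite sipZl // eo eqxx mulr1 addr0 => c0; rewrite c0 eqxx in ci.
elim => [|d [e [Se eo]]].
  by exists (fun=> 0); split => [i|[]//]; exact: (sip0 H).
have [v Sv vn] : exists2 v, S v & sipn (v - \sum_i ip v (e i) *: e i) <> 0.
  apply: contrapT => H0; apply: none; exists d, e; split => // v Sv.
  by apply: contrapT => H1; apply: H0; exists v.
set w := v - _ in vn.
have Ss : S (\sum_i ip v (e i) *: e i) by apply: sipS_sum => j; exact: sipSZ.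
have Sw : S w by rewrite /w -scaleN1r; apply: sipSD => //; exact: sipSZ.
have we j : ip w (e j) = 0.
  rewrite /w -scaleN1r sipDl //; last exact: sipSZ.
  rewrite sipZl // sip_suml //; last by move=> i; exact: sipSZ.
  rewrite (bigD1 j) //= big1 => [|i ij]; last first.
    by rewrite sipZl // eo (negPf ij) mulr0.
  by rewrite sipZl // eo eqxx mulr1 addr0 mulN1r subrr.
pose f (i : 'I_d.+1) := if unlift ord0 i is Some j then e j else (sipn w)^-1 *: w.
have Sf i : S (f i) by rewrite /f; case: unlift => [j|] //; exact: sipSZ.
exists f; split => // i j; rewrite /f.
case: (unliftP ord0 i) => [i' ->|->]; case: (unliftP ord0 j) => [j' ->|->].
- by rewrite eo (inj_eq lift_inj).
- by rewrite (sipC H) ?sipZl ?we ?mulr0 //; exact: sipSZ.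
- by rewrite sipZl ?we ?mulr0.
rewrite sipZl ?sipZr //; last exact: sipSZ.
by rewrite -sipn_sqr // eqxx mulr1n; field; exact/eqP.
Qed.

End semi_inner_product.

Section frobenius.
Context {R : realType}.

Lemma frob_sip (p q : nat) : semi_ip (fun _ : 'M[R]_(p, q) => True) (@frob R p q).
Proof.
split => //.
- move=> u v _ _; rewrite /frob; apply: eq_bigr => i _.
  by apply: eq_bigr => j _; rewrite mulrC.
- move=> a u v w _ _ _; rewrite /frob mulr_sumr -big_split /=.
  apply: eq_bigr => i _; rewrite mulr_sumr -big_split /=.
  by apply: eq_bigr => j _; rewrite !mxE; ring.
- by move=> u _; apply: sumr_ge0 => i _; apply: sumr_ge0 => j _; rewrite -expr2 sqr_ge0.
Qed.

Section fixed_size.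
Variables p q : nat.
Implicit Types (A B C : 'M[R]_(p, q)) (a : R).

Lemma frobC A B : frob A B = frob B A.
Proof. exact: (sipC (@frob_sip p q)). Qed.

Lemma frobDl A B C : frob (A + B) C = frob A C + frob B C.
Proof. exact: (sipDl (@frob_sip p q)). Qed.

Lemma frobDr A B C : frob A (B + C) = frob A B + frob A C.
Proof. exact: (sipDr (@frob_sip p q)). Qed.

Lemma frobZl a A B : frob (a *: A) B = a * frob A B.
Proof. exact: (sipZl (@frob_sip p q)). Qed.

Lemma frobZr a A B : frob A (a *: B) = a * frob A B.
Proof. exact: (sipZr (@frob_sip p q)). Qed.

Lemma frob_ge0 A : 0 <= frob A A.
Proof. exact: (sip_ge0 (@frob_sip p q)). Qed.

Lemma enorm_ge0 A : 0 <= enorm A.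
Proof. exact: sqrtr_ge0. Qed.

Lemma enorm_sqr A : enorm A ^+ 2 = frob A A.
Proof. exact: (sipn_sqr (@frob_sip p q)). Qed.

Lemma frob_le A B : `|frob A B| <= enorm A * enorm B.
Proof. exact: (sip_csn (@frob_sip p q)). Qed.

Lemma enormZ a A : enorm (a *: A) = `|a| * enorm A.
Proof. exact: (sipnZ (@frob_sip p q)). Qed.

Lemma enorm_triangle A B : enorm (A + B) <= enorm A + enorm B.
Proof. exact: (sipnD (@frob_sip p q)). Qed.

Lemma enorm0 : enorm (0 : 'M[R]_(p, q)) = 0.
Proof. exact: (sipn0 (@frob_sip p q)). Qed.

Lemma frob0 : frob (0 : 'M[R]_(p, q)) 0 = 0.
Proof. by rewrite -enorm_sqr enorm0 expr0n. Qed.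

Lemma sqr_entry_le_frob A i j : A i j ^+ 2 <= frob A A.
Proof.
rewrite /frob (bigD1 i) //= (bigD1 j) //= -expr2 -addrA lerDl addr_ge0 //.
  by apply: sumr_ge0 => k _; rewrite -expr2 sqr_ge0.
by apply: sumr_ge0 => k _; apply: sumr_ge0 => l _; rewrite -expr2 sqr_ge0.
Qed.

Lemma entry_le_enorm A i j : `|A i j| <= enorm A.
Proof.
rewrite -ler_sqr ?nnegrE ?enorm_ge0 // real_normK ?num_real // enorm_sqr.
exact: sqr_entry_le_frob.
Qed.

Lemma frob_eq0 A : frob A A = 0 -> A = 0.
Proof.
move=> A0; apply/matrixP => i j; rewrite mxE; apply/eqP.
by rewrite -sqrf_eq0 eq_le sqr_ge0 andbT -A0 sqr_entry_le_frob.
Qed.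

End fixed_size.

Lemma frob_row (n : nat) (u v : 'rV[R]_n) : frob u v = \sum_j u 0 j * v 0 j.
Proof. by rewrite /frob big_ord1. Qed.

Lemma continuous_frob (X : topologicalType) (p q : nat) (f g : X -> 'M[R]_(p, q)) :
  continuous f -> continuous g -> continuous (fun x => frob (f x) (g x)).
Proof.
move=> cf cg; rewrite /frob; do 2!apply: continuous_sum => ?.
by apply: continuous_mulf; exact: continuous_entry.
Qed.

Lemma continuous_sqrtf (X : topologicalType) (f : X -> R) :
  continuous f -> continuous (fun x => Num.sqrt (f x)).
Proof.
move=> cf x; apply: (@continuous_comp _ _ _ f Num.sqrt); first exact: cf.
exact: sqrt_continuous.
Qed.

End frobenius.

Section zero_of_outward_field.
Context {R : realType}.

(* A fixed point of the projection onto the ball composed with x - P x is either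
   a zero of P or a boundary point where P points strictly inward. *)
Lemma zero_of_outward_field (d : nat) (P : 'rV[R]_d -> 'rV[R]_d) (rho : R) :
  0 < rho -> continuous P ->
  (forall x, enorm x = rho -> 0 <= frob (P x) x) -> exists x, P x = 0.
Proof.
move=> rho0 cP Pout.
pose D (x : 'rV[R]_d) := x - P x.
have cD : continuous D.
  apply: continuous_mx => i j.
  rewrite (_ : (fun _ => _) = fun x : 'rV[R]_d => x i j - P x i j).
    by apply: continuous_subf; [exact: coord_continuous|exact: continuous_entry].
  by apply/funext => x; rewrite !mxE.
pose nD x := Num.max rho (enorm (D x)).
have nD0 x : 0 < nD x by rewrite lt_max rho0.
have cnD : continuous nD.
  apply: continuous_maxf; first exact: cst_continuous.
  by apply: continuous_sqrtf; exact: continuous_frob.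
pose F x := (rho / nD x) *: D x.
have Frho x : enorm (F x) <= rho.
  rewrite /F enormZ gtr0_norm ?divr_gt0 // mulrAC ler_pdivrMr //.
  by rewrite ler_pM2l // le_max lexx orbT.
have [x xF] : exists x, F x = x.
  apply: (@brouwer_bounded _ _ _ rho) => [|x i]; last first.
    exact: le_trans (entry_le_enorm _ _ _) (Frho x).
  apply: continuous_mx => i j.
  rewrite (_ : (fun _ => _) = fun x => (rho * (nD x)^-1) * D x i j).
    apply: continuous_mulf; last exact: continuous_entry.
    apply: continuous_mulf; first exact: cst_continuous.
    by apply: continuous_invf => // x; rewrite gt_eqF.
  by apply/funext => x; rewrite /F mxE.
exists x; have [le|gt] := lerP (enorm (D x)) rho.
  move: xF; rewrite /F /nD max_l // divff ?lt0r_neq0 // scale1r /D.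
  by move/(congr1 (fun y => x - y)); rewrite opprB addrC subrK subrr.
have nE : nD x = enorm (D x) by rewrite /nD max_r // ltW.
have Dx0 : 0 < enorm (D x) by apply: lt_trans gt.
have xrho : enorm x = rho.
  rewrite -{1}xF /F enormZ gtr0_norm ?divr_gt0 // nE divfK //.
  exact: lt0r_neq0.
have := Pout x xrho.
have -> : P x = (1 - nD x / rho) *: x.
  have -> : P x = x - D x by rewrite /D opprB addrC subrK.
  have -> : D x = (nD x / rho) *: F x.
    rewrite /F scalerA mulrA divfK ?gt_eqF // divff ?scale1r // gt_eqF //.
  by rewrite xF scalerBl scale1r.
rewrite frobZl -enorm_sqr xrho pmulr_lge0 ?exprn_gt0 // subr_ge0.
by rewrite ler_pdivrMr // mul1r nE leNgt gt.
Qed.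

End zero_of_outward_field.

(** * Lebesgue measure on row vectors *)

Section lebesgue_row.
Context {R : realType}.

(** The sigma-algebra on rows is generated by the entries and not by the open sets; the open cubes
    with rational centre and radius form the countable base that links the two. *)
Lemma open_measurable_rV (n : nat) (U : set 'rV[R]_n) : open U -> measurable U.
Proof.
move=> oU.
pose cube (cr : 'rV[rat]_n * rat) : set 'rV[R]_n :=
  [set y | forall i, `|ratr (cr.1 0 i) - y 0 i| < ratr cr.2].
have -> : U = \bigcup_(cr in [set cr | cube cr `<=` U]) cube cr.
  apply/seteqP; split => [x Ux|x [cr crU /crU//]].
  have /nbhs_ballP[e /= e0 eU] : nbhs x U by apply: open_nbhs_nbhs.
  have [r] := @rat_in_itvoo R (e / 4) (e / 2) ltac:(lra).
  rewrite in_itv /= => /andP[r1 r2].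
  have Hc i : exists q : rat, `|ratr q - x 0 i| < ratr r.
    have [q] := @rat_in_itvoo R (x 0 i - ratr r) (x 0 i + ratr r) ltac:(lra).
    rewrite in_itv /= => /andP[? ?]; exists q.
    by rewrite ltr_norml; apply/andP; split; lra.
  have [c cP] := choice Hc.
  exists (\row_i c i, r) => [y /= yc|i /=]; last by rewrite mxE.
  apply: eU; rewrite -ball_normE /=; apply: norm_mx_lt => // j i.
  rewrite ord1 !mxE; have := yc i; rewrite /= mxE => yi.
  have -> : x 0 i - y 0 i = (ratr (c i) - y 0 i) - (ratr (c i) - x 0 i) by ring.
  by apply: le_lt_trans (ler_normB _ _) _; have := cP i; lra.
have mc cr : measurable (cube cr).
  have -> : cube cr = \bigcap_(i in [set: 'I_n])
      ((fun y : 'rV[R]_n => y 0 i) @^-1` ball (ratr (cr.1 0 i) : R) (ratr cr.2 : R)).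
    by apply/seteqP; split => y yc i; [move=> _|]; exact: yc.
  apply: fin_bigcap_measurable => // i _.
  rewrite -[X in measurable X]setTI; apply: measurable_entry => //.
  by rewrite ball_itv; exact: measurable_itv.
rewrite bigcup_mkcond; apply: countable_bigcupT_measurable => [|cr].
  exact: countableP.
by case: ifP.
Qed.

Lemma closed_measurable_rV (n : nat) (A : set 'rV[R]_n) : closed A -> measurable A.
Proof.
move=> cA; rewrite -(setCK A); apply: measurableC.
by apply: open_measurable_rV; exact: closed_openC.
Qed.

Definition cube_rV (n : nat) (M : R) : set 'rV[R]_n :=
  [set x | forall i, `|x 0 i| <= M].

Lemma measurable_rV_le (n : nat) (f : 'rV[R]_n -> R) (a : R) :
  continuous f -> measurable [set x | f x <= a].
Proof.
move=> cf; apply: closed_measurable_rV.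
by apply: (closed_le_fun (g := cst a)) => //; exact: cst_continuous.
Qed.

Lemma continuous_abs_coord (n : nat) (i : 'I_n) :
  continuous (fun x : 'rV[R]_n => `|x 0 i|).
Proof.
apply: (@continuous_compf _ _ _ (fun x : 'rV[R]_n => x 0 i) Num.norm).
  exact: coord_continuous.
by move=> x; apply: cvg_norm.
Qed.

Lemma measurable_cube_rV (n : nat) (M : R) : measurable (@cube_rV n M).
Proof.
have -> : @cube_rV n M =
    \bigcap_(i in [set: 'I_n]) [set x : 'rV[R]_n | `|x 0 i| <= M].
  by apply/seteqP; split => y yc i; [move=> _|]; exact: yc.
apply: fin_bigcap_measurable => // i _; apply: measurable_rV_le.
exact: continuous_abs_coord.
Qed.

Lemma leb_succE (n : nat) (A : set 'rV[R]_n.+1) :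
  leb n.+1 A = (\int[leb n]_y
    @lebesgue_measure R [set t | A (@cons_rV R n (y, t))])%E.
Proof.
rewrite /= /leb_succ /pushforward /product_measure1.
apply: eq_integral => y _ /=; congr lebesgue_measure.
by apply/seteqP; split => t /=; rewrite /xsection /= inE.
Qed.

Lemma cons_rV_lift (n : nat) (y : 'rV[R]_n) t j : @cons_rV R n (y, t) 0 (lift ord0 j) = y 0 j.
Proof.
rewrite /cons_rV; have -> : lift ord0 j = rshift 1 j by apply: val_inj.
by rewrite (row_mxEr (_ : 'rV_1) (_ : 'rV_n)).
Qed.

Lemma cons_rV0 (n : nat) (y : 'rV[R]_n) t : @cons_rV R n (y, t) 0 ord0 = t.
Proof.
rewrite /cons_rV; have -> : ord0 = lshift n (ord0 : 'I_1) by apply: val_inj.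
by rewrite (row_mxEl (_ : 'rV_1) (_ : 'rV_n)) mxE eqxx mulr1n.
Qed.

Lemma leb_cube_rV_fin (n : nat) (M : R) : (leb n (@cube_rV n M) < +oo)%E.
Proof.
elim: n => [|n IH].
  by rewrite /= diracE; case: (_ \in _); rewrite ltry.
rewrite leb_succE.
rewrite (eq_integral (fun y => (lebesgue_measure [set` `[- M, M]%R] *
    (\1_(@cube_rV n M) y)%:E)%E)); last first.
  move=> y _; rewrite indicE.
  have [yM|yM] := boolP (y \in @cube_rV n M).
    rewrite mule1; congr lebesgue_measure; move: yM; rewrite inE => yM.
    apply/seteqP; split => t /=; rewrite in_itv /= -ler_norml.
      by move=> /(_ ord0); rewrite cons_rV0.
    move=> tM i; case: (unliftP ord0 i) => [k ->|->]; last by rewrite cons_rV0.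
    by rewrite cons_rV_lift; exact: yM.
  rewrite mule0; rewrite (_ : [set _ | _] = set0) ?measure0 //.
  apply/seteqP; split => t //= H; move/negP: yM; apply; rewrite inE => i.
  by have := H (lift ord0 i); rewrite cons_rV_lift.
rewrite ge0_integralZl //=; last by apply/measurable_EFinP/measurable_indic; exact: (@measurable_cube_rV n M).
rewrite integral_indic ?setIT //; last exact: (@measurable_cube_rV n M).
rewrite lebesgue_measure_itv /=; case: ifP => [MM|_]; last by rewrite mul0e ltry.
apply: lte_mul_pinfty => //; rewrite -EFinB lee_fin subr_ge0.
by move: MM; rewrite lte_fin => /ltW.
Qed.

End lebesgue_row.

(** * Translation invariance and null hyperplanes *)

Section lebesgue_row_invariance.
Context {R : realType}.
Local Open Scope ereal_scope.

(** The image measure under translation agrees with Lebesgue measure on half-open intervals, which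
    determine it. *)
Lemma lebesgue_measure_translate (v : R) (A : set R) : measurable A ->
  lebesgue_measure [set t | A (t + v)%R] = lebesgue_measure A.
Proof.
move=> mA.
have mv : measurable_fun [set: measurableTypeR R]
    ((fun t : R => t + v)%R : measurableTypeR R -> measurableTypeR R).
  exact: (@measurable_funD _ (measurableTypeR R)).
pose mu : {measure set (measurableTypeR R) -> \bar R} :=
  @measure_function_pushforward__canonical__measure_function_Measure _ _
    (measurableTypeR R) (measurableTypeR R) _
    (@lebesgue_measure R) _ mv.
rewrite -[LHS]/(mu A); apply/esym.
apply: (@lebesgue_measure_unique R mu) => // X.
move=> [[a b] /= _ <-]; rewrite /mu /= /pushforward.
rewrite (_ : _ @^-1` _ = [set` `](a - v), (b - v)]%R]%classic); last first.
  by apply/seteqP; split => t /=; rewrite !in_itv /= ltrBlDr lerBrDr.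
rewrite !lebesgue_measure_itv /= !lte_fin ltrD2r.
case: ifP => // _.
by rewrite -!EFinB; congr EFin; ring.
Qed.

(** By induction on slices: the first coordinate is translated inside each one-dimensional section,
    the others in the base. It is what moves difference quotients onto test functions later. *)
Lemma leb_translate (n : nat) (v : 'rV[R]_n) (A : set 'rV[R]_n) : measurable A ->
  leb n [set x | A (x + v)%R] = leb n A.
Proof.
elim: n v A => [|n IH] v A mA.
  rewrite (_ : [set x | _] = A) //.
  by apply/seteqP; split => x /=; rewrite (thinmx0 v) addr0.
pose v' : 'rV[R]_n := \row_j v 0%R (lift ord0 j).
have consD y t : (@cons_rV R n (y, t) + v)%R = @cons_rV R n (y + v', t + v 0 ord0)%R.
  apply/rowP => j; rewrite mxE; case: (unliftP ord0 j) => [k ->|->].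
    by rewrite !cons_rV_lift !mxE.
  by rewrite !cons_rV0.
have msec y : measurable [set t | A (@cons_rV R n (y, t))].
  rewrite -[X in measurable X]setTI.
  by apply: (measurableT_comp (@measurable_cons_rV R n) (measurable_pair1 y)).
rewrite !leb_succE.
pose h y := @lebesgue_measure R [set t | A (@cons_rV R n (y, t))].
have mh : measurable_fun [set: 'rV[R]_n] h.
  have mcA : measurable (@cons_rV R n @^-1` A).
    by rewrite -[X in measurable X]setTI; exact: measurable_cons_rV.
  have := measurable_fun_xsection (@lebesgue_measure R) mcA.
  apply: eq_measurable_fun => y _ /=; congr lebesgue_measure.
  by apply/seteqP; split => t /=; rewrite /xsection /= inE.
under eq_integral => y _.
  have -> : [set t | A (@cons_rV R n (y, t) + v)%R] =
      [set t | [set s | A (@cons_rV R n ((y + v')%R, s))] (t + v 0%R ord0)%R].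
    by apply/seteqP; split => t /=; rewrite consD.
  rewrite lebesgue_measure_translate //.
  over.
have mv : measurable_fun [set: 'rV[R]_n] (fun y : 'rV[R]_n => y + v')%R.
  apply: measurable_mx => i j; under eq_fun do rewrite mxE.
  by apply: measurable_funD => //; exact: measurable_entry.
transitivity (\int[pushforward (leb n) (fun y => y + v')%R]_y h y).
  by rewrite (ge0_integral_pushforward mv).
by apply: eq_measure_integral => B mB _; exact: IH.
Qed.

(** If the coefficient of the first coordinate is nonzero, each section is a single point. Otherwise
    the set is a cylinder over a null hyperplane of one dimension less, and infinity times zero is
    zero. Boundaries of simplices are covered by such sets. *)
Lemma leb_affine_null (n : nat) (a : 'rV[R]_n) (b : R) : a != 0%R ->
  leb n [set x : 'rV[R]_n | frob a x = b] = 0.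
Proof.
elim: n a b => [|n IH] a b a0.
  by rewrite (thinmx0 a) eqxx in a0.
pose a' : 'rV[R]_n := \row_j a 0%R (lift ord0 j).
have E y t : frob a (@cons_rV R n (y, t)) = (a 0 ord0 * t + frob a' y)%R.
  rewrite !frob_row big_ord_recl cons_rV0; congr (_ + _)%R.
  by apply: eq_bigr => j _; rewrite cons_rV_lift mxE.
rewrite leb_succE.
have [a00|a00] := eqVneq (a 0%R ord0) 0%R.
  have a'0 : a' != 0%R.
    apply: contraNneq a0 => a'0; apply/eqP/rowP => j; rewrite mxE.
    case: (unliftP ord0 j) => [k ->|-> //].
    by move/rowP: a'0 => /(_ k); rewrite !mxE.
  set N := [set x : 'rV[R]_n | frob a' x = b].
  have mN : measurable N.
    apply: closed_measurable_rV; apply: (closed_eq_fun (g := cst b)).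
      apply: continuous_frob; first exact: cst_continuous.
      by move=> x; exact: cvg_id.
    exact: cst_continuous.
  rewrite (eq_integral (fun y => lebesgue_measure [set: R] * (\1_N y)%:E)).
    rewrite ge0_integralZl //=; last exact/measurable_EFinP/measurable_indic.
    by rewrite integral_indic ?setIT // /N IH ?mule0.
  move=> y _; rewrite indicE; have [|] := boolP (y \in N); rewrite ?inE.
    move=> yN; rewrite mule1; congr lebesgue_measure; apply/seteqP; split => // t _.
    by rewrite /= E a00 mul0r add0r.
  move=> yN; rewrite mule0 (_ : [set _ | _] = set0) ?measure0 //.
  apply/seteqP; split => t //=; rewrite E a00 mul0r add0r => yb.
  by move/negP: yN; apply; rewrite inE.
rewrite integral0_eq // => y _.
rewrite (_ : [set _ | _] = [set ((b - frob a' y) / a 0 ord0)%R]).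
  exact: lebesgue_measure_set1.
apply/seteqP; split => t /=; rewrite E.
  by move=> <-; rewrite addrK mulrAC divff ?mul1r.
by move=> ->; rewrite mulrC divfK // subrK.
Qed.

Lemma bounded_sub_cube (n : nat) (A : set 'rV[R]_n) : bounded_set A ->
  exists2 M : R, (0 < M)%R & A `<=` @cube_rV R n M.
Proof.
move=> [M [_ HM]]; exists (`|M| + 1)%R; first by rewrite ltr_wpDl.
move=> x Ax i; apply: le_trans (entry_le_norm _ _ _) _; apply: HM => //.
by apply: le_lt_trans (ler_norm _) _; rewrite ltrDl.
Qed.

Lemma leb_bounded_fin (n : nat) (A : set 'rV[R]_n) : measurable A ->
  bounded_set A -> leb n A < +oo.
Proof.
move=> mA /bounded_sub_cube[M _ AM].
apply: le_lt_trans (leb_cube_rV_fin n M); apply: le_measure => //.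
- by rewrite inE.
- by rewrite inE; exact: (@measurable_cube_rV R n M).
Qed.

End lebesgue_row_invariance.

(** * Test functions and the fundamental lemma *)

Section directional_derivative.
Context {R : realType}.

Lemma is_derive_line (V : normedModType R) (F : V -> R) (x v : V) (l : R) :
  is_derive (0 : R) (1 : R) (fun h : R => F (h *: v + x)) l -> is_derive x v F l.
Proof.
have E : (fun h : R => h^-1 *: (((fun h : R => F (h *: v + x)) \o shift 0) (h *: 1)
      - F (0 *: v + x))) =
    (fun h : R => h^-1 *: ((F \o shift x) (h *: v) - F x)).
  apply/funext => h /=; rewrite scale0r add0r addr0.
  by rewrite [h *: 1]mulr1.
move=> [dF vF]; split.
  by move: dF; rewrite /derivable E.
by rewrite -vF /derive E.
Qed.

Lemma is_derive_affine_line (f : R -> R) (a b l : R) :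
  is_derive b (1 : R) f l -> is_derive (0 : R) (1 : R) (fun h => f (h * a + b)) (a * l).
Proof.
move=> df.
have -> : (fun h => f (h * a + b)) = f \o (fun h => h * a + b) by [].
have da : is_derive (0 : R) (1 : R) (fun h : R => h * a + b) a.
  apply: is_derive_eq; rewrite /GRing.scale /=; ring.
rewrite mulrC.
apply: is_derive1_comp.
  by rewrite mul0r add0r.
Qed.

End directional_derivative.

(** * The function exp(-1/t) and its derivatives *)

Section flat_functions.
Context {R : realType}.
Implicit Types (p : {poly R}) (t : R).

(** Polynomials in 1/t times exp(-1/t), extended by 0. The polynomial is a parameter because
    differentiation stays in this class: it turns p into X^2 (p - p'). *)
Definition flat p t : R := if 0 < t then p.[t^-1] * expR (- t^-1) else 0.

Lemma horner_bound p : exists2 C, 0 <= C &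
  forall y, 1 <= y -> `|p.[y]| <= C * y ^+ size p.
Proof.
exists (\sum_(i < size p) `|p`_i|); first exact: sumr_ge0.
move=> y y1; rewrite horner_coef; apply: le_trans (ler_norm_sum _ _ _) _.
rewrite mulr_suml; apply: ler_sum => i _; rewrite normrM ler_wpM2l //.
rewrite normrX ger0_norm; last exact: le_trans y1.
by rewrite ler_weXn2l // ltnW.
Qed.

Lemma flat_bound p : exists2 C, 0 <= C & forall t, 0 < t <= 1 -> `|flat p t| <= C * t ^+ 2.
Proof.
(* With N + 1 = size p + 2, the bound of exp(1/t) from below by its term of degree N + 1 beats the
   growth of p(1/t) and leaves the factor t^2, which yields the derivative 0 at the origin. *)
have [S S0 HS] := horner_bound p; pose N := (size p).+1.
exists (S * N.+1`!%:R); first by rewrite mulr_ge0.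
move=> t /andP[t0 t1]; rewrite /flat t0 normrM (ger0_norm (expR_ge0 _)).
have y1 : 1 <= t^-1 by rewrite -invr1 lef_pV2 ?posrE.
have y0 : 0 < t^-1 by rewrite invr_gt0.
have e1 : expR (- t^-1) <= N.+1`!%:R * t ^+ N.+1.
  have B0 : 0 < N.+1`!%:R * t ^+ N.+1 by rewrite mulr_gt0 ?exprn_gt0 // ltr0n fact_gt0.
  rewrite expRN -[leRHS]invrK lef_pV2 ?posrE ?expR_gt0 ?invr_gt0 //.
  apply: le_trans (expR_ge1Dxn N (ltW y0)); rewrite invfM mulrC exprVn.
  by rewrite lerDr.
apply: le_trans (ler_pM (normr_ge0 _) (expR_ge0 _) (HS _ y1) e1) _.
rewrite mulrACA ler_wpM2l ?mulr_ge0 // /N exprVn -addn2 exprD mulKf //.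
by rewrite expf_neq0 // gt_eqF.
Qed.

Lemma is_derive_flat p t : is_derive t (1 : R) (flat p) (flat ('X^2 * (p - p^`())) t).
Proof.
have [t0|t0|<-] := ltgtP 0 t.
- apply: (@near_eq_is_derive _ _ _ (fun s : R => p.[s^-1] * expR (- s^-1))).
    by near=> s; rewrite /flat ifT //; near: s; exact: lt_nbhsr.
  have tn0 : t != 0 by rewrite gt_eqF.
  have dV : is_derive t (1 : R) (fun s : R => s^-1) (- t ^- 2).
    have := is_deriveV (f := id) tn0 (is_derive_id t 1).
    by rewrite [_ *: 1]mulr1.
  have dp : is_derive t (1 : R) (fun s : R => p.[s^-1]) (p^`().[t^-1] * - t ^- 2).
    exact: (@is_derive1_comp _ (horner p) (fun s => s^-1)).
  have dN : is_derive t (1 : R) (fun s : R => - s^-1) (t ^- 2).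
    by rewrite -[t ^- 2]opprK; exact: is_deriveN.
  have de : is_derive t (1 : R) (fun s : R => expR (- s^-1)) (expR (- t^-1) * t ^- 2).
    exact: (@is_derive1_comp _ expR (fun s => - s^-1)).
  apply: is_derive_eq; rewrite /flat t0 /GRing.scale /= hornerM hornerXn hornerD hornerN.
  by rewrite exprVn; ring.
- apply: (@near_eq_is_derive _ _ _ (cst 0)).
    near=> s; rewrite /flat ifF //; apply/negbTE; rewrite -leNgt ltW //.
    by near: s; exact: lt_nbhsl.
  rewrite /flat ifF; last by apply/negbTE; rewrite -leNgt ltW.
  exact: is_derive_cst.
rewrite [X in is_derive _ _ _ X]/flat ltxx.
have [C C0 HC] := flat_bound p.
have lim0 : (fun h : R => h^-1 *: ((flat p \o shift 0) (h *: 1) - flat p 0)) @ 0^'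
    --> (0 : R).
  apply/cvgr0Pnorm_lt => e e0; near=> h.
  have h0 : h != 0 by near: h; exact: nbhs_dnbhs_neq.
  rewrite /= addr0 [h *: 1]mulr1 /flat ltxx subr0.
  case: ifP => hp; last by rewrite scaler0 normr0.
  have hh : `|h| < Num.min 1 (e / (C + 1)).
    near: h; apply: dnbhs0_lt; rewrite lt_min ltr01 divr_gt0 //.
    by rewrite ltr_wpDl.
  move: hh; rewrite (gtr0_norm hp) lt_min => /andP[h1 he].
  have := HC h; rewrite hp (ltW h1) /flat hp => /(_ isT) Hh.
  rewrite normrM (gtr0_norm (_ : 0 < h^-1)) ?invr_gt0 // mulrC ltr_pdivrMr //.
  apply: le_lt_trans Hh _; rewrite expr2 mulrA ltr_pM2r //.
  move: he; rewrite ltr_pdivlMr; last by rewrite ltr_wpDl.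
  by apply: le_lt_trans; rewrite mulrC ler_pM2l // lerDl.
split; first by apply/cvg_ex; exists 0.
exact: cvg_lim lim0.
Unshelve. all: by end_near. Qed.

End flat_functions.

Section smooth_expressions.
Context {R : realType} {n : nat}.

(* A class of functions closed under partial derivatives and containing both
   the polynomials and enough bump functions. *)
Inductive sexpr : Type :=
  | SConst of R
  | SVar of 'I_n
  | SFlat of {poly R} & R & R & 'I_n
  | SAdd of sexpr & sexpr
  | SMul of sexpr & sexpr.

Fixpoint seval (e : sexpr) (x : 'rV[R]_n) : R :=
  match e with
  | SConst c => c
  | SVar i => x 0 i
  | SFlat p a b i => flat p (x 0 i * a + b)
  | SAdd e1 e2 => seval e1 x + seval e2 x
  | SMul e1 e2 => seval e1 x * seval e2 x
  end.

Fixpoint sderiv (j : 'I_n) (e : sexpr) : sexpr :=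
  match e with
  | SConst _ => SConst 0
  | SVar i => SConst (i == j)%:R
  | SFlat p a b i => SMul (SConst ((i == j)%:R * a))
                          (SFlat ('X^2 * (p - p^`())) a b i)
  | SAdd e1 e2 => SAdd (sderiv j e1) (sderiv j e2)
  | SMul e1 e2 => SAdd (SMul e1 (sderiv j e2)) (SMul (sderiv j e1) e2)
  end.

Lemma continuous_seval e : continuous (seval e).
Proof.
elim: e => [c|i|p a b i|e1 IH1 e2 IH2|e1 IH1 e2 IH2].
- exact: cst_continuous.
- exact: coord_continuous.
- apply: (@continuous_compf _ _ _ (fun x : 'rV[R]_n => x 0 i * a + b) (flat p)).
    apply: continuous_addf; last exact: cst_continuous.
    by apply: continuous_mulf; [exact: coord_continuous|exact: cst_continuous].
  move=> t; apply: differentiable_continuous; apply/derivable1_diffP.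
  by have [] := is_derive_flat p t.
- exact: continuous_addf.
- exact: continuous_mulf.
Qed.

Lemma is_derive_seval e j x :
  is_derive x (delta_mx 0 j : 'rV[R]_n) (seval e) (seval (sderiv j e) x).
Proof.
elim: e => [c|i|p a b i|e1 IH1 e2 IH2|e1 IH1 e2 IH2].
- exact: is_derive_cst.
- apply: is_derive_line => /=; under eq_fun do rewrite !mxE /=.
  have := @is_derive_affine_line R id (i == j)%:R (x 0 i) 1 (is_derive_id _ _).
  by rewrite mulr1.
- apply: is_derive_line => /=.
  have -> : (fun h : R => flat p ((h *: delta_mx 0 j + x) 0 i * a + b)) =
      (fun h => flat p (h * ((i == j)%:R * a) + (x 0 i * a + b))).
    by apply/funext => h; rewrite !mxE /=; congr (flat p _); ring.
  exact/is_derive_affine_line/is_derive_flat.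
- exact: is_deriveD.
- have -> : seval (sderiv j (SMul e1 e2)) x =
      seval e1 x *: seval (sderiv j e2) x + seval e2 x *: seval (sderiv j e1) x.
    by rewrite /= /GRing.scale /=; ring.
  exact: is_deriveM.
Qed.

Lemma partials_seval s e : partials s (seval e) = seval (foldr sderiv e s).
Proof.
elim: s => //= j s IH; rewrite IH; apply/funext => x.
by have [_ ->] := is_derive_seval (foldr sderiv e s) j x.
Qed.

Lemma smooth_seval e : smooth (seval e).
Proof.
move=> s; rewrite partials_seval; split; first exact: continuous_seval.
by move=> j x; have [] := is_derive_seval (foldr sderiv e s) j x.
Qed.

Lemma seval_sum (I : Type) (s : seq I) (P : pred I) (f : I -> 'rV[R]_n -> R) :
  (forall i, exists e, f i = seval e) ->
  exists e, (fun x => \sum_(i <- s | P i) f i x) = seval e.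
Proof.
move=> H; elim: s => [|a s [e IH]].
  by exists (SConst 0); apply/funext => x; rewrite big_nil.
have [ea Ha] := H a; exists (if P a then SAdd ea e else e); apply/funext => x.
rewrite big_cons; move/funeqP: IH => /(_ x); case: (P a) => //= ->.
by rewrite Ha.
Qed.

Lemma seval_prod (I : Type) (s : seq I) (P : pred I) (f : I -> 'rV[R]_n -> R) :
  (forall i, exists e, f i = seval e) ->
  exists e, (fun x => \prod_(i <- s | P i) f i x) = seval e.
Proof.
move=> H; elim: s => [|a s [e IH]].
  by exists (SConst 1); apply/funext => x; rewrite big_nil.
have [ea Ha] := H a; exists (if P a then SMul ea e else e); apply/funext => x.
rewrite big_cons; move/funeqP: IH => /(_ x); case: (P a) => //= ->.
by rewrite Ha.
Qed.

Lemma seval_poly (k : nat) (f : 'rV[R]_n -> R) : is_poly k f -> exists e, f = seval e.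
Proof.
move=> [c fc]; rewrite (_ : f = fun x => \sum_(a : {ffun 'I_n -> 'I_k.+1} |
    (\sum_i a i <= k)%N) c a * \prod_i x 0 i ^+ a i); last exact/funext.
apply: seval_sum => a.
have [e /funeqP He] : exists e, (fun x : 'rV[R]_n => \prod_i x 0 i ^+ a i) = seval e.
  apply: seval_prod => i; elim: (nat_of_ord (a i)) => [|m [e /funeqP He]].
    by exists (SConst 1); apply/funext => x; rewrite expr0.
  by exists (SMul (SVar i) e); apply/funext => x; rewrite exprS /= -He.
by exists (SMul (SConst (c a)) e); apply/funext => x; rewrite /= He.
Qed.

End smooth_expressions.

Lemma continuous_bounded_cube {R : realType} {n : nat} (f : 'rV[R]_n -> R) (M : R) :
  continuous f -> exists2 C, 0 <= C & forall x, @cube_rV R n M x -> `|f x| <= C.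
Proof.
move=> cf.
have cM : compact (@cube_rV R n M).
  apply: bounded_closed_compact.
    exists (Num.max 0 M); split => [|r]; first exact: num_real.
    rewrite gt_max => /andP[r0 Mr] x xM; apply: norm_mx_le => [|i j]; first exact: ltW.
    by rewrite ord1; apply: le_trans (xM j) (ltW Mr).
  rewrite (_ : @cube_rV R n M = \bigcap_i [set x : 'rV[R]_n | `|x 0 i| <= M]).
    apply: closed_bigI => i _; apply: (closed_le_fun (g := cst M)).
      exact: continuous_abs_coord.
    exact: cst_continuous.
  by apply/seteqP; split => y yc i; [move=> _|]; exact: yc.
have [->|/set0P ne] := eqVneq (@cube_rV R n M) set0; first by exists 0.
have ca : continuous (fun x => `|f x|).
  apply: (@continuous_compf _ _ _ f Num.norm) => //.
  by move=> x; apply: cvg_norm.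
have [c _ cmax] := compact_EVT_max ne cM (continuous_subspaceT ca).
exists `|f c| => // x xM; apply: cmax; exact/mem_set.
Qed.

(** * Open boxes as a generating family *)

Section open_boxes.
Context {R : realType} {n : nat}.
Implicit Types (a b : 'rV[R]_n).

Definition obox a b : set 'rV[R]_n := [set x | forall i, a 0 i < x 0 i < b 0 i].
Definition cbox a b : set 'rV[R]_n := [set x | forall i, a 0 i <= x 0 i <= b 0 i].

Lemma measurable_obox a b : measurable (obox a b).
Proof.
have -> : obox a b = \bigcap_(i in [set: 'I_n])
    ((fun x : 'rV[R]_n => x 0 i) @^-1` `]a 0 i, b 0 i[%classic).
  by apply/seteqP; split => x xb i; [move=> _|]; have := xb i; rewrite /= in_itv //=; apply.
apply: fin_bigcap_measurable => // i _.
by rewrite -[X in measurable X]setTI; apply: measurable_entry.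
Qed.

Lemma compact_cbox a b : compact (cbox a b).
Proof.
rewrite (_ : cbox a b = [set x | forall i, `[a 0 i, b 0 i]%classic (x ord0 i)]).
  by apply: (@rV_compact _ n (fun i => `[a 0 i, b 0 i]%classic)) => i; exact: segment_compact.
by apply/seteqP; split => x xb i; have := xb i; rewrite /= in_itv.
Qed.

Lemma oboxI a b c d : obox a b `&` obox c d =
  obox (\row_i Num.max (a 0 i) (c 0 i)) (\row_i Num.min (b 0 i) (d 0 i)).
Proof.
apply/seteqP; split => x.
  move=> [x1 x2] i; have /andP[? ?] := x1 i; have /andP[? ?] := x2 i.
  by rewrite !mxE gt_max lt_min; apply/and3P; split => //; apply/andP.
move=> H; split=> i; have := H i; rewrite !mxE gt_max lt_min => /andP[/andP[? ?] /andP[? ?]];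
  exact/andP.
Qed.

Definition oboxes : set (set 'rV[R]_n) := [set A | exists a b, A = obox a b].

Lemma setI_closed_oboxes : setI_closed oboxes.
Proof. by move=> _ _ [a [b ->]] [c [d ->]]; rewrite oboxI; eexists; eexists. Qed.

(** A half-space x_j > c is the union over N of boxes bounded by N in all coordinates. With
    stability under intersections this makes the boxes a pi-system for the Dynkin argument of
    [fundamental_lemma]. *)
Lemma measurable_sigma_oboxes (A : set 'rV[R]_n) : measurable A -> <<s oboxes >> A.
Proof.
rewrite /measurable /=; apply: smallest_sub; first exact: smallest_sigma_algebra.
move=> _ [i0 [j [B [mB ->]]]]; rewrite (ord1 i0) {i0}.
have : <<s @RGenOInfty.G R >> B by rewrite -[X in X B]RGenOInfty.measurableE.
apply: (smallest_sub (X := [set B | <<s oboxes >> ((fun M : 'rV[R]_n => M 0 j) @^-1` B)])).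
  have [h0 hC hU] := smallest_sigma_algebra [set: 'rV[R]_n] oboxes.
  split => [|C hCC|F hF] /=.
  - by rewrite preimage_set0.
  - rewrite setTD preimage_setC -setTD; exact: hC.
  - by rewrite preimage_bigcup; exact: hU.
move=> _ [c ->] /=.
have -> : (fun M : 'rV[R]_n => M 0 j) @^-1` `]c, +oo[%classic =
    \bigcup_N obox (\row_k (if k == j then c else - N%:R)) (const_mx N%:R).
  apply/seteqP; split => x /=; rewrite in_itv /= andbT; last first.
    by move=> [N _ /(_ j)]; rewrite mxE eqxx => /andP[].
  move=> cx; exists (Num.truncn `|x|).+1 => // i; rewrite !mxE.
  have : `|x 0 i| < (Num.truncn `|x|).+1%:R.
    by apply: le_lt_trans (entry_le_norm _ _ _) _; rewrite truncnS_gt.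
  by rewrite ltr_norml => /andP[? ->]; rewrite andbT; case: eqP => [->|].
have [h0 hC hU] := smallest_sigma_algebra [set: 'rV[R]_n] oboxes.
by apply: hU => N; apply: sub_sigma_algebra; eexists; eexists.
Qed.

End open_boxes.
Section measurability_of_continuous.
Context {R : realType} {n : nat}.

Lemma measurable_fun_continuous_on (Omega : set 'rV[R]_n) (f : 'rV[R]_n -> R) :
  open Omega -> (forall x, Omega x -> {for x, continuous f}) -> measurable_fun Omega f.
Proof.
move=> oO cf mO; apply: (measurability _ (RGenOInfty.measurableE R)) => //.
move=> _ [_ [c ->] <-]; apply: open_measurable_rV.
rewrite openE => x [Ox fx]; rewrite /interior.
apply: filterI; first exact: open_nbhs_nbhs.
by apply: (cf x Ox); apply: open_nbhs_nbhs; split => //.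
Qed.

Lemma measurable_fun_continuous (f : 'rV[R]_n -> R) (D : set 'rV[R]_n) :
  continuous f -> measurable D -> measurable_fun D f.
Proof.
move=> cf mD; apply: (@measurable_funS _ _ _ _ setT) => //.
by apply: measurable_fun_continuous_on => [|x _]; [exact: openT|exact: cf].
Qed.

End measurability_of_continuous.

Section fundamental_lemma.
Context {R : realType} {n : nat}.
Implicit Types (a b : 'rV[R]_n) (Omega : set 'rV[R]_n).

(** Since [flat 1] vanishes for t <= 0 and exp(-1/((m + 1) t)) tends to 1 for t > 0, these smooth
    functions tend pointwise to the indicator of the open box while staying between 0 and 1. *)
Definition bump (m : nat) a b (x : 'rV[R]_n) : R :=
  \prod_i (flat 1 (x 0 i * m.+1%:R + - a 0 i * m.+1%:R) *
           flat 1 (x 0 i * - m.+1%:R + b 0 i * m.+1%:R)).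

Lemma flat1E (t : R) : flat 1 t = if 0 < t then expR (- t^-1) else 0.
Proof. by rewrite /flat hornerC mul1r. Qed.

Lemma flat1_eq0 (t : R) : t <= 0 -> flat 1 t = 0.
Proof. by move=> t0; rewrite flat1E ltNge t0. Qed.

Lemma flat1_itv (t : R) : 0 <= flat 1 t <= 1.
Proof.
rewrite flat1E; case: ifP => t0; last by rewrite lexx ler01.
by rewrite expR_ge0 -expR0 ler_expR oppr_le0 invr_ge0 ltW.
Qed.

Lemma flat1_ge0 (t : R) : 0 <= flat 1 t. Proof. by have /andP[] := flat1_itv t. Qed.

Lemma flat1_le1 (t : R) : flat 1 t <= 1. Proof. by have /andP[] := flat1_itv t. Qed.

Lemma bump_itv m a b x : 0 <= bump m a b x <= 1.
Proof.
apply/andP; split.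
  by apply: prodr_ge0 => i _; apply: mulr_ge0; exact: flat1_ge0.
apply: prodr_ile1 => i _; apply/andP; split.
  by apply: mulr_ge0; exact: flat1_ge0.
by apply: mulr_ile1; rewrite ?flat1_ge0 ?flat1_le1.
Qed.

Lemma bump_out m a b x : ~ obox a b x -> bump m a b x = 0.
Proof.
move=> /existsNP[i /negP]; rewrite negb_and -!leNgt => H.
rewrite /bump (bigD1 i) //=.
suff -> : flat 1 (x 0 i * m.+1%:R + - a 0 i * m.+1%:R) *
           flat 1 (x 0 i * - m.+1%:R + b 0 i * m.+1%:R) = 0 by rewrite mul0r.
case/orP: H => H.
  by rewrite flat1_eq0 ?mul0r // -mulrDl mulr_le0_ge0 // subr_le0.
by rewrite [X in _ * X]flat1_eq0 ?mulr0 // mulrN -mulNr -mulrDl mulr_le0_ge0 // addrC subr_le0.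
Qed.

Lemma bump_test Omega m a b : cbox a b `<=` Omega -> test_fun Omega (bump m a b).
Proof.
move=> abO; split.
  have [e E] : exists e, bump m a b = seval e.
    apply: seval_prod => i.
    by exists (SMul (SFlat 1 m.+1%:R (- a 0 i * m.+1%:R) i)
                    (SFlat 1 (- m.+1%:R) (b 0 i * m.+1%:R) i)).
  by rewrite E; exact: smooth_seval.
exists (cbox a b); split => //; first exact: compact_cbox.
move=> x xab; apply: bump_out => xo; apply: xab => i.
by have /andP[? ?] := xo i; rewrite !ltW.
Qed.

Lemma flat1_cvg (t : R) : 0 < t -> (fun m => flat 1 (t * m.+1%:R)) @ \oo --> (1 : R).
Proof.
move=> t0.
have -> : (fun m => flat 1 (t * m.+1%:R)) = (fun m => expR (- (t^-1 * harmonic m))).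
  apply/funext => m; rewrite flat1E mulr_gt0 // invfM //.
have H : (fun m => - (t^-1 * @harmonic R m)) @ \oo --> (0 : R).
  rewrite -oppr0 -(mulr0 t^-1); apply: cvgN; apply: cvgM; first exact: cvg_cst.
  exact: cvg_harmonic.
by rewrite -[X in _ --> X]expR0; exact: (cvg_comp _ _ H (@continuous_expR R 0)).
Qed.

Lemma bump_cvg a b x : (fun m => bump m a b x) @ \oo --> (\1_(obox a b) x : R).
Proof.
rewrite indicE; have [xb|xb] := pselect (obox a b x); last first.
  rewrite memNset // (_ : (fun _ => _) = cst 0); first exact: cvg_cst.
  by apply/funext => m; exact: bump_out.
rewrite mem_set // /bump mulr1n.
suff H (s : seq 'I_n) : (fun m => \prod_(i <- s)
    (flat 1 (x 0 i * m.+1%:R + - a 0 i * m.+1%:R) *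
     flat 1 (x 0 i * - m.+1%:R + b 0 i * m.+1%:R))) @ \oo --> (1 : R) by exact: H.
elim: s => [|i s IH].
  by under eq_fun do rewrite big_nil; exact: cvg_cst.
under eq_fun do rewrite big_cons.
have /andP[ai bi] := xb i.
have -> : nbhs (1 : R) = nbhs ((1 * 1) * 1 : R) by rewrite !mulr1.
apply: cvgM => //; apply: cvgM.
  under eq_fun do rewrite -mulrDl.
  by apply: flat1_cvg; rewrite subr_gt0.
under eq_fun do rewrite mulrN -mulNr -mulrDl.
by apply: flat1_cvg; rewrite addrC subr_gt0.
Qed.

(** Bumps approximate the indicator of a box, so by dominated convergence G has integral 0 on every
    open box whose closure lies in Omega. A Dynkin argument extends this to all measurable subsets
    of such a box, so G is null there, and countably many rational boxes exhaust Omega. *)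
Lemma fundamental_lemma Omega (G : 'rV[R]_n -> R) : open Omega ->
  (leb n).-integrable Omega (EFin \o G) ->
  (forall theta, test_fun Omega theta ->
     \int[leb n]_(x in Omega) (G x * theta x) = 0) ->
  {ae leb n, forall x, Omega x -> G x = 0}.
Proof.
move=> oO iG HG; have mO := open_measurable_rV oO.
have mG : measurable_fun Omega G by apply/measurable_EFinP; exact: measurable_int iG.
have int_box a b : cbox a b `<=` Omega ->
    (\int[leb n]_(x in obox a b) (G x)%:E = 0)%E.
  move=> abO.
  have oO' : obox a b `<=` Omega.
    by move=> x xo; apply: abO => i; have /andP[? ?] := xo i; rewrite !ltW.
  pose f_ m x := (G x * bump m a b x)%:E.
  have mb m : measurable_fun Omega (bump m a b).
    apply: measurable_fun_continuous => //.
    by have [/(_ [::])[]] := bump_test m abO.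
  have mI : measurable_fun Omega (fun x => (G x * \1_(obox a b) x)%:E).
    apply/measurable_EFinP/measurable_funM => //.
    apply: measurable_indic; exact: measurable_obox.
  have mf m : measurable_fun Omega (f_ m).
    by apply/measurable_EFinP/measurable_funM.
  have cv : {ae leb n, forall x, Omega x ->
      f_ ^~ x @ \oo --> (G x * \1_(obox a b) x)%:E}.
    apply/aeW => x _; apply/fine_cvgP; split; first exact: nearW.
    by apply: cvgM; [exact: cvg_cst|exact: bump_cvg].
  have dom : {ae leb n, forall x m, Omega x -> (`|f_ m x| <= `|(G x)%:E|)%E}.
    apply/aeW => x m _; rewrite !abse_EFin lee_fin normrM -[leRHS]mulr1.
    have /andP[b0 b1] := bump_itv m a b x.
    by rewrite ler_wpM2l // ger0_norm.
  have [_ _] := @dominated_convergence _ _ _ (leb n) Omega mO f_ _ _ mf mI cv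
    (integrable_abse iG) dom.
  rewrite (_ : (fun _ => _) = cst 0%E); last first.
    apply/funext => m; have := HG _ (bump_test m abO).
    rewrite /Rintegral => E0.
    have fin : (\int[leb n]_(x in Omega) f_ m x)%E \is a fin_num.
      apply: integrable_fin_num => //.
      apply: (le_integrable mO (mf m) _ (integrable_abse iG)) => x Ox.
      rewrite /= lee_fin normr_id normrM -[leRHS]mulr1.
      have /andP[b0 b1] := bump_itv m a b x.
      by rewrite ler_wpM2l // ger0_norm.
    by rewrite -(fineK fin) /cst; congr EFin.
  move/(cvg_unique _ (cvg_cst _)) => /= E0; rewrite E0 // {E0}.
  rewrite -[X in (\int[_]_(x in X) _)%E](setIidr oO') integral_mkcondr.
  apply: eq_integral => x _; rewrite patchE indicE.
  by case: (x \in _); rewrite ?mulr1 ?mulr0.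
have ae_box a b : cbox a b `<=` Omega -> {ae leb n, forall x, obox a b x -> G x = 0}.
  move=> abO; set Q := obox a b; have mQ : measurable Q by exact: measurable_obox.
  have QO : Q `<=` Omega.
    by move=> x xo; apply: abO => i; have /andP[? ?] := xo i; rewrite !ltW.
  have iQ (A : set 'rV[R]_n) : measurable A -> (leb n).-integrable (Q `&` A) (EFin \o G).
    move=> mA; apply: integrableS iG => //; first exact: measurableI.
    by move=> x [/QO].
  pose D := [set A : set 'rV[R]_n |
    measurable A /\ (\int[leb n]_(x in Q `&` A) (G x)%:E = 0)%E].
  have dD : dynkin D.
    split => [|A [mA A0]|F tF FD].
    - by split; [exact: measurableT|rewrite setIT; exact: int_box].
    - split; first exact: measurableC.
      have := int_box a b abO; rewrite -/Q -[Q in LHS](setIT Q) -(setUv A) setIUr.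
      rewrite integral_setU ?A0 ?add0e //; [exact: measurableI| | |].
      + by apply: measurableI => //; exact: measurableC.
      + rewrite -setIUr setUv setIT.
        by have := measurable_int _ (iQ setT measurableT); rewrite setIT.
      + by apply/disj_set2P; rewrite -setIIr setICr setI0.
    split; first by apply: bigcupT_measurable => i; have [] := FD i.
    rewrite setI_bigcupr integral_bigcup //.
    - by rewrite eseries0 // => i _ _; have [] := FD i.
    - exact: trivIset_setIl.
    - by move=> i; apply: measurableI => //; have [] := FD i.
    - rewrite -setI_bigcupr; apply: iQ.
      by apply: bigcupT_measurable => i; have [] := FD i.
  have all_D A : measurable A -> D A.
    move=> /measurable_sigma_oboxes.
    rewrite -(setI_closed_g_dynkin_g_sigma_algebra setI_closed_oboxes).
    apply: smallest_sub => // _ [c [d ->]]; split; first exact: measurable_obox.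
    rewrite oboxI; apply: int_box => x xb; apply: abO => i.
    have := xb i; rewrite !mxE ge_max le_min => /andP[/andP[-> _] /andP[-> _]].
    by [].
  have := @integral_ae_eq _ _ _ (leb n) Q mQ (cst 0%E) (EFin \o G).
  move=> /(_ _ _ _)[].
  - by have := iQ setT measurableT; rewrite setIT.
  - exact: measurable_cst.
  - move=> E EQ mE; rewrite integral0; have [_] := all_D E mE.
    by rewrite setIidr.
  move=> N [mN N0 sN]; exists N; split => // x /= H; apply: sN => /= H'.
  by apply: H => xQ; have [] := H' xQ.
(* The bad points inside the k-th rational box, when its closed version lies in Omega; every bad
   point of Omega belongs to one of these sets. *)
pose F (k : nat) : set 'rV[R]_n :=
  if @unpickle ('rV[rat]_n * 'rV[rat]_n)%type k is Some cd then
    let a := map_mx ratr cd.1 in let b := map_mx ratr cd.2 in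
    [set x | (cbox a b `<=` Omega) /\ obox a b x /\ G x <> 0]
  else set0.
have : (leb n).-negligible (\bigcup_k F k).
  apply: negligible_bigcup => k; rewrite /F; case: unpickle => [[c d]|]; last first.
    exact: negligible_set0.
  have [abO|nabO] := pselect (cbox (map_mx ratr c) (map_mx ratr d) `<=` Omega).
    apply: negligibleS (ae_box _ _ abO) => x [_ [xab Gx]] H.
    by apply: Gx; exact: H.
  by apply: negligibleS (negligible_set0 _) => x [/nabO].
apply: negligibleS => x /= H.
have [Ox Gx] : Omega x /\ G x <> 0.
  by split; apply: contrapT => H'; apply: H => // Ox; apply: contrapT => /H'.
have /nbhs_ballP[e /= e0 eO] : nbhs x Omega by apply: open_nbhs_nbhs.
have Ha i : exists q : rat, x 0 i - e / 2 < ratr q < x 0 i.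
  by have [|q] := @rat_in_itvoo R (x 0 i - e / 2) (x 0 i); [lra|rewrite in_itv; exists q].
have Hb i : exists q : rat, x 0 i < ratr q < x 0 i + e / 2.
  by have [|q] := @rat_in_itvoo R (x 0 i) (x 0 i + e / 2); [lra|rewrite in_itv; exists q].
have [c cP] := choice Ha; have [d dP] := choice Hb.
exists (pickle (\row_i c i, \row_i d i)) => //.
rewrite /F pickleK /=; split; last split => // i; last first.
  by rewrite !mxE; have /andP[_ ->] := cP i; have /andP[] := dP i.
move=> y yb; apply: eO; rewrite -ball_normE /=; apply: norm_mx_lt => // j i.
rewrite ord1 !mxE; have := yb i; rewrite !mxE => /andP[y1 y2].
have /andP[c1 c2] := cP i; have /andP[d1 d2] := dP i.
by rewrite ltr_norml; apply/andP; split; lra.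
Qed.

End fundamental_lemma.

(** * Square-integrable fields and weak derivatives *)

Section square_integrable.
Context {R : realType} {n : nat} (Omega : set 'rV[R]_n).
Hypotheses (oO : open Omega) (bO : bounded_set Omega).

Let mO : measurable Omega.
Proof. exact: open_measurable_rV. Qed.

Implicit Types f g : 'rV[R]_n -> R.

Definition integ f : Prop := (leb n).-integrable Omega (EFin \o f).

Definition L2s f : Prop :=
  measurable_fun Omega f /\ (leb n).-integrable Omega (fun x => (f x ^+ 2)%:E).

Lemma integ_measurable f : integ f -> measurable_fun Omega f.
Proof. by move=> /measurable_int/measurable_EFinP. Qed.

Lemma integ_le f g : measurable_fun Omega f -> integ g ->
  (forall x, Omega x -> `|f x| <= `|g x|) -> integ f.
Proof.
move=> mf ig fg; apply: le_integrable ig => //; first exact/measurable_EFinP.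
Qed.

Lemma integD f g : integ f -> integ g -> integ (fun x => f x + g x).
Proof.
move=> i_f i_g; have := integrableD mO i_f i_g; apply: eq_integrable => // x _.
Qed.

Lemma integZ (c : R) f : integ f -> integ (fun x => c * f x).
Proof. by move=> i_f; have := integrableZl mO c i_f; exact: eq_integrable. Qed.

Lemma integ_sum (I : Type) (s : seq I) (P : pred I) (f : I -> 'rV[R]_n -> R) :
  (forall i, integ (f i)) -> integ (fun x => \sum_(i <- s | P i) f i x).
Proof.
move=> Hf; elim: s => [|a s IH].
  have -> : (fun x => \sum_(i <- [::] | P i) f i x) = cst 0.
    by apply/funext => x; rewrite big_nil.
  exact: integrable0.
have -> : (fun x => \sum_(i <- a :: s | P i) f i x) = fun x =>
    (if P a then 1 else 0) * f a x + \sum_(i <- s | P i) f i x.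
  by apply/funext => x; rewrite big_cons; case: (P a); rewrite ?mul1r ?mul0r ?add0r.
by apply: integD => //; exact: integZ.
Qed.

Lemma integ_cst (c : R) : integ (cst c).
Proof.
apply/integrableP; split; first exact/measurable_EFinP.
rewrite (eq_integral (cst `|c|%:E)) ?integral_cst //.
apply: lte_mul_pinfty => //; last exact: leb_bounded_fin.
Qed.

Lemma integ_bounded f (C : R) : measurable_fun Omega f ->
  (forall x, Omega x -> `|f x| <= C) -> integ f.
Proof.
move=> mf fC; apply: (integ_le mf (integ_cst C)) => x Ox.
by apply: le_trans (fC x Ox) (ler_norm _).
Qed.

Lemma L2s_integM f g : L2s f -> L2s g -> integ (fun x => f x * g x).
Proof.
move=> [mf f2] [mg g2].
apply: (@integ_le _ (fun x => f x ^+ 2 + g x ^+ 2)).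
- exact: measurable_funM.
- exact: integD.
move=> x _; rewrite [leRHS]ger0_norm ?addr_ge0 ?sqr_ge0 //.
rewrite ler_norml; apply/andP; split.
  by have := sqr_ge0 (f x + g x); have := sqr_ge0 (f x); have := sqr_ge0 (g x); nra.
by have := sqr_ge0 (f x - g x); have := sqr_ge0 (f x); have := sqr_ge0 (g x); nra.
Qed.

Lemma L2sD f g : L2s f -> L2s g -> L2s (fun x => f x + g x).
Proof.
move=> Hf Hg; have i_fg := L2s_integM Hf Hg; move: Hf Hg => [mf f2] [mg g2]; split.
  exact: measurable_funD.
have -> : (fun x => ((f x + g x) ^+ 2)%:E) =
    EFin \o (fun x => (f x ^+ 2 + g x ^+ 2) + 2 * (f x * g x)).
  by apply/funext => x /=; congr EFin; ring.
by apply: integD; [exact: integD|exact: integZ].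
Qed.

Lemma L2sM f g (C : R) : measurable_fun Omega g ->
  (forall x, Omega x -> `|g x| <= C) -> L2s f -> L2s (fun x => g x * f x).
Proof.
move=> mg gC [mf f2]; split; first exact: measurable_funM.
apply: (@integ_le (fun x => (g x * f x) ^+ 2) (fun x => C ^+ 2 * f x ^+ 2)).
- by apply: measurable_funX; exact: measurable_funM.
- exact: integZ.
move=> x Ox; have f0 := sqr_ge0 (f x).
have gC2 : g x ^+ 2 <= C ^+ 2.
  rewrite -[g x ^+ 2]real_normK ?num_real // ler_sqr ?nnegrE //; first exact: gC.
  by apply: le_trans (normr_ge0 _) (gC x Ox).
rewrite /= ger0_norm ?sqr_ge0 // ger0_norm; last by rewrite mulr_ge0 ?sqr_ge0.
by rewrite exprMn; apply: ler_wpM2r.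
Qed.

Lemma L2s_bounded f (C : R) : measurable_fun Omega f ->
  (forall x, Omega x -> `|f x| <= C) -> L2s f.
Proof.
move=> mf fC; split => //.
apply: (@integ_bounded (fun x => f x ^+ 2) (C ^+ 2)); first exact: measurable_funX.
move=> x Ox; rewrite normrX ler_sqr ?nnegrE ?fC //.
by apply: le_trans (normr_ge0 _) (fC x Ox).
Qed.

Lemma L2sZ (c : R) f : L2s f -> L2s (fun x => c * f x).
Proof. by apply: (L2sM (C := `|c|)) => //; exact: measurable_cst. Qed.

Lemma L2s_sum (I : Type) (s : seq I) (P : pred I) (f : I -> 'rV[R]_n -> R) :
  (forall i, L2s (f i)) -> L2s (fun x => \sum_(i <- s | P i) f i x).
Proof.
move=> Hf; elim: s => [|a s IH].
  have -> : (fun x => \sum_(i <- [::] | P i) f i x) = cst 0.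
    by apply/funext => x; rewrite big_nil.
  by apply: (L2s_bounded (C := 0)) => // x _; rewrite normr0.
have -> : (fun x => \sum_(i <- a :: s | P i) f i x) = fun x =>
    (if P a then 1 else 0) * f a x + \sum_(i <- s | P i) f i x.
  by apply/funext => x; rewrite big_cons; case: (P a); rewrite ?mul1r ?mul0r ?add0r.
by apply: L2sD => //; exact: L2sZ.
Qed.

Lemma L2s_integ f : L2s f -> integ f.
Proof.
move=> Hf; have : L2s (cst 1) by apply: (L2s_bounded (C := 1)) => // x _; rewrite normr1.
move=> /(L2s_integM Hf); apply: eq_integrable => // x _ /=; by rewrite mulr1.
Qed.

Lemma int_addf f g : integ f -> integ g ->
  \int[leb n]_(x in Omega) (f x + g x) =
  \int[leb n]_(x in Omega) f x + \int[leb n]_(x in Omega) g x.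
Proof. exact: RintegralD. Qed.

Lemma int_scalef (c : R) f : integ f ->
  \int[leb n]_(x in Omega) (c * f x) = c * \int[leb n]_(x in Omega) f x.
Proof. exact: RintegralZl. Qed.

Lemma int_ae f g : measurable_fun Omega f -> measurable_fun Omega g ->
  {ae leb n, forall x, Omega x -> f x = g x} ->
  \int[leb n]_(x in Omega) f x = \int[leb n]_(x in Omega) g x.
Proof.
move=> mf mg fg; rewrite /Rintegral; congr fine; apply: ae_eq_integral => //.
- exact/measurable_EFinP.
- exact/measurable_EFinP.
by apply: filterS fg => x /= H Ox; rewrite H.
Qed.

Lemma int_le f g : integ f -> integ g -> (forall x, Omega x -> f x <= g x) ->
  \int[leb n]_(x in Omega) f x <= \int[leb n]_(x in Omega) g x.
Proof. exact: le_Rintegral. Qed.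

Lemma int_ae_le f g : integ f -> integ g ->
  {ae leb n, forall x, Omega x -> f x <= g x} ->
  \int[leb n]_(x in Omega) f x <= \int[leb n]_(x in Omega) g x.
Proof.
move=> i_f i_g fg.
have mf := integ_measurable i_f; have mg := integ_measurable i_g.
(* The function max(f, g) equals g almost everywhere and dominates f everywhere, which reduces the
   claim to pointwise monotonicity. *)
rewrite (@int_ae g (fun x => Num.max (f x) (g x))) //.
- apply: int_le => //; last by move=> x _; rewrite le_max lexx.
  apply: (@integ_le _ (fun x => `|f x| + `|g x|)).
  + exact: measurable_maxr.
  + by apply: integD; exact: integrable_norm.
  + move=> x _; rewrite [leRHS]ger0_norm ?addr_ge0 //.
    by case: (leP (f x) (g x)) => _; rewrite ?lerDl ?lerDr.
- exact: measurable_maxr.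
by apply: filterS fg => x H Ox; rewrite max_r // H.
Qed.

Lemma int_eq0 f : integ f -> (forall x, Omega x -> 0 <= f x) ->
  \int[leb n]_(x in Omega) f x = 0 -> {ae leb n, forall x, Omega x -> f x = 0}.
Proof.
move=> i_f f0 int0.
have mf := integ_measurable i_f.
have : (\int[leb n]_(x in Omega) `|(f x)%:E| = 0)%E.
  rewrite (eq_integral (fun x => (f x)%:E)) => [|x]; last first.
    by rewrite inE => Ox; rewrite gee0_abs // lee_fin f0.
  have fin : (\int[leb n]_(x in Omega) (f x)%:E)%E \is a fin_num.
    exact: integrable_fin_num.
  by rewrite -(fineK fin); congr EFin.
move=> /(ae_eq_integral_abs _ mO) H.
have /H : measurable_fun Omega (EFin \o f) by exact/measurable_EFinP.
by apply: filterS => x /= Hx Ox; have [] := Hx Ox.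
Qed.

End square_integrable.

Section vector_L2.
Context {R : realType} {n : nat} (Omega : set 'rV[R]_n).
Hypotheses (oO : open Omega) (bO : bounded_set Omega).

Definition L2ip {p q : nat} (f g : 'rV[R]_n -> 'M[R]_(p, q)) : R :=
  \int[leb n]_(x in Omega) frob (f x) (g x).

Definition aeq {T : Type} (f g : 'rV[R]_n -> T) : Prop :=
  {ae leb n, forall x, Omega x -> f x = g x}.

Lemma aeq_refl {T : Type} (f : 'rV[R]_n -> T) : aeq f f.
Proof. exact/aeW. Qed.

Lemma L2_entry p q (f : 'rV[R]_n -> 'M[R]_(p, q)) i j :
  L2 Omega f -> L2s Omega (fun x => f x i j).
Proof. by move=> /(_ i j). Qed.

Lemma L2_integ_frob p q (f g : 'rV[R]_n -> 'M[R]_(p, q)) :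
  L2 Omega f -> L2 Omega g -> integ Omega (fun x => frob (f x) (g x)).
Proof.
move=> Hf Hg; rewrite /frob.
apply: (integ_sum oO) => i; apply: (integ_sum oO) => j.
by apply: (L2s_integM oO); exact: L2_entry.
Qed.

Lemma L2_lincomb p q (a : R) (f g : 'rV[R]_n -> 'M[R]_(p, q)) :
  L2 Omega f -> L2 Omega g -> L2 Omega (a *: f + g).
Proof.
move=> Hf Hg i j; rewrite -/(L2s Omega (fun x => (a *: f + g) x i j)).
have -> : (fun x => (a *: f + g) x i j) = (fun x => a * f x i j + g x i j).
  by apply/funext => x; rewrite !mxE.
by apply: (L2sD oO); [apply: (L2sZ oO)|]; exact: L2_entry.
Qed.

Lemma L2_zero p q : L2 Omega (0 : 'rV[R]_n -> 'M[R]_(p, q)).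
Proof.
move=> i j; apply: (@L2s_bounded _ _ _ oO bO _ 0).
  rewrite (_ : (fun _ => _) = cst 0); first exact: measurable_cst.
  by apply/funext => x; rewrite mxE.
by move=> x _; rewrite mxE normr0.
Qed.

Lemma L2ip_sip p q : semi_ip (L2 Omega (p := p) (q := q)) L2ip.
Proof.
split.
- exact: L2_zero.
- by move=> a u v; exact: L2_lincomb.
- move=> u v _ _; rewrite /L2ip; apply: eq_Rintegral => x _; exact: frobC.
- move=> a u v w Hu Hv Hw; rewrite /L2ip.
  have iu := L2_integ_frob Hu Hw; have iv := L2_integ_frob Hv Hw.
  rewrite -int_scalef // -int_addf //; last exact: integZ.
  by apply: eq_Rintegral => x _; rewrite /= frobDl frobZl.
- by move=> u _; apply: Rintegral_ge0 => x _; exact: frob_ge0.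
Qed.

Lemma L2norm_sipn p q (f : 'rV[R]_n -> 'M[R]_(p, q)) : L2norm Omega f = sipn L2ip f.
Proof. by []. Qed.

Lemma measurable_frob p q (f g : 'rV[R]_n -> 'M[R]_(p, q)) :
  L2 Omega f -> L2 Omega g -> measurable_fun Omega (fun x => frob (f x) (g x)).
Proof. by move=> Hf Hg; apply: integ_measurable; exact: L2_integ_frob. Qed.

Lemma L2ip_ae p q (f f' g g' : 'rV[R]_n -> 'M[R]_(p, q)) :
  L2 Omega f -> L2 Omega f' -> L2 Omega g -> L2 Omega g' ->
  aeq f f' -> aeq g g' -> L2ip f g = L2ip f' g'.
Proof.
move=> Hf Hf' Hg Hg' ff gg; apply: int_ae => //; try exact: measurable_frob.
by apply: filterS2 ff gg => x H1 H2 Ox; rewrite H1 // H2.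
Qed.

Lemma L2norm_eq0 p q (f : 'rV[R]_n -> 'M[R]_(p, q)) :
  L2 Omega f -> L2norm Omega f = 0 -> aeq f 0.
Proof.
move=> Hf f0; have : L2ip f f = 0.
  by rewrite -(sipn_sqr (@L2ip_sip p q)) // -L2norm_sipn f0 expr0n.
move=> /(int_eq0 oO (L2_integ_frob Hf Hf)) H.
have {}H := H (fun x _ => frob_ge0 _).
by apply: filterS H => x Hx Ox; apply: frob_eq0; exact: Hx.
Qed.

Lemma L2norm_ae0 p q (f : 'rV[R]_n -> 'M[R]_(p, q)) :
  L2 Omega f -> aeq f 0 -> L2norm Omega f = 0.
Proof.
move=> Hf f0; have H0 := @L2_zero p q.
rewrite /L2norm -/(L2ip f f) (L2ip_ae Hf H0 Hf H0 f0 f0).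
by rewrite (sip0l (@L2ip_sip p q)) ?sqrtr0.
Qed.

Lemma L2_linear p q p' q' (L : 'M[R]_(p, q) -> 'M[R]_(p', q'))
    (f : 'rV[R]_n -> 'M[R]_(p, q)) :
  linear L -> L2 Omega f -> L2 Omega (fun x => L (f x)).
Proof.
move=> HL Hf i j; rewrite -/(L2s Omega (fun x => L (f x) i j)).
have L0 : L 0 = 0.
  by apply: (addrI (L 0)); have := HL 1 0 0; rewrite !scale1r !addr0.
have LD u v : L (u + v) = L u + L v by have := HL 1 u v; rewrite !scale1r.
have LZ a u : L (a *: u) = a *: L u by have := HL a u 0; rewrite L0 !addr0.
have Lsum (I : Type) (s : seq I) (F : I -> 'M[R]_(p, q)) :
    L (\sum_(k <- s) F k) = \sum_(k <- s) L (F k).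
  by elim: s => [|k s IH]; rewrite ?big_nil // !big_cons LD IH.
have -> : (fun x => L (f x) i j) = (fun x => \sum_(k < p) \sum_(l < q)
    L (delta_mx k l) i j * f x k l).
  apply/funext => x; rewrite [in LHS](matrix_sum_delta (f x)) Lsum summxE.
  apply: eq_bigr => k _; rewrite Lsum summxE; apply: eq_bigr => l _.
  by rewrite LZ mxE mulrC.
apply: (L2s_sum oO bO) => k; apply: (L2s_sum oO bO) => l.
by apply: (L2sZ oO); exact: L2_entry.
Qed.

Lemma L2_mulb p q (m : 'rV[R]_n -> R) (C : R) (f : 'rV[R]_n -> 'M[R]_(p, q)) :
  measurable_fun Omega m -> (forall x, Omega x -> `|m x| <= C) ->
  L2 Omega f -> L2 Omega (fun x => m x *: f x).
Proof.
move=> mm mC Hf i j; rewrite -/(L2s Omega (fun x => (m x *: f x) i j)).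
have -> : (fun x => (m x *: f x) i j) = (fun x => m x * f x i j).
  by apply/funext => x; rewrite mxE.
by apply: (L2sM oO (C := C)) => //; exact: L2_entry.
Qed.

Lemma L2norm_le p q p' q' (C : R) (f : 'rV[R]_n -> 'M[R]_(p, q))
    (g : 'rV[R]_n -> 'M[R]_(p', q')) : 0 <= C -> L2 Omega f -> L2 Omega g ->
  {ae leb n, forall x, Omega x -> enorm (f x) <= C * enorm (g x)} ->
  L2norm Omega f <= C * L2norm Omega g.
Proof.
move=> C0 Hf Hg fg; rewrite -[C in leRHS]ger0_norm // -sqrtr_sqr.
rewrite /L2norm -sqrtrM ?sqr_ge0 // ler_wsqrtr //.
have i_f := L2_integ_frob Hf Hf; have i_g := L2_integ_frob Hg Hg.
rewrite -int_scalef //; apply: int_ae_le => //; first exact: integZ.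
apply: filterS fg => x H Ox; rewrite -!enorm_sqr -exprMn ler_sqr ?nnegrE ?H //.
  exact: enorm_ge0.
by rewrite mulr_ge0 ?enorm_ge0.
Qed.

Lemma L2norm_ge0 p q (f : 'rV[R]_n -> 'M[R]_(p, q)) : 0 <= L2norm Omega f.
Proof. exact: sqrtr_ge0. Qed.

Lemma L2ip_le p q (f g : 'rV[R]_n -> 'M[R]_(p, q)) : L2 Omega f -> L2 Omega g ->
  `|L2ip f g| <= L2norm Omega f * L2norm Omega g.
Proof. exact: (sip_csn (@L2ip_sip p q)). Qed.

Lemma L2norm_sqr p q (f : 'rV[R]_n -> 'M[R]_(p, q)) : L2 Omega f ->
  L2norm Omega f ^+ 2 = L2ip f f.
Proof. exact: (sipn_sqr (@L2ip_sip p q)). Qed.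

End vector_L2.

(** * Weak gradients and divergences *)

Section weak_derivatives.
Context {R : realType} {n : nat} (Omega : set 'rV[R]_n).
Hypotheses (oO : open Omega) (bO : bounded_set Omega).

Let mO : measurable Omega.
Proof. exact: open_measurable_rV. Qed.

Lemma continuous_L2s (f : 'rV[R]_n -> R) : continuous f -> L2s Omega f.
Proof.
move=> cf; have [M _ OM] := bounded_sub_cube bO.
have [C _ HC] := continuous_bounded_cube M cf.
apply: (L2s_bounded oO bO (C := C)) => [|x /OM]; last exact: HC.
exact: measurable_fun_continuous.
Qed.

Lemma test_L2s theta : test_fun Omega theta -> L2s Omega theta.
Proof. by move=> [/(_ [::])[ct _] _]; exact: continuous_L2s. Qed.

Lemma test_deriv_L2s theta j : test_fun Omega theta ->
  L2s Omega ('D_(delta_mx 0 j) theta).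
Proof. by move=> [/(_ [:: j])[ct _] _]; exact: continuous_L2s. Qed.

Lemma is_wgrad_lin p (a : R) (u v : 'rV[R]_n -> 'rV[R]_p) Gu Gv :
  L2 Omega u -> L2 Omega v -> L2 Omega Gu -> L2 Omega Gv ->
  is_wgrad Omega u Gu -> is_wgrad Omega v Gv ->
  is_wgrad Omega (a *: u + v) (a *: Gu + Gv).
Proof.
move=> Hu Hv HGu HGv wu wv i j theta tt.
have td := test_deriv_L2s j tt; have t2 := test_L2s tt.
have iu := L2s_integM oO (L2_entry 0 i Hu) td.
have iv := L2s_integM oO (L2_entry 0 i Hv) td.
have iGu := L2s_integM oO (L2_entry i j HGu) t2.
have iGv := L2s_integM oO (L2_entry i j HGv) t2.
under eq_Rintegral do rewrite !mxE mulrDl -mulrA.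
under [in RHS]eq_Rintegral do rewrite !mxE mulrDl -mulrA.
rewrite int_addf //; last exact: integZ.
rewrite [in RHS]int_addf //; last exact: integZ.
by rewrite !int_scalef // wu // wv //; ring.
Qed.

Lemma is_wdiv_lin (a : R) (s t : 'rV[R]_n -> 'M[R]_n) ds dt :
  L2 Omega s -> L2 Omega t -> L2 Omega ds -> L2 Omega dt ->
  is_wdiv Omega s ds -> is_wdiv Omega t dt ->
  is_wdiv Omega (a *: s + t) (a *: ds + dt).
Proof.
move=> Hs Ht Hds Hdt ws wt i theta tt.
have t2 := test_L2s tt.
have is_ : integ Omega (fun x => \sum_j s x i j * 'D_(delta_mx 0 j) theta x).
  apply: (integ_sum oO) => j; apply: (L2s_integM oO); last exact: test_deriv_L2s.
  exact: L2_entry.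
have it : integ Omega (fun x => \sum_j t x i j * 'D_(delta_mx 0 j) theta x).
  apply: (integ_sum oO) => j; apply: (L2s_integM oO); last exact: test_deriv_L2s.
  exact: L2_entry.
have ids := L2s_integM oO (L2_entry 0 i Hds) t2.
have idt := L2s_integM oO (L2_entry 0 i Hdt) t2.
rewrite (_ : (fun x => _) = fun x =>
    a * (\sum_j s x i j * 'D_(delta_mx 0 j) theta x) +
    \sum_j t x i j * 'D_(delta_mx 0 j) theta x); last first.
  apply/funext => x; rewrite mulr_sumr -big_split /=; apply: eq_bigr => j _.
  by rewrite !mxE; ring.
under [in RHS]eq_Rintegral do rewrite !mxE mulrDl -mulrA.
rewrite int_addf //; last exact: integZ.
rewrite [in RHS]int_addf //; last exact: integZ.
by rewrite !int_scalef // ws // wt //; ring.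
Qed.

Lemma weak_unique (f g : 'rV[R]_n -> R) : L2s Omega f -> L2s Omega g ->
  (forall theta, test_fun Omega theta ->
    \int[leb n]_(x in Omega) (f x * theta x) =
    \int[leb n]_(x in Omega) (g x * theta x)) ->
  {ae leb n, forall x, Omega x -> f x = g x}.
Proof.
move=> Hf Hg fg.
have Hfg : L2s Omega (fun x => -1 * g x + f x) by apply: (L2sD oO) => //; exact: L2sZ.
have : {ae leb n, forall x, Omega x -> -1 * g x + f x = 0}.
  apply: (fundamental_lemma oO (L2s_integ oO bO Hfg)) => theta tt.
  have t2 := test_L2s tt.
  have i_f := L2s_integM oO Hf t2; have i_g := L2s_integM oO Hg t2.
  under eq_Rintegral do rewrite mulrDl -mulrA.
  rewrite int_addf //; last exact: integZ.
  by rewrite int_scalef // fg //; ring.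
by apply: filterS => x H Ox; have := H Ox; lra.
Qed.

Lemma ae_matrix p q (f g : 'rV[R]_n -> 'M[R]_(p, q)) :
  (forall i j, {ae leb n, forall x, Omega x -> f x i j = g x i j}) -> aeq Omega f g.
Proof.
move=> H.
have : {ae leb n, forall x, forall ij : 'I_p * 'I_q,
    Omega x -> f x ij.1 ij.2 = g x ij.1 ij.2}.
  by apply: filter_forall => -[i j] /=; exact: H.
by apply: filterS => x Hx Ox; apply/matrixP => i j; exact: (Hx (i, j)).
Qed.

Lemma wgrad_unique p (v : 'rV[R]_n -> 'rV[R]_p) G G' :
  L2 Omega G -> L2 Omega G' -> is_wgrad Omega v G -> is_wgrad Omega v G' ->
  aeq Omega G G'.
Proof.
move=> HG HG' wG wG'; apply: ae_matrix => i j.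
apply: (weak_unique (L2_entry i j HG) (L2_entry i j HG')) => theta tt.
by apply: oppr_inj; rewrite -wG // -wG'.
Qed.

Lemma wdiv_unique (t : 'rV[R]_n -> 'M[R]_n) d d' :
  L2 Omega d -> L2 Omega d' -> is_wdiv Omega t d -> is_wdiv Omega t d' ->
  aeq Omega d d'.
Proof.
move=> Hd Hd' wd wd'; apply: ae_matrix => i j; rewrite (ord1 i).
apply: (weak_unique (L2_entry 0 j Hd) (L2_entry 0 j Hd')) => theta tt.
by apply: oppr_inj; rewrite -wd // -wd'.
Qed.

Lemma wgradP p (v : 'rV[R]_n -> 'rV[R]_p) : H1 Omega v ->
  L2 Omega (wgrad Omega v) /\ is_wgrad Omega v (wgrad Omega v).
Proof.
move=> [_ [G [HG wG]]].
by have := @getPex _ [set G | L2 Omega G /\ is_wgrad Omega v G]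
  (ex_intro _ G (conj HG wG)).
Qed.

Lemma wgrad_ae p (v : 'rV[R]_n -> 'rV[R]_p) G : H1 Omega v ->
  L2 Omega G -> is_wgrad Omega v G -> aeq Omega (wgrad Omega v) G.
Proof. by move=> /wgradP[? ?] HG wG; exact: wgrad_unique wG. Qed.

Definition Hdiv (t : 'rV[R]_n -> 'M[R]_n) : Prop :=
  L2 Omega t /\ exists d, L2 Omega d /\ is_wdiv Omega t d.

Lemma wdivP t : Hdiv t -> L2 Omega (wdiv Omega t) /\ is_wdiv Omega t (wdiv Omega t).
Proof.
move=> [_ [d [Hd wd]]].
by have := @getPex _ [set d | L2 Omega d /\ is_wdiv Omega t d]
  (ex_intro _ d (conj Hd wd)).
Qed.

Lemma wdiv_ae t d : Hdiv t -> L2 Omega d -> is_wdiv Omega t d ->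
  aeq Omega (wdiv Omega t) d.
Proof. by move=> /wdivP[? ?] Hd wd; exact: wdiv_unique wd. Qed.

Lemma H1_lin p a (u v : 'rV[R]_n -> 'rV[R]_p) : H1 Omega u -> H1 Omega v ->
  H1 Omega (a *: u + v) /\
  aeq Omega (wgrad Omega (a *: u + v)) (a *: wgrad Omega u + wgrad Omega v).
Proof.
move=> Hu Hv; have [Gu wu] := wgradP Hu; have [Gv wv] := wgradP Hv.
have [Lu _] := Hu; have [Lv _] := Hv.
have HG : L2 Omega (a *: wgrad Omega u + wgrad Omega v) by exact: L2_lincomb.
have wG := is_wgrad_lin a Lu Lv Gu Gv wu wv.
have Huv : H1 Omega (a *: u + v).
  by split; [exact: L2_lincomb|exists (a *: wgrad Omega u + wgrad Omega v)].
by split => //; exact: wgrad_ae.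
Qed.

Lemma Hdiv_lin a (s t : 'rV[R]_n -> 'M[R]_n) : Hdiv s -> Hdiv t ->
  Hdiv (a *: s + t) /\
  aeq Omega (wdiv Omega (a *: s + t)) (a *: wdiv Omega s + wdiv Omega t).
Proof.
move=> Hs Ht; have [Ds ws] := wdivP Hs; have [Dt wt] := wdivP Ht.
have [Ls _] := Hs; have [Lt _] := Ht.
have HD : L2 Omega (a *: wdiv Omega s + wdiv Omega t) by exact: L2_lincomb.
have wD := is_wdiv_lin a Ls Lt Ds Dt ws wt.
have Hst : Hdiv (a *: s + t).
  by split; [exact: L2_lincomb|exists (a *: wdiv Omega s + wdiv Omega t)].
by split => //; exact: wdiv_ae.
Qed.

(** Zero is a weak gradient of a null function, so by uniqueness the chosen gradient is null as
    well. Thus functions that are zero almost everywhere have zero norm, which lets finite dimension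
    be read off piecewise coefficients. *)
Lemma H1_ae0 p (v : 'rV[R]_n -> 'rV[R]_p) : L2 Omega v -> aeq Omega v 0 ->
  H1 Omega v /\ aeq Omega (wgrad Omega v) 0.
Proof.
move=> Lv v0.
have w0 : is_wgrad Omega v (0 : 'rV[R]_n -> 'M[R]_(p, n)).
  move=> i j theta tt.
  under [in RHS]eq_Rintegral do rewrite mxE mul0r.
  rewrite (int_ae oO (g := fun=> 0)); first by rewrite Rintegral_cst // !mul0r oppr0.
  - apply: integ_measurable; apply: (L2s_integM oO); first exact: L2_entry.
    exact: test_deriv_L2s.
  - exact: measurable_cst.
  by apply: filterS v0 => x H Ox; rewrite H // mxE mul0r.
have L0 := @L2_zero _ _ _ oO bO p n.
have Hv : H1 Omega v by split => //; exists 0.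
by split => //; exact: wgrad_ae.
Qed.

Lemma Hdiv_ae0 (t : 'rV[R]_n -> 'M[R]_n) : L2 Omega t -> aeq Omega t 0 ->
  Hdiv t /\ aeq Omega (wdiv Omega t) 0.
Proof.
move=> Lt t0.
have w0 : is_wdiv Omega t (0 : 'rV[R]_n -> 'rV[R]_n).
  move=> i theta tt.
  under [in RHS]eq_Rintegral do rewrite mxE mul0r.
  rewrite (int_ae oO (g := fun=> 0)); first by rewrite Rintegral_cst // !mul0r oppr0.
  - apply: integ_measurable; apply: (integ_sum oO) => j; apply: (L2s_integM oO).
      exact: L2_entry.
    exact: test_deriv_L2s.
  - exact: measurable_cst.
  apply: filterS t0 => x H Ox; rewrite H // big1 // => j _; by rewrite mxE mul0r.
have L0 := @L2_zero _ _ _ oO bO 1 n.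
have Ht : Hdiv t by split => //; exists 0.
by split => //; exact: wdiv_ae.
Qed.

Definition H1ip {p} (u v : 'rV[R]_n -> 'rV[R]_p) : R :=
  L2ip Omega u v + L2ip Omega (wgrad Omega u) (wgrad Omega v).

Lemma H1ip_sip p : semi_ip (H1 Omega (p := p)) H1ip.
Proof.
have S0 := L2ip_sip oO bO 1 p; have S1 := L2ip_sip oO bO p n.
split.
- by have [] := H1_ae0 (@L2_zero _ _ _ oO bO 1 p) (aeq_refl _ _).
- by move=> a u v Hu Hv; have [] := H1_lin a Hu Hv.
- move=> u v Hu Hv; have [Gu _] := wgradP Hu; have [Gv _] := wgradP Hv.
  have [Lu _] := Hu; have [Lv _] := Hv.
  by rewrite /H1ip (sipC S0 Lu Lv) (sipC S1 Gu Gv).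
- move=> a u v w Hu Hv Hw; have [Gu _] := wgradP Hu; have [Gv _] := wgradP Hv.
  have [Gw _] := wgradP Hw; have [Lu _] := Hu; have [Lv _] := Hv; have [Lw _] := Hw.
  have [Huv E] := H1_lin a Hu Hv; have [Guv _] := wgradP Huv.
  have GL : L2 Omega (a *: wgrad Omega u + wgrad Omega v) by exact: L2_lincomb.
  rewrite /H1ip (sipL S0 a Lu Lv Lw).
  rewrite (L2ip_ae oO Guv GL Gw Gw E (aeq_refl _ _)) (sipL S1 a Gu Gv Gw).
  by rewrite mulrDr addrACA.
- move=> u Hu; have [Gu _] := wgradP Hu; have [Lu _] := Hu.
  by apply: addr_ge0; [exact: (sip_ge0 S0 Lu)|exact: (sip_ge0 S1 Gu)].
Qed.

Lemma H1norm_sipn p (u : 'rV[R]_n -> 'rV[R]_p) : H1 Omega u ->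
  H1norm Omega u = sipn H1ip u.
Proof.
move=> Hu; have [Gu _] := wgradP Hu; have [Lu _] := Hu.
by rewrite /H1norm /H1semi !(L2norm_sqr oO bO).
Qed.

Lemma L2norm_le_H1 p (u : 'rV[R]_n -> 'rV[R]_p) : L2norm Omega u <= H1norm Omega u.
Proof.
by rewrite /H1norm -[leLHS]ger0_norm ?L2norm_ge0 // -sqrtr_sqr ler_wsqrtr // lerDl sqr_ge0.
Qed.

Lemma H1semi_le_H1 p (u : 'rV[R]_n -> 'rV[R]_p) : H1semi Omega u <= H1norm Omega u.
Proof.
by rewrite /H1norm -[leLHS]ger0_norm ?L2norm_ge0 // -sqrtr_sqr ler_wsqrtr // lerDr sqr_ge0.
Qed.

End weak_derivatives.

(** * Continuous piecewise polynomials are H^1 functions *)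

Section simplex_geometry.
Context {R : realType} {n : nat}.
Implicit Types (S : seq 'rV[R]_n).

Lemma hull_param S (x : 'rV[R]_n) : S <> [::] ->
  hull S x <-> exists2 t, ref_simplex t & x = param S t.
Proof.
case: S => [//|s0 s] _; rewrite /hull /param /ref_simplex /=.
have combE (l : 'I_(size s).+1 -> R) : \sum_i l i = 1 ->
    \sum_i l i *: (s0 :: s)`_i = s0 + (\row_i l (lift ord0 i)) *m edge_mx (s0 :: s).
  move=> l1; rewrite big_ord_recl /= mulmx_sum_row.
  have rowE (i : 'I_(size s)) : row i (edge_mx (s0 :: s)) = s`_i - s0.
    by apply/rowP => j; rewrite !mxE.
  rewrite [in RHS](eq_bigr (fun i => l (lift ord0 i) *: s`_i - l (lift ord0 i) *: s0)); last first.
    by move=> i _; rewrite rowE mxE scalerBr.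
  have -> : l ord0 = 1 - \sum_(i < size s) l (lift ord0 i).
    by rewrite -l1 big_ord_recl addrK.
  by rewrite sumrB -scaler_suml scalerBl scale1r addrAC addrA.
split.
  move=> [l [l0 l1 ->]]; exists (\row_i l (lift ord0 i)); last exact: combE.
  split => [i|]; first by rewrite mxE.
  under eq_bigr do rewrite mxE.
  by rewrite -l1 big_ord_recl lerDr.
move=> [t [t0 t1] ->].
pose l (i : 'I_(size s).+1) : R :=
  if unlift ord0 i is Some j then t 0 j else 1 - \sum_j t 0 j.
have l1 : \sum_i l i = 1.
  rewrite big_ord_recl {1}/l unlift_none.
  by under [X in _ + X]eq_bigr do rewrite /l liftK; rewrite subrK.
exists l; split => // [i|].
  by rewrite /l; case: unlift => [j|]; rewrite ?t0 // subr_ge0.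
rewrite combE //; congr (_ + _ *m _); apply/rowP => i.
by rewrite mxE /l liftK.
Qed.

(** The affine functions are the barycentric coordinates: [Some j] stands for vertex j + 1 and
    [None] for vertex 0. None of them is constant, because each takes different values at two
    vertices; this gives the nonzero normals. *)
Lemma hull_halfspaces S : (0 < n)%N -> size S = n.+1 -> affine_indep S ->
  exists (I : finType) (a : I -> 'rV[R]_n) (b : I -> R),
    (forall i, a i != 0) /\ hull S = [set x | forall i, 0 <= frob (a i) x + b i].
Proof.
move=> n0 sS [S0 free].
have szS : (size S).-1 = n by rewrite sS.
set E := edge_mx S in free.
(* The edge matrix is square only after rewriting (size S).-1 into n; the pseudo-inverse provides
   both inverse identities without a cast. *)
pose P := pinvmx E.
have EP : E *m P = 1%:M by exact: mulmxVp.
have full : row_full E by rewrite /row_full -[X in _ == X]szS.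
have PE : P *m E = 1%:M by exact: mulVpmx.
pose a (i : option 'I_(size S).-1) : 'rV[R]_n :=
  if i is Some j then (col j P)^T else - \sum_j (col j P)^T.
pose b (i : option 'I_(size S).-1) : R := - frob (a i) S`_0 + (i == None)%:R.
have tE (x : 'rV[R]_n) j : ((x - S`_0) *m P) 0 j = frob (a (Some j)) x + b (Some j).
  have E1 (y : 'rV[R]_n) : (y *m P) 0 j = frob (a (Some j)) y.
    by rewrite frob_row mxE; apply: eq_bigr => i _; rewrite !mxE mulrC.
  by rewrite mulmxBl mxE [X in _ + X]mxE !E1 /b addr0.
have tN (x : 'rV[R]_n) : 1 - \sum_j ((x - S`_0) *m P) 0 j = frob (a None) x + b None.
  rewrite /b eqxx (eq_bigr (fun j => frob (a (Some j)) x + b (Some j))) //.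
  rewrite big_split /= /b.
  have aN (y : 'rV[R]_n) : frob (a None) y = - \sum_j frob (a (Some j)) y.
    rewrite frobC /a -scaleN1r frobZr mulN1r; congr (- _).
    rewrite (big_morph (frob y) (frobDr y) (_ : frob y 0 = 0)).
      by apply: eq_bigr => j _; rewrite frobC.
    by rewrite -(scale0r 0) frobZr mul0r.
  rewrite !aN opprK; under [X in - (_ + X)]eq_bigr do rewrite addr0.
  by rewrite sumrN mulr1n; ring.
have rowEP j : (S`_0 + row j E - S`_0) *m P = row j 1%:M.
  by rewrite addrAC subrr add0r -row_mul EP.
have f0 (y : 'rV[R]_n) : frob 0 y = 0 by exact: (sip0l (@frob_sip R 1 n)).
have j0 : 'I_(size S).-1 by rewrite szS; exact: Ordinal n0.
exists _, a, b; split.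
  case=> [j|]; apply/eqP => aj0.
    have := tE (S`_0 + row j E) j; rewrite rowEP aj0 f0 add0r !mxE eqxx.
    have := tE S`_0 j; rewrite aj0 f0 add0r subrr mul0mx mxE => <- /eqP.
    by rewrite oner_eq0.
  have := tN (S`_0 + row j0 E); have := tN S`_0.
  rewrite aj0 !f0 !add0r subrr mul0mx big1 ?subr0 => [<-|i _]; last by rewrite mxE.
  rewrite rowEP (bigD1 j0) //= big1 => [|i ij]; last first.
    by rewrite !mxE eq_sym (negPf ij).
  by rewrite !mxE eqxx addr0 subrr => /esym/eqP; rewrite oner_eq0.
have xE (x : 'rV[R]_n) t : x = param S t -> (x - S`_0) *m P = t.
  by move=> ->; rewrite /param addrAC subrr add0r -mulmxA EP mulmx1.
apply/seteqP; split => x.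
  move=> /(hull_param _ S0)[t [t0 t1] /xE xt] [j|]; first by rewrite -tE xt.
  by rewrite -tN xt subr_ge0.
move=> H; apply/(hull_param _ S0); exists ((x - S`_0) *m P).
  split => [j|]; first by rewrite tE; exact: H.
  by rewrite -subr_ge0 tN; exact: H.
by rewrite /param -mulmxA PE mulmx1 addrC subrK.
Qed.

End simplex_geometry.

Lemma near_gt {R : realType} (X : topologicalType) (f : X -> R) (c : R) (x : X) :
  continuous f -> c < f x -> \forall y \near x, c < f y.
Proof. by move=> cf cx; apply: (cvgr_gt _ (cf x)). Qed.

Section simplex_measure.
Context {R : realType} {n : nat} (n0 : (0 < n)%N).
Implicit Types (S : seq 'rV[R]_n).

Lemma continuous_affine (a : 'rV[R]_n) (b : R) : continuous (fun x => frob a x + b).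
Proof.
apply: continuous_addf; last exact: cst_continuous.
by apply: continuous_frob; [exact: cst_continuous|move=> ?; exact: cvg_id].
Qed.

Lemma closed_hull S : size S = n.+1 -> affine_indep S -> closed (hull S).
Proof.
move=> sS /(hull_halfspaces n0 sS)[I [a [b [_ ->]]]].
rewrite (_ : [set x | _] = \bigcap_i [set x | 0 <= frob (a i) x + b i]).
  apply: closed_bigI => i _; apply: (closed_le_fun (f := cst 0)).
    exact: cst_continuous.
  exact: continuous_affine.
by apply/seteqP; split => x H i; [move=> _|]; exact: H.
Qed.

Lemma hull_convex_line S (x v : 'rV[R]_n) (s t u : R) :
  size S = n.+1 -> affine_indep S -> s <= t <= u ->
  hull S (x + s *: v) -> hull S (x + u *: v) -> hull S (x + t *: v).
Proof.
move=> sS /(hull_halfspaces n0 sS)[I [a [b [_ ->]]]] /andP[st tu] Hs Hu i.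
have := Hs i; have := Hu i; rewrite !frobDr !frobZr.
have [sv|sv] := lerP 0 (frob (a i) v).
  by move=> _ H; apply: le_trans H _; rewrite lerD2r lerD2l ler_wpM2r.
by move=> H _; apply: le_trans H _; rewrite lerD2r lerD2l ler_wnM2r // ltW.
Qed.

(** Where all barycentric coordinates are positive they stay positive nearby, so a non-interior
    point of the simplex lies on one of finitely many hyperplanes. *)
Lemma hull_boundary_null S : size S = n.+1 -> affine_indep S ->
  (leb n).-negligible (hull S `\` interior (hull S)).
Proof.
move=> sS /(hull_halfspaces n0 sS)[I [a [b [a0 hE]]]].
have mN i : measurable [set x : 'rV[R]_n | frob (a i) x = - b i].
  apply: closed_measurable_rV; apply: (closed_eq_fun (g := cst (- b i))).
    by apply: continuous_frob; [exact: cst_continuous|move=> ?; exact: cvg_id].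
  exact: cst_continuous.
have neg : (leb n).-negligible (\bigcup_(i in [set: I]) [set x | frob (a i) x = - b i]).
  rewrite (_ : \bigcup_(i in _) _ =
      \bigcup_k (if @unpickle I k is Some i then [set x | frob (a i) x = - b i] else set0)).
    apply: negligible_bigcup => k; case: unpickle => [i|]; last exact: negligible_set0.
    by exists [set x | frob (a i) x = - b i]; split => //; exact: leb_affine_null.
  apply/seteqP; split => x [i _ xi]; first by exists (pickle i) => //; rewrite pickleK.
  by move: xi; case: unpickle => [j xj|//]; exists j.
apply: negligibleS neg => x [xS xI]; apply: contrapT => H; apply: xI.
have pos i : 0 < frob (a i) x + b i.
  rewrite lt_def; apply/andP; split; last by move: xS; rewrite hE => /(_ i).
  apply/eqP => E0; apply: H; exists i => //=.
  by apply/eqP; rewrite -subr_eq0 opprK E0.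
have near_pos i : \forall y \near x, 0 < frob (a i) y + b i.
  exact: (near_gt (@continuous_affine (a i) (b i)) (pos i)).
have near_all : \forall y \near x, forall i, 0 < frob (a i) y + b i.
  exact: filter_forall near_pos.
by rewrite /interior hE; apply: filterS near_all => y Hy i; exact: ltW.
Qed.

End simplex_measure.

(** * Lipschitz bounds along segments covered by finitely many cells *)

Section lipschitz_on_covered_segments.
Context {R : realType} (T : choiceType).

(** Induction on the number of closed sets, which may meet the segment in any pattern. A set
    containing a is left for good at the last point t where it meets [a, b]; the bound on that set
    applies to the pair a, t at once, and [t, b] is covered by the remaining sets. *)
Lemma lipschitz_covered_segment (C : T -> set R) (s : seq T) (L a b : R) (g : R -> R) :
  0 <= L -> a <= b ->
  (forall K, K \in s -> closed (C K)) ->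
  (forall K, K \in s -> forall x y, a <= x <= b -> a <= y <= b -> C K x -> C K y ->
    `|g x - g y| <= L * `|x - y|) ->
  (forall x, a <= x <= b -> exists2 K, K \in s & C K x) ->
  `|g b - g a| <= L * (b - a).
Proof.
move=> L0; move: {2}(size s) (leqnn (size s)) => m.
elim: m s a => [|m IH] s a sm ab cC gL cov.
  have [|K] := cov a; first by rewrite lexx.
  by move: sm; rewrite leqn0 size_eq0 => /eqP ->.
have [|K Ks Ka] := cov a; first by rewrite lexx.
pose A := C K `&` [set x | a <= x <= b].
have A0 : A !=set0 by exists a; split => //=; rewrite lexx.
have Ab : has_sup A by split => //; exists b => x [_ /andP[]].
pose t := sup A.
have cA : closed A.
  apply: closedI; first exact: cC.
  rewrite (_ : [set x | _] = `[a, b]%classic); first exact: interval_closed.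
  by apply/seteqP; split => x; rewrite /= in_itv.
have At : A t by rewrite (closure_id A).1 //; apply: closure_sup => //; case: Ab.
have [Kt /andP[at_ tb]] := At.
have gta : `|g t - g a| <= L * (t - a).
  have := gL K Ks t a; rewrite at_ tb lexx ab => /(_ isT isT Kt Ka).
  by rewrite (ger0_norm (_ : 0 <= t - a)) // subr_ge0.
have [tb'|] := ltP t b; last by move=> bt; have -> : b = t by apply/eqP; rewrite eq_le bt.
pose s' := [seq J <- s | J != K].
have s's J : J \in s' -> J \in s by rewrite mem_filter => /andP[].
have cov' x : t < x <= b -> exists2 J, J \in s' & C J x.
  move=> /andP[tx xb]; have ax : a <= x by exact: le_trans at_ (ltW tx).
  have [|J Js Jx] := cov x; first by rewrite ax.
  exists J => //; rewrite mem_filter Js andbT; apply/eqP => JK.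
  have : x <= t by apply: ub_le_sup => //; [case: Ab|split => //=; [rewrite -JK|rewrite ax]].
  by rewrite leNgt tx.
have cl : closed (\bigcup_(J in [set` s']) C J).
  by apply: closed_bigcup => [|J /s's]; [exact: finite_seq|exact: cC].
(* Points just beyond t belong to the remaining sets, whose finite union is closed, so t does
   too. *)
have covt : exists2 J, J \in s' & C J t.
  suff [J Js Jt] : (\bigcup_(J in [set` s']) C J) t by exists J.
  apply: cl => U /nbhs_ballP[e /= e0 eU].
  pose x := Num.min b (t + e / 2).
  have tx : t < x by rewrite lt_min tb' ltrDl divr_gt0.
  have xb : x <= b by rewrite ge_min lexx.
  have [|J Js Jx] := cov' x; first by rewrite tx.
  exists x; split; first by exists J.
  apply: eU; rewrite /ball /= ltr0_norm ?subr_lt0 // opprB ltrBlDr addrC.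
  apply: (@le_lt_trans _ _ (t + e / 2)); first by rewrite ge_min lexx orbT.
  by rewrite ltrD2l; lra.
have gbt : `|g b - g t| <= L * (b - t).
  apply: (IH s') => //.
  - rewrite -ltnS; apply: leq_trans sm; rewrite size_filter -(count_predC (pred1 K) s).
    by rewrite -[ltnLHS]add0n ltn_add2r -has_count has_pred1.
  - by move=> J /s's; exact: cC.
  - move=> J /s's Js x y /andP[tx xb] /andP[ty yb]; apply: (gL J Js).
      by rewrite xb (le_trans at_).
    by rewrite yb (le_trans at_).
  - move=> x /andP[]; rewrite le_eqVlt => /orP[/eqP <- _|tx xb]; first exact: covt.
    by apply: cov'; rewrite tx.
have -> : g b - g a = (g b - g t) + (g t - g a) by rewrite addrA subrK.
apply: le_trans (ler_normD _ _) _.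
have -> : L * (b - a) = L * (b - t) + L * (t - a) by ring.
exact: lerD.
Qed.

End lipschitz_on_covered_segments.

Section line_derivatives.
Context {R : realType}.

Lemma is_derive_along_line (V : normedModType R) (F : V -> R) (x v : V) (u l : R) :
  is_derive (x + u *: v) v F l -> is_derive u (1 : R) (fun h : R => F (x + h *: v)) l.
Proof.
have E : (fun h : R => h^-1 *: (((fun h : R => F (x + h *: v)) \o shift u) (h *: 1)
      - F (x + u *: v))) =
    (fun h : R => h^-1 *: ((F \o shift (x + u *: v)) (h *: v) - F (x + u *: v))).
  apply/funext => h /=; rewrite [h *: 1]mulr1 scalerDl.
  by rewrite addrCA.
move=> [dF vF]; split; first by rewrite /derivable E.
by rewrite -vF /derive E.
Qed.

Lemma mvt_line (V : normedModType R) (F DF : V -> R) (x v : V) (a b C : R) : a <= b ->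
  (forall s, a <= s <= b -> is_derive (x + s *: v) v F (DF (x + s *: v))) ->
  (forall s, a <= s <= b -> `|DF (x + s *: v)| <= C) ->
  `|F (x + b *: v) - F (x + a *: v)| <= C * (b - a).
Proof.
move=> ab dF DC; pose phi (s : R) := F (x + s *: v).
have dphi s : a <= s <= b -> is_derive s (1 : R) phi (DF (x + s *: v)).
  by move=> /dF; exact: is_derive_along_line.
have [||c] := @MVT_segment R phi (fun s => DF (x + s *: v)) a b ab.
- by move=> s; rewrite in_itv /= => /andP[? ?]; apply: dphi; rewrite !ltW.
- apply: derivable_within_continuous => s; rewrite in_itv /= => sab.
  by have [] := dphi s sab.
rewrite in_itv /= => cab; rewrite /phi => ->; rewrite normrM.
rewrite [X in _ * X]ger0_norm ?subr_ge0 // ler_wpM2r ?subr_ge0 //; exact: DC.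
Qed.

Lemma derive_line_cvg (V : normedModType R) (F : V -> R) (x v : V) (l : R) (u : nat -> R) :
  is_derive x v F l -> u @ \oo --> (0 : R) -> (forall m, u m != 0) ->
  (fun m => (u m)^-1 * (F (x + u m *: v) - F x)) @ \oo --> l.
Proof.
move=> [dF vF] u0 un0.
have u0' : u @ \oo --> (0 : R)^'.
  move=> A; rewrite /dnbhs /= /within /= => /u0 H.
  exact: (@filterS _ \oo _ _ _ (fun m (P : u m != 0 -> A (u m)) => P (un0 m)) H).
have lim : (fun h : R => h^-1 *: ((F \o shift x) (h *: v) - F x)) @ 0^' --> l.
  by rewrite -vF; exact: dF.
have := cvg_comp _ _ u0' lim; apply: cvg_trans; apply: near_eq_cvg; apply: nearW => m /=.
by rewrite [u m *: v + x]addrC.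
Qed.

End line_derivatives.

Section integrals_on_rows.
Context {R : realType} {n : nat}.

Lemma Rdominated (D : set 'rV[R]_n) (f_ : nat -> 'rV[R]_n -> R) (f g : 'rV[R]_n -> R) :
  measurable D -> (forall m, measurable_fun D (f_ m)) -> measurable_fun D f ->
  {ae leb n, forall x, D x -> f_ ^~ x @ \oo --> f x} ->
  integ D g ->
  (forall m x, D x -> `|f_ m x| <= g x) ->
  (fun m => \int[leb n]_(x in D) f_ m x) @ \oo --> \int[leb n]_(x in D) f x.
Proof.
move=> mD mf_ mf cv ig dom.
have mE m : measurable_fun D (EFin \o f_ m) by exact/measurable_EFinP.
have mfE : measurable_fun D (EFin \o f) by exact/measurable_EFinP.
have cvE : {ae leb n, forall x, D x -> (EFin \o f_ m) x @[m --> \oo] --> (EFin \o f) x}.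
  apply: filterS cv => x H Dx; apply/fine_cvgP; split; first exact: nearW.
  exact: H.
have domE : {ae leb n, forall x m, D x -> (`|(EFin \o f_ m) x| <= (EFin \o g) x)%E}.
  by apply: aeW => x m Dx; rewrite /= lee_fin; exact: dom.
have [i_f _ lim] := @dominated_convergence _ _ _ (leb n) D mD (fun m => EFin \o f_ m)
  (EFin \o f) (EFin \o g) mE mfE cvE ig domE.
apply: fine_cvg; rewrite /Rintegral fineK //.
exact: integrable_fin_num.
Qed.

Lemma Rint_translate (v : 'rV[R]_n) (f : 'rV[R]_n -> R) : integ [set: 'rV[R]_n] f ->
  integ [set: 'rV[R]_n] (fun x => f (x + v)) ->
  \int[leb n]_x f (x + v) = \int[leb n]_x f x.
Proof.
move=> i_f i_fv; rewrite /Rintegral; congr fine.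
have mv : measurable_fun [set: 'rV[R]_n] (fun y : 'rV[R]_n => y + v).
  apply: measurable_mx => i j; under eq_fun do rewrite mxE.
  by apply: measurable_funD => //; exact: measurable_entry.
have mf : measurable_fun [set: 'rV[R]_n] (EFin \o f) by exact: measurable_int i_f.
transitivity (\int[pushforward (leb n) (fun y => (y + v)%R)]_y (f y)%:E)%E.
  by rewrite (integral_pushforward mv mf).
by apply: eq_measure_integral => B mB _; exact: leb_translate.
Qed.

Lemma closed_cube_rV (M : R) : closed (@cube_rV R n M).
Proof.
rewrite (_ : @cube_rV R n M = \bigcap_i [set x : 'rV[R]_n | `|x 0 i| <= M]).
  apply: closed_bigI => i _; apply: (closed_le_fun (g := cst M)).
    exact: continuous_abs_coord.
  exact: cst_continuous.
by apply/seteqP; split => y yc i; [move=> _|]; exact: yc.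
Qed.

Lemma compact_thicken (Omega K : set 'rV[R]_n) (e : 'rV[R]_n) : open Omega ->
  compact K -> K `<=` Omega ->
  exists2 d : R, 0 < d & forall x s, K x -> `|s| < d -> Omega (x + s *: e).
Proof.
move=> oO /compact_near_coveringP cK KO.
have : \forall s \near (0 : R), K `<=` (fun x => Omega (x + s *: e)).
  apply: (cK R (nbhs (0 : R)) (fun s x => Omega (x + s *: e))) => x /KO Ox.
  have /nbhs_ballP[r /= r0 rO] : nbhs x Omega by apply: open_nbhs_nbhs.
  pose d := r / 2 / (`|e| + 1).
  have e1 : 0 < `|e| + 1 by rewrite ltr_wpDl.
  have d0 : 0 < d by rewrite !divr_gt0.
  exists (ball x (r / 2), ball (0 : R) d) => /=.
    by split; apply: nbhsx_ballx => //; rewrite divr_gt0.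
  move=> -[y s] /= [yx s0]; apply: rO; rewrite -ball_normE /= in yx *.
  have -> : x - (y + s *: e) = (x - y) - s *: e by rewrite opprD addrA.
  apply: le_lt_trans (ler_normB _ _) _; rewrite (splitr r); apply: ltrD => //.
  rewrite normrZ; move: s0; rewrite /ball /= sub0r normrN => s0.
  apply: (@le_lt_trans _ _ (`|s| * (`|e| + 1))); first by rewrite ler_wpM2l // lerDl.
  by rewrite -ltr_pdivlMr.
move=> /nbhs_ballP[d /= d0 dP]; exists d => // x s Kx sd.
by apply: (dP s) => //; rewrite /ball /= sub0r normrN.
Qed.

End integrals_on_rows.

(** * Weak derivatives of continuous piecewise smooth functions *)

Section piecewise_smooth.
Context {R : realType} {n : nat} (n0 : (0 < n)%N) (Omega : set 'rV[R]_n).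
Hypotheses (oO : open Omega) (bO : bounded_set Omega).
Variable T : seq (seq 'rV[R]_n).
Hypothesis hT : forall K, K \in T -> size K = n.+1 /\ affine_indep K.
Hypothesis cov : closure Omega = \bigcup_(K in [set` T]) hull K.

Let mO : measurable Omega.
Proof. exact: open_measurable_rV. Qed.

Lemma cover_hull x : Omega x -> exists2 K, K \in T & hull K x.
Proof.
by move=> /(@subset_closure _ Omega); rewrite cov => -[K KT Kx]; exists K.
Qed.

Lemma hull_in_cube : exists2 M : R, 0 < M &
  Omega `<=` @cube_rV R n M /\ forall K, K \in T -> hull K `<=` @cube_rV R n M.
Proof.
have [M M0 OM] := bounded_sub_cube bO; exists M => //; split => // K KT x Kx.
have : closure Omega x by rewrite cov; exists K.
by move/(closure_subset OM); rewrite -(closure_id _).1 //; exact: closed_cube_rV.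
Qed.

Lemma ae_interior : {ae leb n, forall x, Omega x ->
  exists2 K, K \in T & interior (hull K) x}.
Proof.
have neg : (leb n).-negligible
    (\bigcup_k ((hull (nth [::] T k) `\` interior (hull (nth [::] T k))) `&` [set x | (k < size T)%N])).
  apply: negligible_bigcup => k; have [kT|kT] := ltnP k (size T).
    have [sK aK] := hT (mem_nth [::] kT).
    by apply: negligibleS (hull_boundary_null n0 sK aK) => x [].
  by apply: negligibleS (negligible_set0 _) => x [].
apply: negligibleS neg => x /= H.
have [Ox nI] : Omega x /\ ~ exists2 K, K \in T & interior (hull K) x.
  by split; apply: contrapT => H'; apply: H => // Ox; apply: contrapT => /H'.
have [K KT Kx] := cover_hull Ox.
exists (index K T) => //; split; last by rewrite /= index_mem.
rewrite nth_index //; split => // KI; apply: nI; by exists K.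
Qed.

(** The first listed cell whose interior contains x decides, and the value is 0 if there is none.
    Writing the choice with indicators makes measurability immediate; cell boundaries are null sets,
    so their values do not affect integrals. *)
Fixpoint piecewise (s : seq (seq 'rV[R]_n)) (F : seq 'rV[R]_n -> 'rV[R]_n -> R)
    (x : 'rV[R]_n) : R :=
  if s is K :: s' then
    \1_(interior (hull K)) x * F K x +
    (1 - \1_(interior (hull K)) x) * piecewise s' F x
  else 0.

Lemma piecewise_eq s F x : (exists2 K, K \in s & interior (hull K) x) ->
  exists K, [/\ K \in s, interior (hull K) x & piecewise s F x = F K x].
Proof.
elim: s => [[K]//|K s IH] /= [J Js Jx].
have [Kx|Kx] := pselect (interior (hull K) x).
  exists K; split; [exact: mem_head|by []|].
  by rewrite indicE mem_set // mulr1n subrr mul1r mul0r addr0.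
have [|J' [J's J'x ->]] := IH.
  exists J => //; move: Js; rewrite in_cons => /orP[/eqP JK|//].
  by rewrite JK in Jx.
exists J'; split => //; first by rewrite in_cons J's orbT.
by rewrite indicE memNset // mulr0n mul0r subr0 mul1r add0r.
Qed.

Lemma measurable_piecewise s F : (forall K, measurable_fun [set: 'rV[R]_n] (F K)) ->
  measurable_fun [set: 'rV[R]_n] (piecewise s F).
Proof.
move=> mF; elim: s => [|K s IH] /=; first exact: measurable_cst.
have mI : measurable_fun [set: 'rV[R]_n] (\1_(interior (hull K)) : _ -> R).
  by apply: measurable_indic; apply: open_measurable_rV; exact: open_interior.
apply: measurable_funD; first exact: measurable_funM.
by apply: measurable_funM => //; apply: measurable_funB.
Qed.

Lemma piecewise_bounded s F (C : R) x : 0 <= C -> (forall K, K \in s -> `|F K x| <= C) ->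
  `|piecewise s F x| <= C.
Proof.
move=> C0; elim: s => [_|K s IH FC] /=; first by rewrite normr0.
have FK := FC K (mem_head _ _).
have {}IH := IH (fun J Js => FC J (mem_behead (s := K :: s) Js)).
rewrite indicE; case: (_ \in _).
  by rewrite mulr1n subrr mul1r mul0r addr0.
by rewrite mulr0n mul0r subr0 mul1r add0r.
Qed.

Lemma uniform_bound (e : seq 'rV[R]_n -> @sexpr R n) (M : R) :
  exists2 C, 0 <= C & forall K x, K \in T -> @cube_rV R n M x -> `|seval (e K) x| <= C.
Proof.
have H K := continuous_bounded_cube M (@continuous_seval _ _ (e K)).
have [C HC] := choice (fun K => let: ex_intro2 c p q := H K in ex_intro _ c (conj p q)).
exists (\sum_(K <- T) C K); first by apply: sumr_ge0 => K _; have [] := HC K.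
move=> K x KT xM; rewrite (big_rem K) //=; have [_ HK] := HC K.
apply: le_trans (HK x xM) _; rewrite lerDl; apply: sumr_ge0 => J _.
by have [] := HC J.
Qed.

Variables (f : 'rV[R]_n -> R) (e : seq 'rV[R]_n -> @sexpr R n).
Hypothesis fe : forall K x, K \in T -> hull K x -> f x = seval (e K) x.
Hypothesis mf : measurable_fun Omega f.

Lemma piecewise_fun_bounded : exists2 C, 0 <= C & forall x, Omega x -> `|f x| <= C.
Proof.
have [M _ [OM KM]] := hull_in_cube; have [C C0 HC] := uniform_bound e M.
exists C => // x Ox; have [K KT Kx] := cover_hull Ox.
by rewrite (fe KT Kx); apply: HC => //; exact: OM.
Qed.

Variable j : 'I_n.
Let ej : 'rV[R]_n := delta_mx 0 j.

(** Two points of a segment lying in one cell are joined inside it by convexity, where the mean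
    value inequality applies with a bound common to all cells; [lipschitz_covered_segment] chains
    the cells. *)
Lemma piecewise_lipschitz : exists2 L, 0 <= L & forall x h, 0 <= h ->
  (forall s, 0 <= s <= h -> Omega (x + s *: ej)) -> `|f (x + h *: ej) - f x| <= L * h.
Proof.
have [M _ [OM KM]] := hull_in_cube.
have [L L0 HL] := uniform_bound (fun K => sderiv j (e K)) M.
exists L => // x h h0 seg.
pose g (s : R) := f (x + s *: ej).
have cline : continuous (fun s : R => x + s *: ej).
  move=> s; apply: cvgD; first exact: cvg_cst.
  by apply: cvgZr_tmp; exact: cvg_id.
have := @lipschitz_covered_segment R _ (fun K => [set s : R | hull K (x + s *: ej)])
  T L 0 h g L0 h0.
rewrite /g scale0r addr0 subr0; apply.
- move=> K KT; have [sK aK] := hT KT.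
  by apply: (closed_comp (f := fun s : R => x + s *: ej)) => [s _|];
    [exact: cline|exact: closed_hull].
- move=> K KT; have [sK aK] := hT KT.
  have key s t : s <= t -> hull K (x + s *: ej) -> hull K (x + t *: ej) ->
      `|f (x + t *: ej) - f (x + s *: ej)| <= L * (t - s).
    move=> st Ks Kt; rewrite !(fe KT) //.
    apply: (mvt_line (DF := seval (sderiv j (e K)))) => // u sut.
      exact: is_derive_seval.
    apply: HL => //; apply: (KM _ KT).
    exact: (hull_convex_line n0 sK aK sut).
  move=> s t _ _ Ks Kt; have [st|ts] := lerP s t.
    by rewrite distrC; exact: key.
  by apply: key => //; exact: ltW.
move=> s /seg Os; exact: cover_hull.
Qed.

Let ftil : 'rV[R]_n -> R := f \_ Omega.
Let G := piecewise T (fun K => seval (sderiv j (e K))).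

Lemma ftil_in x : Omega x -> ftil x = f x.
Proof. by move=> Ox; rewrite /ftil patchE mem_set. Qed.

Lemma ftil_out x : ~ Omega x -> ftil x = 0.
Proof. by move=> Ox; rewrite /ftil patchE memNset. Qed.

Let mftil : measurable_fun [set: 'rV[R]_n] ftil.
Proof. exact: (measurable_restrictT f mO).1 mf. Qed.

Lemma measurable_piecewise_deriv : measurable_fun [set: 'rV[R]_n] G.
Proof.
apply: measurable_piecewise => K; apply: measurable_fun_continuous => //.
exact: continuous_seval.
Qed.

Lemma piecewise_deriv_bounded : exists2 C, 0 <= C & forall x, Omega x -> `|G x| <= C.
Proof.
have [M _ [OM KM]] := hull_in_cube.
have [C C0 HC] := uniform_bound (fun K => sderiv j (e K)) M.
exists C => // x Ox; apply: piecewise_bounded => // K KT; apply: HC => //; exact: OM.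
Qed.

Lemma integ_supp (g : 'rV[R]_n -> R) (C : R) : measurable_fun [set: 'rV[R]_n] g ->
  (forall x, Omega x -> `|g x| <= C) -> (forall x, ~ Omega x -> g x = 0) ->
  integ [set: 'rV[R]_n] g.
Proof.
move=> mg gC g0.
have : integ Omega g.
  by apply: (integ_bounded oO bO) gC; exact: measurable_funS mg.
rewrite /integ (integrable_mkcond _ mO); apply: eq_integrable => // x _.
rewrite patchE; case: ifPn => // /negP; rewrite inE => Ox.
by rewrite /= g0.
Qed.

Lemma int_supp (g : 'rV[R]_n -> R) : (forall x, ~ Omega x -> g x = 0) ->
  \int[leb n]_(x in Omega) g x = \int[leb n]_x g x.
Proof.
move=> g0; rewrite Rintegral_mkcond; apply: eq_Rintegral => x _.
by rewrite patchE; case: ifPn => // /negP; rewrite inE => /g0.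
Qed.

Lemma measurable_translate (g : 'rV[R]_n -> R) (v : 'rV[R]_n) :
  measurable_fun [set: 'rV[R]_n] g -> measurable_fun [set: 'rV[R]_n] (fun x => g (x + v)).
Proof.
move=> mg; apply: (measurableT_comp mg); apply: measurable_mx => i k.
under eq_fun do rewrite mxE.
by apply: measurable_funD => //; exact: measurable_entry.
Qed.

(* Difference quotients of f are moved to theta by translation invariance; they
   are dominated because f is Lipschitz along segments, which finitely many cells
   cover. *)
Lemma piecewise_weak_deriv theta : test_fun Omega theta ->
  \int[leb n]_(x in Omega) (f x * 'D_ej theta x) =
  - \int[leb n]_(x in Omega) (G x * theta x).
Proof.
move=> tt; have [sm [Kt [cK KO Kout]]] := tt.
have [ct dt] := sm [::]; have [cdt _] := sm [:: j].
rewrite /= in ct dt cdt.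
have [d d0 thick] := compact_thicken ej oO cK KO.
have [m0 m0d] : exists m0 : nat, m0.+1%:R^-1 < Num.min 1 d.
  have min0 : 0 < Num.min 1 d by rewrite lt_min ltr01.
  exists (Num.truncn (Num.min 1 d)^-1).
  by rewrite invf_plt ?posrE // truncnS_gt.
(* Steps below 1 keep shifted points in the cube of half-side M + 1, and steps below d keep the
   segments that start in the support of theta inside Omega. *)
pose h (m : nat) : R := (m + m0).+1%:R^-1.
have h0 m : 0 < h m by rewrite invr_gt0.
have hm m : h m < Num.min 1 d.
  by apply: le_lt_trans m0d; rewrite lef_pV2 ?posrE // ler_nat ltnS leq_addl.
have h1 m : h m < 1 by apply: lt_le_trans (hm m) _; rewrite ge_min lexx.
have hd m : h m < d by apply: lt_le_trans (hm m) _; rewrite ge_min lexx orbT.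
have hcv : h @ \oo --> (0 : R).
  by have := @cvg_harmonic R; rewrite -(cvg_shiftn m0).
have out x : ~ Omega x -> theta x = 0 by move=> Ox; apply: Kout => /KO.
have mt : measurable_fun [set: 'rV[R]_n] theta by exact: measurable_fun_continuous.
have [Cf Cf0 fC] := piecewise_fun_bounded.
have [M M0 [OM _]] := hull_in_cube.
have [Ct Ct0 tC] := continuous_bounded_cube (M + 1) ct.
have [Cd Cd0 dC] := continuous_bounded_cube (M + 1) cdt.
have cubeS x s : @cube_rV R n M x -> 0 <= s <= 1 -> @cube_rV R n (M + 1) (x + s *: ej).
  move=> xM /andP[s0 s1] i; rewrite !mxE; apply: le_trans (ler_normD _ _) _.
  apply: lerD; first exact: xM.
  rewrite normrM (ger0_norm s0) -[leRHS]mulr1; apply: ler_pM => //.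
  by rewrite /=; case: (_ == _); rewrite ?normr1 ?normr0.
have tbig x s : Omega x -> 0 <= s <= 1 -> `|theta (x + s *: ej)| <= Ct.
  by move=> Ox s01; apply: tC; apply: cubeS => //; exact: OM.
have t_bound x : Omega x -> `|theta x| <= Ct.
  by move=> Ox; have := tbig x 0 Ox; rewrite lexx ler01 scale0r addr0; apply.
(* In q the difference quotient acts on theta, in p on the extension of f by zero; translation
   invariance equates their integrals. *)
pose q m x := ftil x * ((h m)^-1 * (theta (x + h m *: ej) - theta x)).
pose p m x := ((h m)^-1 * (ftil (x - h m *: ej) - ftil x)) * theta x.
have mq m : measurable_fun [set: 'rV[R]_n] (q m).
  apply: measurable_funM => //; apply: measurable_funM => //; apply: measurable_funB => //.
  exact: measurable_translate.
have mp m : measurable_fun [set: 'rV[R]_n] (p m).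
  apply: measurable_funM => //; apply: measurable_funM => //; apply: measurable_funB => //.
  exact: measurable_translate.
have qp m : \int[leb n]_x q m x = \int[leb n]_x p m x.
  pose g x := ftil (x - h m *: ej) * theta x.
  pose k x := ftil x * theta x.
  have gv x : g (x + h m *: ej) = ftil x * theta (x + h m *: ej).
    by rewrite /g addrK.
  have ig : integ [set: 'rV[R]_n] g.
    apply: (@integ_supp _ (Cf * Ct)).
    - by apply: measurable_funM => //; exact: measurable_translate.
    - move=> x Ox; rewrite normrM ler_pM // ?t_bound //.
      have [Ox'|Ox'] := pselect (Omega (x - h m *: ej)); first by rewrite ftil_in // fC.
      by rewrite ftil_out // normr0.
    - by move=> x Ox; rewrite /g out // mulr0.
  have igv : integ [set: 'rV[R]_n] (fun x => g (x + h m *: ej)).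
    apply: (@integ_supp _ (Cf * Ct)).
    - by apply: measurable_translate; apply: measurable_funM => //; exact: measurable_translate.
    - move=> x Ox; rewrite gv normrM ler_pM // ?ftil_in ?fC //.
      by apply: tbig => //; rewrite !ltW.
    - by move=> x Ox; rewrite gv ftil_out // mul0r.
  have ik : integ [set: 'rV[R]_n] k.
    apply: (@integ_supp _ (Cf * Ct)).
    - exact: measurable_funM.
    - by move=> x Ox; rewrite normrM ler_pM // ?ftil_in ?fC // t_bound.
    - by move=> x Ox; rewrite /k out // mulr0.
  have oT : open [set: 'rV[R]_n] by exact: openT.
  have E1 x : q m x = (h m)^-1 * g (x + h m *: ej) + (- (h m)^-1) * k x.
    by rewrite gv /q /k; ring.
  have E2 x : p m x = (h m)^-1 * g x + (- (h m)^-1) * k x.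
    by rewrite /p /g /k; ring.
  under eq_Rintegral do rewrite E1.
  under [RHS]eq_Rintegral do rewrite E2.
  rewrite (int_addf oT); [|exact: integZ|exact: integZ].
  rewrite [RHS](int_addf oT); [|exact: integZ|exact: integZ].
  by rewrite !(int_scalef oT) // (Rint_translate ig igv).
have limq : (fun m => \int[leb n]_x q m x) @ \oo -->
    \int[leb n]_x (ftil x * 'D_ej theta x).
  apply: (@Rdominated _ _ _ _ _ (fun x => (Cf * Cd) * \1_Omega x)) => //.
  - apply: measurable_funM => //; exact: measurable_fun_continuous.
  - apply: aeW => x _; apply: cvgM; first exact: cvg_cst.
    apply: derive_line_cvg => //; last by move=> m; rewrite gt_eqF.
    by split; [exact: dt|].
  - apply: (@integ_supp _ (Cf * Cd)).
    + by apply: measurable_funM => //; exact: measurable_indic.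
    + by move=> x Ox; rewrite indicE mem_set // mulr1 ger0_norm // mulr_ge0.
    + by move=> x Ox; rewrite indicE memNset // mulr0.
  - move=> m x _; have [Ox|Ox] := pselect (Omega x); last first.
      by rewrite /q ftil_out // mul0r normr0 indicE memNset // mulr0.
    rewrite indicE mem_set // mulr1 /q normrM; apply: ler_pM => //.
      by rewrite ftil_in // fC.
    rewrite normrM gtr0_norm ?invr_gt0 // mulrC ler_pdivrMr //.
    have := @mvt_line R _ theta ('D_ej theta) x ej 0 (h m) Cd (ltW (h0 m)).
    rewrite scale0r addr0 subr0; apply.
      by move=> s _; split; [exact: dt|].
    move=> s /andP[s0 sh]; apply: dC; apply: cubeS; first exact: OM.
    by rewrite s0 (le_trans sh) // ltW.
have limp : (fun m => \int[leb n]_x p m x) @ \oo -->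
    \int[leb n]_x (- G x * theta x).
  have [L L0 HL] := piecewise_lipschitz.
  apply: (@Rdominated _ _ _ _ _ (fun x => (L * Ct) * \1_Omega x)) => //.
  - apply: measurable_funM => //.
    by apply: measurableT_comp => //; exact: measurable_piecewise_deriv.
  - apply: filterS ae_interior => x H _.
    have [Ox|Ox] := pselect (Omega x); last first.
      rewrite out // mulr0 (_ : p^~ x = cst 0); first exact: cvg_cst.
      by apply/funext => m; rewrite /p out // mulr0.
    have [K [KT Kx GE]] := piecewise_eq (fun K => seval (sderiv j (e K))) (H Ox).
    apply: cvgM; last exact: cvg_cst.
    rewrite /G GE.
    have lim : (fun m => (- h m)^-1 * (seval (e K) (x + (- h m) *: ej) - seval (e K) x))
        @ \oo --> seval (sderiv j (e K)) x.
      apply: derive_line_cvg; first exact: is_derive_seval.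
        by rewrite -oppr0; exact: cvgN.
      by move=> m; rewrite oppr_eq0 gt_eqF.
    suff E : \forall m \near \oo,
        - ((- h m)^-1 * (seval (e K) (x + (- h m) *: ej) - seval (e K) x)) =
        (h m)^-1 * (ftil (x - h m *: ej) - ftil x).
      exact: (cvg_trans (near_eq_cvg E) (cvgN lim)).
    (* Almost every x is interior to a cell, and for small steps the shifted point stays in the same
       cell, where f is a single smooth expression. *)
    have nx : nbhs x (Omega `&` hull K).
      by apply: filterI; [exact: open_nbhs_nbhs|exact: Kx].
    have [r /= r0 rO] := (nbhs_ballP _ _).1 nx.
    have : \forall m \near \oo, h m * (`|ej| + 1) < r.
      have e1 : 0 < `|ej| + 1 by rewrite ltr_wpDl.
      have : \forall m \near \oo, h m < r / (`|ej| + 1).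
        by apply: (cvgr_lt _ hcv); rewrite divr_gt0.
      by apply: filterS => m; rewrite ltr_pdivlMr.
    apply: filterS => m Hm.
    have [Ox' Kx'] : (Omega `&` hull K) (x + (- h m) *: ej).
      apply: rO; rewrite -ball_normE /= opprD addrA subrr sub0r scaleNr opprK normrZ.
      rewrite gtr0_norm //; apply: le_lt_trans Hm.
      by apply: ler_wpM2l; [exact: ltW|rewrite lerDl].
    have -> : x - h m *: ej = x + (- h m) *: ej by rewrite scaleNr.
    rewrite (ftil_in Ox') (ftil_in Ox) (fe KT Kx') (fe KT (interior_subset Kx)).
    by rewrite invrN mulNr opprK.
  - apply: (@integ_supp _ (L * Ct)).
    + by apply: measurable_funM => //; exact: measurable_indic.
    + by move=> x Ox; rewrite indicE mem_set // mulr1 ger0_norm // mulr_ge0.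
    + by move=> x Ox; rewrite indicE memNset // mulr0.
  - move=> m x _; have [Kx|Kx] := pselect (Kt x); last first.
      by rewrite /p Kout // mulr0 normr0 !mulr_ge0.
    have Ox := KO x Kx.
    rewrite indicE mem_set // mulr1 /p normrM; apply: ler_pM => //; last exact: t_bound.
    rewrite normrM gtr0_norm ?invr_gt0 // mulrC ler_pdivrMr //.
    (* Only points x of the support of theta matter, and the whole segment from x - h e_j to x then
       lies in Omega, as the Lipschitz bound requires. *)
    have seg s : 0 <= s <= h m -> Omega (x - h m *: ej + s *: ej).
      move=> /andP[s0 sh]; rewrite -addrA -scaleNr -scalerDl; apply: thick => //.
      rewrite addrC distrC ger0_norm ?subr_ge0 //; apply: le_lt_trans (hd m).
      by rewrite lerBlDr lerDl.
    have := HL (x - h m *: ej) (h m) (ltW (h0 m)) seg; rewrite subrK distrC.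
    rewrite !ftil_in //.
    by have := seg 0; rewrite lexx ltW // scale0r addr0; apply.
have lim_eq : \int[leb n]_x (ftil x * 'D_ej theta x) = \int[leb n]_x (- G x * theta x).
  move: limp; rewrite -(funext qp) => limq'.
  exact: (cvg_unique _ limq limq').
transitivity (\int[leb n]_(x in Omega) (ftil x * 'D_ej theta x)).
  by apply: eq_Rintegral => x; rewrite inE => Ox; rewrite ftil_in.
rewrite int_supp; last by move=> x Ox; rewrite ftil_out // mul0r.
rewrite lim_eq int_supp; last by move=> x Ox; rewrite out // mulr0.
have [CG CG0 GC] := piecewise_deriv_bounded.
have iG : integ [set: 'rV[R]_n] (fun x => G x * theta x).
  apply: (@integ_supp _ (CG * Ct)).
  - by apply: measurable_funM => //; exact: measurable_piecewise_deriv.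
  - by move=> x Ox; rewrite normrM ler_pM // ?GC // t_bound.
  - by move=> x Ox; rewrite out // mulr0.
under eq_Rintegral do rewrite mulNr -mulN1r.
by rewrite (int_scalef openT) // mulN1r.
Qed.

End piecewise_smooth.

(** * Regularity and traces of discrete functions *)

Section discrete_functions.
Context {R : realType} {n : nat} (n0 : (0 < n)%N) (Omega : set 'rV[R]_n).
Hypotheses (oO : open Omega) (bO : bounded_set Omega).
Variables (T : seq (seq 'rV[R]_n)) (k : nat).
Hypothesis hT : triangulation Omega T.

Let hT1 K : K \in T -> size K = n.+1 /\ affine_indep K.
Proof. by move=> KT; have [H _ _] := hT; exact: H. Qed.

Let cov : closure Omega = \bigcup_(K in [set` T]) hull K.
Proof. by have [_ H _] := hT. Qed.

Let mO : measurable Omega.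
Proof. exact: open_measurable_rV. Qed.

Lemma within_open_trace (psi : 'rV[R]_n -> 'rV[R]_n) (i : 'I_n) (U : set R) :
  {within closure Omega, continuous psi} -> open U ->
  exists2 V : set 'rV[R]_n, open V &
    forall x, closure Omega x -> V x <-> U (psi x 0 i).
Proof.
move=> cpsi oU.
have oU' : open [set y : 'rV[R]_n | U (y 0 i)].
  by apply: (@open_comp _ _ (fun y : 'rV[R]_n => y 0 i)) => // y _; exact: coord_continuous.
have : open ((psi : subspace (closure Omega) -> 'rV[R]_n) @^-1` [set y | U (y 0 i)]).
  by move/continuousP: cpsi; apply.
move=> /open_subspaceP[V oV VE]; exists V => // x Ox.
have : (V `&` closure Omega) x <-> (psi @^-1` [set y | U (y 0 i)] `&` closure Omega) x.
  by rewrite VE.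
by move=> [H1 H2]; split => H; [have [] := H1 (conj H Ox)|have [] := H2 (conj H Ox)].
Qed.

Lemma Hphi_measurable (psi : 'rV[R]_n -> 'rV[R]_n) (i : 'I_n) :
  {within closure Omega, continuous psi} -> measurable_fun Omega (fun x => psi x 0 i).
Proof.
move=> cpsi _; apply: (measurability _ (RGenOInfty.measurableE R)) => //.
move=> _ [_ [c ->] <-].
have [V oV VE] := within_open_trace i cpsi (@interval_open R (BRight c) +oo%O isT isT).
rewrite (_ : _ `&` _ = Omega `&` V).
  by apply: measurableI => //; exact: open_measurable_rV.
by apply/seteqP; split => x [Ox Hx]; split => //;
  have [H1 H2] := VE x (subset_closure Ox); [exact: H2|exact: H1].
Qed.

Lemma Hphi_exprs (psi : 'rV[R]_n -> 'rV[R]_n) : Hphi Omega T k psi ->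
  exists e : 'I_n -> seq 'rV[R]_n -> @sexpr R n, forall i K x,
    K \in T -> hull K x -> psi x 0 i = seval (e i K) x.
Proof.
move=> [_ hpsi].
have H (iK : 'I_n * seq 'rV[R]_n) : exists e : @sexpr R n,
    forall x, iK.2 \in T -> hull iK.2 x -> psi x 0 iK.1 = seval e x.
  have [KT|KT] := boolP (iK.2 \in T); last by exists (SConst 0).
  have [P [/(_ 0 iK.1)/seval_poly[e He] PE]] := hpsi iK.2 KT.
  by exists e => x _ /PE ->; rewrite -He.
have [e He] := choice H.
by exists (fun i K => e (i, K)) => i K x; exact: (He (i, K)).
Qed.

Lemma Hphi_bounded (psi : 'rV[R]_n -> 'rV[R]_n) : Hphi Omega T k psi ->
  exists2 C, 0 <= C & forall x, closure Omega x -> forall i, `|psi x 0 i| <= C.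
Proof.
move=> /Hphi_exprs[e He].
have [M _ [OM KM]] := hull_in_cube bO cov.
have H i := uniform_bound T (e i) M.
have [C HC] := choice (fun i => let: ex_intro2 c p q := H i in ex_intro _ c (conj p q)).
exists (\sum_i C i); first by apply: sumr_ge0 => i _; have [] := HC i.
move=> x; rewrite cov => -[K KT Kx] i; have [_ HCi] := HC i.
rewrite (He i K) //; apply: le_trans (HCi K x KT (KM K KT x Kx)) _.
by rewrite (bigD1 i) //= lerDl; apply: sumr_ge0 => l _; have [] := HC l.
Qed.

Lemma Hphi_H1 (psi : 'rV[R]_n -> 'rV[R]_n) : Hphi Omega T k psi -> H1 Omega psi.
Proof.
move=> Hpsi; have [cpsi _] := Hpsi.
have [C C0 HC] := Hphi_bounded Hpsi; have [e He] := Hphi_exprs Hpsi.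
have mpsi i : measurable_fun Omega (fun x => psi x 0 i) by exact: Hphi_measurable.
split.
  move=> i j; rewrite (ord1 i); apply: (L2s_bounded oO bO (C := C)) => // x Ox.
  by apply: HC; exact: subset_closure.
exists (fun x => \matrix_(i, j) piecewise T (fun K => seval (sderiv j (e i K))) x); split.
  move=> i j; rewrite -/(L2s Omega _).
  have [D D0 HD] := piecewise_deriv_bounded bO cov (e i) j.
  apply: (L2s_bounded oO bO (C := D)) => [|x Ox]; last by rewrite mxE HD.
  under eq_fun do rewrite mxE.
  apply: measurable_funS (measurable_piecewise_deriv T (e i) j) => //.
move=> i j theta tt.
rewrite (piecewise_weak_deriv n0 oO bO hT1 cov (He i) (mpsi i) j tt).
by congr (- _); apply: eq_Rintegral => x _; rewrite mxE.
Qed.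

Lemma H1norm0 p : H1norm Omega (fun=> 0 : 'rV[R]_p) = 0.
Proof.
have L0 := @L2_zero _ _ _ oO bO 1 p.
have [H0 E] := H1_ae0 oO bO L0 (aeq_refl _ _).
have [G0 _] := wgradP H0.
by rewrite /H1norm /H1semi (L2norm_ae0 oO bO L0 (aeq_refl _ _)) (L2norm_ae0 oO bO G0 E)
  expr0n addr0 sqrtr0.
Qed.

(** A discrete function is continuous up to the boundary, so the constant sequence psi approximates
    it and its restriction at once. What remains is measurability and boundedness on the reference
    simplex. *)
Lemma Hphi_is_trace (psi : 'rV[R]_n -> 'rV[R]_n) F : Hphi Omega T k psi ->
  face_in (frontier Omega) F -> is_trace Omega F psi psi.
Proof.
move=> Hpsi [sF [F0 _] FO]; have [cpsi _] := Hpsi.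
have [C C0 HC] := Hphi_bounded Hpsi.
have Fcl t : ref_simplex t -> closure Omega (param F t).
  move=> tr; have [] : frontier Omega (param F t) by apply: FO; apply/hull_param => //; exists t.
  by [].
set d := (size F).-1.
have cref : closed (@ref_simplex R d).
  rewrite (_ : ref_simplex = (\bigcap_i [set t : 'rV[R]_d | 0 <= t 0 i]) `&`
      [set t : 'rV[R]_d | \sum_i t 0 i <= 1]); last first.
    by apply/seteqP; split => t [t0 t1]; split => // i; [move=> _|]; exact: t0.
  apply: closedI.
    apply: closed_bigI => i _; apply: (closed_le_fun (f := cst 0)).
      exact: cst_continuous.
    exact: coord_continuous.
  apply: (closed_le_fun (g := cst 1)); last exact: cst_continuous.
  by apply: continuous_sum => i; exact: coord_continuous.
have mref : measurable (@ref_simplex R d) by exact: closed_measurable_rV.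
have bref : bounded_set (@ref_simplex R d).
  exists 1; split; first exact: num_real.
  move=> M M1 t [t0 t1]; apply: le_trans (ltW M1); apply: norm_mx_le => // a i.
  rewrite ord1 ger0_norm //; apply: le_trans t1.
  by rewrite (bigD1 i) //= lerDl; exact: sumr_ge0.
have cparam : continuous (param F : 'rV[R]_d -> 'rV[R]_n).
  apply: continuous_mx => a i; rewrite (ord1 a).
  rewrite (_ : (fun _ => _) = fun t : 'rV[R]_d =>
      F`_0 0 i + \sum_l t 0 l * edge_mx F l i).
    apply: continuous_addf; first exact: cst_continuous.
    apply: continuous_sum => l; apply: continuous_mulf; last exact: cst_continuous.
    exact: coord_continuous.
  by apply/funext => t; rewrite /param !mxE.
have mi i : measurable_fun (@ref_simplex R d) (fun t => psi (param F t) 0 i).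
  move=> _; apply: (measurability _ (RGenOInfty.measurableE R)) => //.
  move=> _ [_ [c ->] <-].
  have [V oV VE] := within_open_trace i cpsi (@interval_open R (BRight c) +oo%O isT isT).
  rewrite (_ : _ `&` _ = ref_simplex `&` (param F @^-1` V)).
    apply: measurableI => //; apply: open_measurable_rV.
    by apply: open_comp => // t _; exact: cparam.
  by apply/seteqP; split => t [tr Ht]; split => //;
    have [H1 H2] := VE (param F t) (Fcl t tr); [exact: H2|exact: H1].
split.
  move=> i; split; first exact: mi.
  have int_cst : (leb d).-integrable (@ref_simplex R d) (EFin \o cst (C ^+ 2)).
    apply/integrableP; split; first exact/measurable_EFinP.
    rewrite (eq_integral (cst `|C ^+ 2|%:E)) ?integral_cst //.
    apply: lte_mul_pinfty => //; exact: leb_bounded_fin.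
  apply: (le_integrable mref _ _ int_cst).
    by apply/measurable_EFinP; apply: measurable_funX; exact: mi.
  move=> t tr; rewrite /= lee_fin !normrX ler_sqr ?nnegrE //.
  rewrite (ger0_norm C0); apply: HC; exact: Fcl.
exists (fun=> psi); split.
- by move=> _; split; [exact: Hphi_H1|exact: cpsi].
- rewrite (_ : (fun _ => _) = cst 0); first exact: cvg_cst.
  apply/funext => m; rewrite -[RHS](H1norm0 n); congr (H1norm Omega _).
  by apply/funext => x; rewrite subrr.
- rewrite (_ : (fun _ => _) = cst 0); first exact: cvg_cst.
  apply/funext => m; rewrite /simplex_int.
  under eq_Rintegral do rewrite subrr enorm0 expr0n /=.
  by rewrite Rintegral_cst // mul0r mulr0.
Qed.

Lemma HphiD_H1D (D : set 'rV[R]_n) psi : HphiD Omega D T k psi -> H1D Omega D psi.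
Proof.
move=> [Hpsi psi0]; split; first exact: Hphi_H1.
move=> F HF; exists psi; split; first exact: Hphi_is_trace.
rewrite /simplex_negligible (_ : [set t | _] = set0); first exact: negligible_set0.
by apply/seteqP; split => t //= [_ [Dt]]; rewrite psi0.
Qed.

End discrete_functions.

(** * The truncated Galerkin problem *)

Section galerkin.
Context {R : realType}.

Definition linS (V : lmodType R) (S : V -> Prop) (f : V -> R) : Prop :=
  forall a u v, S u -> S v -> f (a *: u + v) = a * f u + f v.

Section linS_theory.
Variables (V : lmodType R) (S : V -> Prop) (ip : V -> V -> R) (H : semi_ip S ip).
Variable f : V -> R.
Hypothesis lf : linS S f.

Lemma linS0 : f 0 = 0.
Proof.
have S0 := sip0 H; apply: (addrI (f 0)).
by have := lf 1 S0 S0; rewrite scale1r mul1r !addr0.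
Qed.

Lemma linSZ a u : S u -> f (a *: u) = a * f u.
Proof. by move=> Su; have := lf a Su (sip0 H); rewrite addr0 linS0 addr0. Qed.

Lemma linSD u v : S u -> S v -> f (u + v) = f u + f v.
Proof. by move=> Su Sv; have := lf 1 Su Sv; rewrite scale1r mul1r. Qed.

Lemma linS_comb (m : nat) (g : 'I_m -> V) (a : 'I_m -> R) : (forall l, S (g l)) ->
  f (\sum_l a l *: g l) = \sum_l a l * f (g l).
Proof.
move=> Sg; elim: (index_enum _) => [|l s IH]; first by rewrite !big_nil linS0.
rewrite !big_cons lf ?IH //.
by apply: (sipS_sum H) => i; exact: (sipSZ H).
Qed.

End linS_theory.

Lemma continuous_of_modulus (X : topologicalType) (f : X -> R) (d : X -> X -> R) :
  (forall x y, `|f x - f y| <= d x y) -> (forall x, continuous (d x)) ->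
  (forall x, d x x = 0) -> continuous f.
Proof.
move=> fd cd d0 x; apply/cvgrPdist_lt => eps eps0.
have : \forall y \near x, d x y < eps.
  by apply: (cvgr_lt _ (cd x x)); rewrite d0.
by apply: filterS => y; apply: le_lt_trans; exact: fd.
Qed.

(** Meant for the dependence of [A] on its coefficient phi, which is not multilinear and so cannot
    be expanded in the coordinates. *)
Lemma continuous_lipschitz_comp (Z : topologicalType) (m : nat)
    (h : ('I_m -> R) -> R) (L : R) (a : 'I_m -> Z -> R) :
  (forall b c, `|h b - h c| <= L * \sum_l `|b l - c l|) ->
  (forall l, continuous (a l)) -> continuous (fun z => h (a ^~ z)).
Proof.
move=> hL ca.
apply: (continuous_of_modulus (d := fun y z => L * \sum_l `|a l y - a l z|)) => // [y|y].
  apply: continuous_mulf; first exact: cst_continuous.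
  apply: continuous_sum => l.
  apply: (@continuous_compf _ _ _ (fun z => a l y - a l z) Num.norm).
    by apply: continuous_subf => //; exact: cst_continuous.
  by move=> x; apply: cvg_norm.
by rewrite big1 ?mulr0 // => l _; rewrite subrr normr0.
Qed.

Variables (V X : lmodType R) (S1 : V -> Prop) (SX S2 : X -> Prop).
Variables (ip1 : V -> V -> R) (ipX : X -> X -> R).
Hypotheses (H1 : semi_ip S1 ip1) (HX : semi_ip SX ipX) (H2 : semi_ip S2 ipX).
Hypothesis S2X : forall v, S2 v -> SX v.
Variables (m1 m2 : nat).
Hypothesis dep1 : forall f : 'I_m1 -> V, (forall i, S1 (f i)) ->
    exists2 c : 'I_m1 -> R, exists i, c i != 0 & sipn ip1 (\sum_i c i *: f i) = 0.
Hypothesis dep2 : forall f : 'I_m2 -> X, (forall i, S2 (f i)) ->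
    exists2 c : 'I_m2 -> R, exists i, c i != 0 & sipn ipX (\sum_i c i *: f i) = 0.

Notation n1 := (sipn ip1).
Notation nX := (sipn ipX).

Variables (A B : X -> V -> V -> R) (F : X -> V -> R) (C : X -> X -> R)
  (G : X -> X -> X -> R) (pr : V -> X) (E : X).
(** Here al and alt are the coercivity constants of A and C, while be, fF, kC and cG bound B, F, C
    and G. The condition be r <= al / 2 lets half of the coercivity of A absorb B. *)
Variables (al be fF alt kC cG r : R).
Hypotheses (al0 : 0 < al) (be0 : 0 <= be) (fF0 : 0 <= fF) (alt0 : 0 < alt)
  (kC0 : 0 <= kC) (cG0 : 0 <= cG) (r0 : 0 < r) (ber : be * r <= al / 2).
Hypothesis SXE : SX E.
Hypothesis pr_lin : forall a u v, pr (a *: u + v) = a *: pr u + pr v.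
Hypothesis prS : forall v, S1 v -> SX (pr v).

Hypothesis A_l : forall phi eta, SX phi -> S1 eta -> linS S1 (fun xi => A phi xi eta).
Hypothesis A_r : forall phi xi, SX phi -> S1 xi -> linS S1 (A phi xi).
Hypothesis A_null : forall phi xi eta, SX phi -> S1 xi -> S1 eta -> n1 eta = 0 ->
  A phi xi eta = 0.
Hypothesis A_coercive : forall phi xi, SX phi -> S1 xi ->
  al * n1 xi ^+ 2 <= A phi xi xi.
Hypothesis A_lipschitz : forall m (g : 'I_m -> X) xi eta, (forall l, SX (g l)) ->
  S1 xi -> S1 eta -> exists L, forall b c : 'I_m -> R,
    `|A (\sum_l b l *: g l) xi eta - A (\sum_l c l *: g l) xi eta| <=
      L * \sum_l `|b l - c l|.

Hypothesis B_w : forall xi eta, S1 xi -> S1 eta -> linS SX (fun w => B w xi eta).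
Hypothesis B_l : forall w eta, SX w -> S1 eta -> linS S1 (fun xi => B w xi eta).
Hypothesis B_r : forall w xi, SX w -> S1 xi -> linS S1 (B w xi).
Hypothesis B_le : forall w xi eta, SX w -> S1 xi -> S1 eta ->
  `|B w xi eta| <= be * nX w * n1 xi * n1 eta.

Hypothesis F_l : forall eta, S1 eta -> linS SX (fun phi => F phi eta).
Hypothesis F_r : forall phi, SX phi -> linS S1 (F phi).
Hypothesis F_le : forall phi eta, SX phi -> S1 eta ->
  `|F phi eta| <= fF * nX phi * n1 eta.

Hypothesis C_l : forall psi, SX psi -> linS SX (fun chi => C chi psi).
Hypothesis C_r : forall chi, SX chi -> linS SX (C chi).
Hypothesis C_le : forall chi psi, SX chi -> SX psi ->
  `|C chi psi| <= kC * nX chi * nX psi.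
Hypothesis C_coercive : forall psi, S2 psi -> alt * nX psi ^+ 2 <= C psi psi.

Hypothesis G_w : forall phi psi, SX phi -> SX psi -> linS SX (fun w => G w phi psi).
Hypothesis G_phi : forall w psi, SX w -> SX psi -> linS SX (fun phi => G w phi psi).
Hypothesis G_psi : forall w phi, SX w -> SX phi -> linS SX (G w phi).
Hypothesis G_le : forall w phi psi, SX w -> SX phi -> SX psi ->
  `|G w phi psi| <= cG * nX w * nX phi * nX psi.

(* The nonlinear arguments are scaled by r / max(r, |u| + |phi|), which leaves
   them unchanged on the ball where the solution is eventually shown to lie. *)
Lemma truncated_solution : exists xi phi1 s, [/\ S1 xi, S2 phi1,
  [/\ 0 < s <= 1, s * (nX (pr xi) + nX (E + phi1)) <= r &
      nX (pr xi) + nX (E + phi1) <= r -> s = 1],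
  forall eta, S1 eta -> A (s *: (E + phi1)) xi eta + B (s *: pr xi) xi eta =
    F (s *: (E + phi1)) eta &
  forall psi, S2 psi -> C (E + phi1) psi = G (s *: pr xi) (s *: (E + phi1)) psi].
Proof.
have [d1 [e [Se eo espan]]] := orthonormal_basis H1 dep1.
have [d2 [p [Sp po pspan]]] := orthonormal_basis H2 dep2.
have SXp j : SX (p j) by exact/S2X/Sp.
pose x (z : 'rV[R]_(d1 + d2)) i := z 0 (lshift d2 i).
pose y (z : 'rV[R]_(d1 + d2)) j := z 0 (rshift d1 j).
pose xi z := \sum_i x z i *: e i.
pose phi1 z := \sum_j y z j *: p j.
have Sxi z : S1 (xi z) by apply: (sipS_sum H1) => i; exact: (sipSZ H1).
have Sphi1 z : S2 (phi1 z) by apply: (sipS_sum H2) => i; exact: (sipSZ H2).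
(* The fixed element E is added as a generator with coefficient 1 at index 0, so that the affine
   family E + phi1 becomes a family of linear combinations. *)
pose q (l : 'I_d2.+1) := if unlift ord0 l is Some j then p j else E.
have Sq l : SX (q l) by rewrite /q; case: unlift.
pose a (l : 'I_d2.+1) z := if unlift ord0 l is Some j then y z j else 1.
have phiE z : E + phi1 z = \sum_l a l z *: q l.
  rewrite big_ord_recl /a /q unlift_none scale1r; congr (_ + _).
  by apply: eq_bigr => j _; rewrite liftK.
have Sphi z : SX (E + phi1 z) by apply: (sipSD HX) => //; exact: S2X.
pose pe i := pr (e i).
have Spe i : SX (pe i) by exact: prS.
have prE z : pr (xi z) = \sum_i x z i *: pe i.
  rewrite /xi /pe; elim: (index_enum _) => [|i s IH].
    rewrite !big_nil; apply: (addrI (pr 0)).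
    by have := pr_lin 1 0 0; rewrite !scale1r !addr0.
  by rewrite !big_cons pr_lin IH.
have Spr z : SX (pr (xi z)) by exact: prS.
have cx i : continuous (x^~ i) by exact: coord_continuous.
have cy j : continuous (y^~ j) by exact: coord_continuous.
have ca l : continuous (a l).
  by rewrite /a; case: unlift => [j|]; [exact: cy|exact: cst_continuous].
have cn (m : nat) (g : 'I_m -> X) (b : 'I_m -> 'rV[R]_(d1 + d2) -> R) :
    (forall l, SX (g l)) -> (forall l, continuous (b l)) ->
    continuous (fun z => nX (\sum_l b l z *: g l)).
  move=> Sg cb; apply: continuous_sqrtf.
  rewrite (_ : (fun _ => _) = fun z =>
      \sum_k b k z * \sum_l b l z * ipX (g k) (g l)); last first.
    apply/funext => z; have Sc : SX (\sum_l b l z *: g l).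
      by apply: (sipS_sum HX) => i; exact: (sipSZ HX).
    rewrite (sip_suml HX) //; last by move=> k; exact: (sipSZ HX).
    apply: eq_bigr => k _; rewrite (sipZl HX) //; congr (_ * _).
    rewrite (sipC HX) // (sip_suml HX) //; last by move=> l; exact: (sipSZ HX).
    by apply: eq_bigr => l _; rewrite (sipZl HX) // (sipC HX).
  apply: continuous_sum => k; apply: continuous_mulf => //.
  apply: continuous_sum => l; apply: continuous_mulf => //.
  exact: cst_continuous.
pose N z := nX (pr (xi z)) + nX (E + phi1 z).
have N0 z : 0 <= N z by rewrite addr_ge0 ?sipn_ge0.
have cN : continuous N.
  apply: continuous_addf.
    rewrite (_ : (fun _ => _) = fun z => nX (\sum_i x z i *: pe i)).
      by apply: (cn _ pe (fun i => x^~ i)).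
    by apply/funext => z; rewrite prE.
  rewrite (_ : (fun _ => _) = fun z => nX (\sum_l a l z *: q l)); first exact: cn.
  by apply/funext => z; rewrite phiE.
pose M z := Num.max r (N z).
have M0 z : 0 < M z by rewrite lt_max r0.
pose s z := r / M z.
have s01 z : 0 < s z <= 1.
  rewrite divr_gt0 //= ler_pdivrMr // mul1r /M le_max lexx.
  by [].
have sN z : s z * N z <= r.
  rewrite /s mulrAC ler_pdivrMr // ler_pM2l //.
  by rewrite /M le_max lexx orbT.
have cs : continuous s.
  apply: continuous_mulf; first exact: cst_continuous.
  apply: continuous_invf => [z|]; first by rewrite gt_eqF.
  by apply: continuous_maxf => //; exact: cst_continuous.
have Ssphi z : SX (s z *: (E + phi1 z)) by exact: (sipSZ HX).
have Sspr z : SX (s z *: pr (xi z)) by exact: (sipSZ HX).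
pose P1 z eta := A (s z *: (E + phi1 z)) (xi z) eta + B (s z *: pr (xi z)) (xi z) eta -
  F (s z *: (E + phi1 z)) eta.
pose P2 z psi := C (E + phi1 z) psi - G (s z *: pr (xi z)) (s z *: (E + phi1 z)) psi.
pose Pl z (l : 'I_d1 + 'I_d2) : R :=
  match l with inl i => P1 z (e i) | inr j => P2 z (p j) end.
pose P (z : 'rV[R]_(d1 + d2)) : 'rV[R]_(d1 + d2) :=
  \row_(l < d1 + d2) Pl z (fintype.split l).
have sphiE z : s z *: (E + phi1 z) = \sum_l (s z * a l z) *: q l.
  by rewrite phiE scaler_sumr; apply: eq_bigr => l _; rewrite scalerA.
have cP1 eta : S1 eta -> continuous (fun z => P1 z eta).
  move=> Seta; apply: continuous_subf; first apply: continuous_addf.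
  - rewrite (_ : (fun _ => _) = fun z => \sum_i x z i *
        A (\sum_l (s z * a l z) *: q l) (e i) eta).
      apply: continuous_sum => i; apply: continuous_mulf => //.
      have [L HL] := A_lipschitz Sq (Se i) Seta.
      apply: (@continuous_lipschitz_comp _ _
        (fun b => A (\sum_l b l *: q l) (e i) eta) L (fun l z => s z * a l z)) => // l.
      exact: continuous_mulf.
    apply/funext => z.
    rewrite (linS_comb H1 (A_l (Ssphi z) Seta) (x z) Se).
    by apply: eq_bigr => i _; rewrite sphiE.
  - rewrite (_ : (fun _ => _) = fun z => \sum_i x z i * (s z *
        \sum_k x z k * B (pe k) (e i) eta)).
      apply: continuous_sum => i; apply: continuous_mulf => //.
      apply: continuous_mulf => //; apply: continuous_sum => k.
      by apply: continuous_mulf => //; exact: cst_continuous.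
    apply/funext => z.
    rewrite (linS_comb H1 (B_l (Sspr z) Seta) (x z) Se).
    apply: eq_bigr => i _; rewrite (linSZ HX (B_w (Se i) Seta)) // prE.
    by rewrite (linS_comb HX (B_w (Se i) Seta) (x z) Spe).
  rewrite (_ : (fun _ => _) = fun z => \sum_l (s z * a l z) * F (q l) eta).
    apply: continuous_sum => l; apply: continuous_mulf; last exact: cst_continuous.
    exact: continuous_mulf.
  apply/funext => z; rewrite sphiE.
  exact: (linS_comb HX (F_l Seta) _ Sq).
have cP2 psi : S2 psi -> continuous (fun z => P2 z psi).
  move=> /S2X Spsi; apply: continuous_subf.
    rewrite (_ : (fun _ => _) = fun z => \sum_l a l z * C (q l) psi).
      apply: continuous_sum => l; apply: continuous_mulf => //; exact: cst_continuous.
    apply/funext => z; rewrite phiE; exact: (linS_comb HX (C_l Spsi) _ Sq).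
  rewrite (_ : (fun _ => _) = fun z => s z * \sum_k x z k *
      \sum_l (s z * a l z) * G (pe k) (q l) psi).
    apply: continuous_mulf => //; apply: continuous_sum => k.
    apply: continuous_mulf => //; apply: continuous_sum => l.
    apply: continuous_mulf; last exact: cst_continuous.
    exact: continuous_mulf.
  apply/funext => z; rewrite (linSZ HX (G_w (Ssphi z) Spsi)) // {1}prE.
  rewrite (linS_comb HX (G_w (Ssphi z) Spsi) _ Spe); congr (_ * _).
  apply: eq_bigr => k _; rewrite sphiE.
  by rewrite (linS_comb HX (G_phi (Spe k) Spsi) _ Sq).
have cP : continuous P.
  apply: continuous_mx => i l; rewrite (_ : (fun _ => _) = Pl ^~ (fintype.split l)); last first.
    by apply/funext => z; rewrite mxE.
  by case: (fintype.split l) => [i'|j]; [exact: cP1|exact: cP2].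
have P1_r z : linS S1 (P1 z).
  move=> c u v Su Sv; rewrite /P1 (A_r (Ssphi z) (Sxi z)) //.
  rewrite (B_r (Sspr z) (Sxi z)) // (F_r (Ssphi z)) //; ring.
have P2_r z : linS S2 (P2 z).
  move=> c u v /S2X Su /S2X Sv; rewrite /P2 (C_r (Sphi z)) //.
  rewrite (G_psi (Sspr z) (Ssphi z)) //; ring.
(* By linearity in the test function, pairing the field with z amounts to testing each residual with
   the candidate itself. *)
have PzE z : frob (P z) z = P1 z (xi z) + P2 z (phi1 z).
  rewrite frob_row big_split_ord /=; congr (_ + _).
    rewrite (linS_comb H1 (P1_r z) (x z) Se); apply: eq_bigr => i _.
    by rewrite mxE (unsplitK (inl i)) mulrC.
  rewrite (linS_comb H2 (P2_r z) (y z) Sp); apply: eq_bigr => j _.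
  by rewrite mxE (unsplitK (inr j)) mulrC.
have norm_comb (W : lmodType R) (S : W -> Prop) ip (HS : semi_ip S ip) m (b : 'I_m -> W)
    (c : 'I_m -> R) : (forall i, S (b i)) ->
    (forall i j, ip (b i) (b j) = (i == j)%:R) ->
    ip (\sum_i c i *: b i) (\sum_i c i *: b i) = \sum_i c i ^+ 2.
  move=> Sb bo; have Sc : S (\sum_i c i *: b i).
    by apply: (sipS_sum HS) => i; exact: (sipSZ HS).
  rewrite (sip_suml HS) //; last by move=> i; exact: (sipSZ HS).
  apply: eq_bigr => i _; rewrite (sipZl HS) // (sipC HS) // (sip_suml HS) //; last first.
    by move=> j; exact: (sipSZ HS).
  rewrite (bigD1 i) //= big1 => [|j ji]; last first.
    by rewrite (sipZl HS) // bo (negPf ji) mulr0.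
  by rewrite (sipZl HS) // bo eqxx addr0 mulr1 expr2.
have znorm z : enorm z ^+ 2 = n1 (xi z) ^+ 2 + nX (phi1 z) ^+ 2.
  rewrite (sipn_sqr H1) // (sipn_sqr H2) // (norm_comb _ _ _ H1) // (norm_comb _ _ _ H2) //.
  by rewrite enorm_sqr frob_row big_split_ord.
(* Coefficients of the terms linear in the unknown that remain once the truncated arguments are
   bounded by r. *)
pose c1 := fF * r; pose c2 := kC * nX E + cG * r * r.
have c10 : 0 <= c1 by rewrite mulr_ge0 // ltW.
have c20 : 0 <= c2.
  by rewrite addr_ge0 ?mulr_ge0 ?sipn_ge0 // ltW.
have sphi_le z : nX (s z *: (E + phi1 z)) <= r.
  have /andP[s0 s1] := s01 z; rewrite (sipnZ HX) // gtr0_norm //.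
  apply: le_trans (sN z); rewrite ler_pM2l // lerDr sipn_ge0 //.
have spr_le z : nX (s z *: pr (xi z)) <= r.
  have /andP[s0 s1] := s01 z; rewrite (sipnZ HX) // gtr0_norm //.
  apply: le_trans (sN z); rewrite ler_pM2l // lerDl sipn_ge0 //.
have E1 z : al / 2 * n1 (xi z) ^+ 2 - c1 * n1 (xi z) <= P1 z (xi z).
  have HA := A_coercive (Ssphi z) (Sxi z).
  have := B_le (Sspr z) (Sxi z) (Sxi z); rewrite ler_norml => /andP[HB _].
  have := F_le (Ssphi z) (Sxi z); rewrite ler_norml => /andP[_ HF].
  have n0 := sipn_ge0 ip1 (xi z).
  have b1 : be * nX (s z *: pr (xi z)) <= al / 2.
    by apply: le_trans ber; rewrite ler_wpM2l.
  have b2 : be * nX (s z *: pr (xi z)) * n1 (xi z) * n1 (xi z) <= al / 2 * n1 (xi z) ^+ 2.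
    by rewrite -mulrA -expr2 ler_wpM2r // sqr_ge0.
  have b3 : fF * nX (s z *: (E + phi1 z)) * n1 (xi z) <= c1 * n1 (xi z).
    by rewrite ler_wpM2r // ler_wpM2l.
  rewrite /P1; lra.
have E2 z : alt * nX (phi1 z) ^+ 2 - c2 * nX (phi1 z) <= P2 z (phi1 z).
  have SXphi1 : SX (phi1 z) by exact/S2X.
  have HC := C_coercive (Sphi1 z).
  have := C_le SXE SXphi1; rewrite ler_norml => /andP[HC2 _].
  have := G_le (Sspr z) (Ssphi z) SXphi1; rewrite ler_norml => /andP[_ HG].
  have n0 := sipn_ge0 ipX (phi1 z).
  have b1 : cG * nX (s z *: pr (xi z)) * nX (s z *: (E + phi1 z)) <= cG * r * r.
    by apply: ler_pM; rewrite ?mulr_ge0 ?sipn_ge0 // ler_wpM2l.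
  have b3 : cG * nX (s z *: pr (xi z)) * nX (s z *: (E + phi1 z)) * nX (phi1 z) <=
      cG * r * r * nX (phi1 z) by rewrite ler_wpM2r.
  rewrite /P2 (linSD (C_l SXphi1)) // /c2; lra.
pose mn := Num.min (al / 2) alt.
have mn0 : 0 < mn by rewrite lt_min alt0 divr_gt0.
(* The radius makes mn rho^2 at least (c1 + c2) rho, so the quadratic part wins on the sphere; the
   added 1 keeps rho positive. *)
pose rho := (c1 + c2) / mn + 1.
have rho0 : 0 < rho by apply: ltr_wpDl => //; apply: divr_ge0; [exact: addr_ge0|exact: ltW].
have [|z Pz0] := @zero_of_outward_field R _ P rho rho0 cP.
  move=> z zrho; rewrite PzE.
  have zz := znorm z; rewrite zrho in zz.
  have n10 := sipn_ge0 ip1 (xi z); have nX0 := sipn_ge0 ipX (phi1 z).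
  have n1r : n1 (xi z) <= rho.
    by rewrite -ler_sqr ?nnegrE ?(ltW rho0) // zz lerDl sqr_ge0.
  have nXr : nX (phi1 z) <= rho.
    by rewrite -ler_sqr ?nnegrE ?(ltW rho0) // zz lerDr sqr_ge0.
  have e1 := E1 z; have e2 := E2 z.
  have f1 : c1 * n1 (xi z) <= c1 * rho by rewrite ler_wpM2l.
  have f2 : c2 * nX (phi1 z) <= c2 * rho by rewrite ler_wpM2l.
  have g1 : mn * n1 (xi z) ^+ 2 <= al / 2 * n1 (xi z) ^+ 2.
    by rewrite ler_wpM2r ?sqr_ge0 // ge_min lexx.
  have g2 : mn * nX (phi1 z) ^+ 2 <= alt * nX (phi1 z) ^+ 2.
    by rewrite ler_wpM2r ?sqr_ge0 // ge_min lexx orbT.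
  have g3 : (c1 + c2) * rho <= mn * rho ^+ 2.
    rewrite expr2 mulrA ler_pM2r // /rho mulrDr mulr1 mulrCA divff ?gt_eqF // mulr1.
    by rewrite lerDl ltW.
  rewrite zz in g3; lra.
have P1e i : P1 z (e i) = 0.
  by move/rowP: Pz0 => /(_ (lshift d2 i)); rewrite !mxE (unsplitK (inl i)).
have P2p j : P2 z (p j) = 0.
  by move/rowP: Pz0 => /(_ (rshift d1 j)); rewrite !mxE (unsplitK (inr j)).
have P1_null eta : S1 eta -> n1 eta = 0 -> P1 z eta = 0.
  move=> Seta eta0; rewrite /P1 A_null // add0r.
  have := B_le (Sspr z) (Sxi z) Seta; rewrite eta0 mulr0 normr_le0 => /eqP ->.
  have := F_le (Ssphi z) Seta; rewrite eta0 mulr0 normr_le0 => /eqP ->.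
  by rewrite subr0.
have P2_null psi : S2 psi -> nX psi = 0 -> P2 z psi = 0.
  move=> /S2X Spsi psi0; rewrite /P2.
  have := C_le (Sphi z) Spsi; rewrite psi0 mulr0 normr_le0 => /eqP ->.
  have := G_le (Sspr z) (Ssphi z) Spsi; rewrite psi0 mulr0 normr_le0 => /eqP ->.
  by rewrite subr0.
(* The projection of eta on the orthonormal family is annihilated because P z = 0, and the rest is
   null, where the residual vanishes by [P1_null]. *)
have P1z eta : S1 eta -> P1 z eta = 0.
  move=> Seta; pose w := \sum_i ip1 eta (e i) *: e i.
  have Sw : S1 w by apply: (sipS_sum H1) => i; exact: (sipSZ H1).
  have Sew : S1 (eta - w) by rewrite -scaleN1r; apply: (sipSD H1) => //; exact: (sipSZ H1).
  have -> : eta = (eta - w) + w by rewrite subrK.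
  rewrite (linSD (P1_r z)) // P1_null // ?espan // add0r.
  by rewrite (linS_comb H1 (P1_r z) _ Se) big1 // => i _; rewrite P1e mulr0.
have P2z psi : S2 psi -> P2 z psi = 0.
  move=> Spsi; pose w := \sum_i ipX psi (p i) *: p i.
  have Sw : S2 w by apply: (sipS_sum H2) => i; exact: (sipSZ H2).
  have Spw : S2 (psi - w) by rewrite -scaleN1r; apply: (sipSD H2) => //; exact: (sipSZ H2).
  have -> : psi = (psi - w) + w by rewrite subrK.
  rewrite (linSD (P2_r z)) // P2_null // ?pspan // add0r.
  by rewrite (linS_comb H2 (P2_r z) _ Sp) big1 // => i _; rewrite P2p mulr0.
exists (xi z), (phi1 z), (s z); split => //.
- split => // Nr; rewrite /s /M max_l // divff // gt_eqF //.
- by move=> eta /P1z /eqP; rewrite /P1 subr_eq0 => /eqP.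
- by move=> psi /P2z /eqP; rewrite /P2 subr_eq0 => /eqP.
Qed.

End galerkin.

(** * The discrete spaces *)

Section matrix_algebra.
Context {R : realType}.

Lemma dev_linear n : linear (@dev R n).
Proof.
move=> a A B; rewrite /dev linearD linearZ /= mulrDl raddfD /= -mulrA.
by rewrite -scale_scalar_mx opprD addrACA scalerBr.
Qed.

Lemma sympart_linear n : linear (@sympart R n).
Proof.
by move=> a A B; apply/matrixP => i j; rewrite !mxE; ring.
Qed.

Lemma skewpart_linear n : linear (@skewpart R n).
Proof.
by move=> a A B; apply/matrixP => i j; rewrite !mxE; ring.
Qed.

Lemma frob_scalar n (A : 'M[R]_n) c : frob A c%:M = c * \tr A.
Proof.
rewrite /frob /mxtrace mulr_sumr; apply: eq_bigr => i _.
rewrite (bigD1 i) //= big1 ?addr0 => [|j ji]; last by rewrite mxE eq_sym (negPf ji) mulr0.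
by rewrite mxE eqxx mulrC.
Qed.

(** The deviator is an orthogonal projection: the squared norm drops by (tr A)^2 / n. *)
Lemma enorm_dev n (A : 'M[R]_n) : (0 < n)%N -> enorm (dev A) <= enorm A.
Proof.
move=> n0; apply: ler_wsqrtr; set c := \tr A / n%:R.
have nn : n%:R != 0 :> R by rewrite pnatr_eq0 -lt0n.
have E : frob (dev A) (dev A) = frob A A - (\tr A) ^+ 2 / n%:R.
  rewrite /dev -/c -scaleN1r addrC frobDl frobZl !frobDr !frobZr.
  rewrite frob_scalar (frobC _ A) frob_scalar mxtrace_scalar /c.
  by rewrite -mulr_natr; field.
by rewrite E gerBl divr_ge0 ?sqr_ge0.
Qed.

Lemma tensE n (u w : 'rV[R]_n) i j : tens u w i j = u 0 i * w 0 j.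
Proof. by rewrite mxE big_ord1 mxE. Qed.

Lemma enorm_tens n (u w : 'rV[R]_n) : enorm (tens u w) = enorm u * enorm w.
Proof.
rewrite /enorm -sqrtrM ?frob_ge0 //; congr Num.sqrt.
rewrite !frob_row mulr_suml; apply: eq_bigr => i _; rewrite mulr_sumr.
by apply: eq_bigr => j _; rewrite !tensE; ring.
Qed.

Lemma mxappE n (A : 'M[R]_n) (w : 'rV[R]_n) i : mxapp A w 0 i = \sum_j A i j * w 0 j.
Proof. by rewrite mxE; apply: eq_bigr => j _; rewrite mxE mulrC. Qed.

Lemma frob_mxapp n (A : 'M[R]_n) (w v : 'rV[R]_n) :
  frob (mxapp A w) v = frob A (tens v w).
Proof.
rewrite frob_row; apply: eq_bigr => i _; rewrite mxappE mulr_suml.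
by apply: eq_bigr => j _; rewrite tensE; ring.
Qed.

Lemma frob_mulmx_columns n p (K : 'M[R]_n) (A : 'M[R]_(n, p)) k0 :
  (forall y : 'rV[R]_n, k0 * enorm y ^+ 2 <= frob (mxapp K y) y) ->
  k0 * frob A A <= frob (K *m A) A.
Proof.
move=> Kpos; pose y j := \row_i A i j.
have -> : frob A A = \sum_j enorm (y j) ^+ 2.
  rewrite /frob exchange_big; apply: eq_bigr => j _; rewrite enorm_sqr frob_row.
  by apply: eq_bigr => i _; rewrite mxE.
have -> : frob (K *m A) A = \sum_j frob (mxapp K (y j)) (y j).
  rewrite /frob exchange_big; apply: eq_bigr => j _; rewrite -[RHS]/(frob _ _) frob_row.
  apply: eq_bigr => i _; rewrite mxappE !mxE; congr (_ * _).
  by apply: eq_bigr => l _; rewrite mxE.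
by rewrite mulr_sumr; apply: ler_sum => j _; exact: Kpos.
Qed.

(** A diagonal K multiplies row i of A by K_ii, so the largest entry bounds the product without a
    dimensional factor. This is how the entrywise sup norm of K enters the final constant
    unchanged. *)
Lemma enorm_diag_mulmx n p (K : 'M[R]_n) (A : 'M[R]_(n, p)) M : 0 <= M ->
  is_diag_mx K -> (forall i, `|K i i| <= M) -> enorm (K *m A) <= M * enorm A.
Proof.
move=> M0 /is_diag_mxP Kd KM.
rewrite -[M in leRHS]ger0_norm // -sqrtr_sqr /enorm -sqrtrM ?sqr_ge0 //.
apply: ler_wsqrtr; rewrite /frob mulr_sumr; apply: ler_sum => i _.
rewrite mulr_sumr; apply: ler_sum => j _.
have -> : (K *m A) i j = K i i * A i j.
  rewrite mxE (bigD1 i) //= big1 ?addr0 // => l li.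
  by rewrite Kd ?mul0r // eq_sym; apply: contra li => /eqP/val_inj ->.
rewrite mulrACA; apply: ler_wpM2r; first by rewrite -expr2 sqr_ge0.
by rewrite -expr2 -real_normK ?num_real // ler_sqr ?nnegrE.
Qed.

End matrix_algebra.

Section linS_closure.
Context {R : realType} {V : lmodType R} {S : V -> Prop}.
Implicit Types f g : V -> R.

Lemma linS_add f g : linS S f -> linS S g -> linS S (fun u => f u + g u).
Proof. by move=> lf lg a u v Su Sv; rewrite lf // lg // mulrDr addrACA. Qed.

Lemma linS_scale c f : linS S f -> linS S (fun u => c * f u).
Proof. by move=> lf a u v Su Sv; rewrite lf // mulrDr mulrCA. Qed.

Lemma linS_opp f : linS S f -> linS S (fun u => - f u).
Proof. by move=> lf a u v Su Sv; rewrite lf // opprD mulrN. Qed.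

End linS_closure.

(** * Operators into L^2, linear up to null sets *)

Section L2_operators.
Context {R : realType} {n : nat} (Omega : set 'rV[R]_n).
Hypotheses (oO : open Omega) (bO : bounded_set Omega).
Context {V : lmodType R} (S : V -> Prop) (ip : V -> V -> R).
Hypothesis HS : semi_ip S ip.

(** Gradients and divergences are chosen representatives, hence linear only almost everywhere. The
    last clause, that null elements have null images, makes the forms vanish on null test functions.
    All terms of the forms are L^2 products of such operators. *)
Definition l2op {p q : nat} (T : V -> 'rV[R]_n -> 'M[R]_(p, q)) : Prop :=
  [/\ forall u, S u -> L2 Omega (T u),
      forall a u v, S u -> S v -> aeq Omega (T (a *: u + v)) (a *: T u + T v) &
      forall u, S u -> sipn ip u = 0 -> aeq Omega (T u) 0].

Lemma l2op_pointwise p q p' q' (L : 'rV[R]_n -> 'M[R]_(p, q) -> 'M[R]_(p', q'))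
    (T : V -> 'rV[R]_n -> 'M[R]_(p, q)) :
  (forall x, linear (L x)) ->
  (forall f, L2 Omega f -> L2 Omega (fun x => L x (f x))) ->
  l2op T -> l2op (fun u x => L x (T u x)).
Proof.
move=> HL LL [T1 T2 T3]; split => [u Su|a u v Su Sv|u Su u0]; first exact/LL/T1.
- by apply: filterS (T2 a u v Su Sv) => x /= H Ox; rewrite H // HL.
- apply: filterS (T3 u Su u0) => x /= H Ox; rewrite H //.
  by apply: (addrI (L x 0)); have := HL x 1 0 0; rewrite !scale1r !addr0.
Qed.

Lemma l2op_linear p q p' q' (L : 'M[R]_(p, q) -> 'M[R]_(p', q'))
    (T : V -> 'rV[R]_n -> 'M[R]_(p, q)) :
  linear L -> l2op T -> l2op (fun u x => L (T u x)).
Proof.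
by move=> HL; apply: (l2op_pointwise (L := fun=> L)) => // f; exact: (L2_linear oO bO).
Qed.

Lemma l2op_lincomb p q c (T U : V -> 'rV[R]_n -> 'M[R]_(p, q)) :
  l2op T -> l2op U -> l2op (fun u x => c *: T u x + U u x).
Proof.
move=> [T1 T2 T3] [U1 U2 U3]; split => [u Su|a u v Su Sv|u Su u0].
- exact: (L2_lincomb oO c (T1 u Su) (U1 u Su)).
- apply: filterS2 (T2 a u v Su Sv) (U2 a u v Su Sv) => x /= H1 H2 Ox.
  rewrite H1 // H2 // [RHS]/GRing.add /= !scalerDr !scalerA addrACA.
  by rewrite (mulrC c).
- apply: filterS2 (T3 u Su u0) (U3 u Su u0) => x /= H1 H2 Ox.
  by rewrite H1 // H2 // scaler0 addr0.
Qed.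

Lemma linS_L2ipl p q (T : V -> 'rV[R]_n -> 'M[R]_(p, q)) g : l2op T -> L2 Omega g ->
  linS S (fun u => L2ip Omega (T u) g).
Proof.
move=> [T1 T2 _] Hg a u v Su Sv.
have Suv : S (a *: u + v) by exact: (sipS HS).
have LL := L2_lincomb oO a (T1 u Su) (T1 v Sv).
rewrite (L2ip_ae oO (T1 _ Suv) LL Hg Hg (T2 a u v Su Sv) (aeq_refl _ _)).
exact: (sipL (L2ip_sip oO bO p q) a (T1 u Su) (T1 v Sv) Hg).
Qed.

Lemma linS_L2ipr p q (T : V -> 'rV[R]_n -> 'M[R]_(p, q)) g : l2op T -> L2 Omega g ->
  linS S (fun u => L2ip Omega g (T u)).
Proof.
move=> HT Hg a u v Su Sv; have [T1 _ _] := HT.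
have Suv : S (a *: u + v) by exact: (sipS HS).
have C w : S w -> L2ip Omega g (T w) = L2ip Omega (T w) g.
  by move=> Sw; exact: (sipC (L2ip_sip oO bO p q) Hg (T1 w Sw)).
by rewrite !C //; exact: linS_L2ipl.
Qed.

Lemma l2op_L2norm0 p q (T : V -> 'rV[R]_n -> 'M[R]_(p, q)) u : l2op T -> S u ->
  sipn ip u = 0 -> L2norm Omega (T u) = 0.
Proof. by move=> [T1 _ T3] Su u0; apply: (L2norm_ae0 oO bO); [exact: T1|exact: T3]. Qed.

Lemma l2op_L2ip0 p q (T : V -> 'rV[R]_n -> 'M[R]_(p, q)) g u : l2op T -> S u ->
  sipn ip u = 0 -> L2 Omega g -> L2ip Omega g (T u) = 0.
Proof.
move=> HT Su u0 Hg; have [T1 _ _] := HT.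
have := L2ip_le oO bO Hg (T1 u Su).
by rewrite (l2op_L2norm0 HT Su u0) mulr0 normr_le0 => /eqP.
Qed.

End L2_operators.

(** * Finite dimension modulo null functions *)

Section finite_dimension.
Context {R : realType}.

(* The coordinates are a linear relation instead of a linear map: the
   piecewise polynomial representing v need not be unique. *)
Definition fdim {V : lmodType R} (P Z : V -> Prop) : Prop :=
  exists m (Rel : V -> 'rV[R]_m -> Prop),
    [/\ forall v, P v -> exists c, Rel v c,
        forall a u v c d, Rel u c -> Rel v d -> Rel (a *: u + v) (a *: c + d) &
        forall v, Rel v 0 -> Z v].

Lemma fdim_dependent (V : lmodType R) (P Z : V -> Prop) : fdim P Z ->
  exists m, forall f : 'I_m -> V, (forall i, P (f i)) ->
    exists2 c : 'I_m -> R, exists i, c i != 0 & Z (\sum_i c i *: f i).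
Proof.
move=> [m [Rel [R1 R2 R3]]]; exists m.+1 => f Pf.
have [c Hc] := choice (fun i => R1 (f i) (Pf i)).
pose A : 'M[R]_(m.+1, m) := \matrix_i c i.
(* The m + 1 coordinate rows live in R^m, so their matrix has a nonzero left kernel vector, whose
   entries are the coefficients sought. *)
have /rowV0Pn[v /sub_kermxP vA /rV0Pn[i vi]] : kermx A != 0.
  rewrite kermx_eq0 /row_free neq_ltn; apply/orP; left.
  by apply: leq_ltn_trans (rank_leq_col A) _.
exists (v 0); first by exists i.
apply: R3; rewrite -vA mulmx_sum_row.
have Rel0 : Rel 0 0.
  have := R2 (-1) _ _ _ _ (Hc ord0) (Hc ord0).
  by rewrite !scaleN1r !addNr.
elim: (index_enum _) => [|l s IH]; first by rewrite !big_nil.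
by rewrite !big_cons rowK; exact: R2.
Qed.

Lemma fdim_pair (V V1 V2 : lmodType R) (P Z : V -> Prop) (P1 Z1 : V1 -> Prop)
    (P2 Z2 : V2 -> Prop) (p1 : V -> V1) (p2 : V -> V2) :
  linear p1 -> linear p2 -> fdim P1 Z1 -> fdim P2 Z2 ->
  (forall v, P v -> P1 (p1 v) /\ P2 (p2 v)) ->
  (forall v, Z1 (p1 v) -> Z2 (p2 v) -> Z v) -> fdim P Z.
Proof.
move=> l1 l2 [m1 [Rel1 [A1 B1 C1]]] [m2 [Rel2 [A2 B2 C2]]] HP HZ.
exists (m1 + m2)%N, (fun v c => Rel1 (p1 v) (lsubmx c) /\ Rel2 (p2 v) (rsubmx c)).
split.
- move=> v /HP[/A1[c1 H1] /A2[c2 H2]]; exists (row_mx c1 c2).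
  by rewrite row_mxKl row_mxKr.
- move=> a u v c d [H1 H2] [H3 H4]; rewrite l1 l2 !linearP; split; first exact: B1.
  exact: B2.
- by move=> v; rewrite !linear0 => -[/C1 ? /C2 ?]; exact: HZ.
Qed.

Lemma fdim_sub (V : lmodType R) (P Z P' Z' : V -> Prop) :
  (forall v, P' v -> P v) -> (forall v, Z v -> Z' v) -> fdim P Z -> fdim P' Z'.
Proof.
move=> PP ZZ [m [Rel [A B C]]]; exists m, Rel; split => //.
  by move=> v /PP; exact: A.
by move=> v /C; exact: ZZ.
Qed.

End finite_dimension.

Section piecewise_spans.
Context {R : realType} {n : nat}.

Lemma is_poly_lin k a (f g : 'rV[R]_n -> R) : is_poly k f -> is_poly k g ->
  is_poly k (fun x => a * f x + g x).
Proof.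
move=> [c Hc] [d Hd]; exists (fun l => a * c l + d l) => x.
rewrite Hc Hd mulr_sumr -big_split; apply: eq_bigr => l _ /=.
by rewrite mulrDl mulrA.
Qed.

Lemma is_polymx_lin k p q a (f g : 'rV[R]_n -> 'M[R]_(p, q)) :
  is_polymx k f -> is_polymx k g -> is_polymx k (a *: f + g).
Proof.
move=> Hf Hg i j; have := is_poly_lin a (Hf i j) (Hg i j).
by congr (is_poly _ _); apply/funext => x; rewrite !mxE.
Qed.

(** Exponents of total degree above k give the zero function, so that all exponent functions can
    serve as a finite index type. *)
Definition monomial k (a : {ffun 'I_n -> 'I_k.+1}) (x : 'rV[R]_n) : R :=
  if (\sum_i a i <= k)%N then \prod_i x 0 i ^+ a i else 0.

Definition polymx_basis k p q (m : 'I_p * 'I_q * {ffun 'I_n -> 'I_k.+1})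
    (x : 'rV[R]_n) : 'M[R]_(p, q) := monomial m.2 x *: delta_mx m.1.1 m.1.2.

Lemma is_polymx_span k p q (f : 'rV[R]_n -> 'M[R]_(p, q)) : is_polymx k f ->
  exists c, forall x, f x = \sum_m c m *: polymx_basis (k := k) m x.
Proof.
move=> Hf; have [c Hc] := choice (fun ij : 'I_p * 'I_q => Hf ij.1 ij.2).
exists (fun m => c m.1 m.2) => x; rewrite [LHS]matrix_sum_delta pair_bigA.
rewrite (eq_bigr (fun ij => \sum_a (c ij a) *: polymx_basis (ij, a) x)); last first.
  move=> ij _; rewrite Hc scaler_suml big_mkcond; apply: eq_bigr => a _.
  rewrite /polymx_basis /monomial /=; case: ifP => _; first by rewrite scalerA.
  by rewrite scale0r scaler0.
by rewrite pair_bigA; apply: eq_bigr => -[].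
Qed.

(** A spanning family of the row-wise Raviart-Thomas space, in general not a basis: if q has degree
    below k, then q x already has entries of degree at most k. *)
Definition rt_basis k (m : 'I_n * 'I_n * {ffun 'I_n -> 'I_k.+1} +
    'I_n * 'I_1 * {ffun 'I_n -> 'I_k.+1}) (x : 'rV[R]_n) : 'M[R]_n :=
  match m with inl m => polymx_basis m x | inr m => polymx_basis m x *m x end.

Definition piecewise_span (J : finType) p q (B : J -> 'rV[R]_n -> 'M[R]_(p, q))
    (T : seq (seq 'rV[R]_n)) (f : 'rV[R]_n -> 'M[R]_(p, q)) : Prop :=
  forall K, K \in T -> exists c : J -> R,
    {ae leb n, forall x, hull K x -> f x = \sum_m c m *: B m x}.

Lemma fdim_piecewise_span (J : finType) p q (B : J -> 'rV[R]_n -> 'M[R]_(p, q))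
    (T : seq (seq 'rV[R]_n))
    (Omega : set 'rV[R]_n) : closure Omega = \bigcup_(K in [set` T]) hull K ->
  fdim (piecewise_span B T) (fun f => aeq Omega f 0).
Proof.
move=> cov.
pose JT := ('I_(size T) * J)%type.
exists #|{: JT}|, (fun (f : 'rV[R]_n -> 'M[R]_(p, q)) (c : 'rV[R]_#|{: JT}|) =>
   forall l : 'I_(size T),
  {ae leb n, forall x, hull (nth [::] T l) x -> f x = \sum_m c 0 (enum_rank (l, m)) *: B m x}).
split.
- move=> f Hf.
  have H (l : 'I_(size T)) : exists c : J -> R,
      {ae leb n, forall x, hull (nth [::] T l) x -> f x = \sum_m c m *: B m x}.
    by apply: Hf; exact: mem_nth.
  have [c Hc] := choice H.
  exists (\row_j c (enum_val j).1 (enum_val j).2) => l.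
  apply: filterS (Hc l) => x Hx lx; rewrite Hx //; apply: eq_bigr => m _.
  by rewrite mxE enum_rankK.
- move=> a u v c d Hc Hd l; apply: filterS2 (Hc l) (Hd l) => x H1 H2 lx.
  rewrite -[LHS]/(a *: u x + v x) H1 // H2 // scaler_sumr -big_split.
  by apply: eq_bigr => m _ /=; rewrite !mxE scalerDl scalerA.
- move=> f Hf; have : {ae leb n, forall x, forall l : 'I_(size T), hull (nth [::] T l) x -> f x = 0}.
    apply: filter_forall => l; apply: filterS (Hf l) => x Hx lx; rewrite Hx //.
    by rewrite big1 // => m _; rewrite mxE scale0r.
  apply: filterS => x Hx Ox; have : closure Omega x by exact: subset_closure.
  rewrite cov => -[K /= KT Kx].
  have lK : (index K T < size T)%N by rewrite index_mem.
  by apply: (Hx (Ordinal lK)); rewrite /= nth_index.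
Qed.

End piecewise_spans.

Section semi_ip_constructions.
Context {R : realType} {V : lmodType R} (S : V -> Prop).
Hypotheses (S0 : S 0) (Slin : forall a u v, S u -> S v -> S (a *: u + v)).

Lemma semi_ip_pull (W : lmodType R) (S' : W -> Prop) ip (p : V -> W) :
  linear p -> (forall u, S u -> S' (p u)) -> semi_ip S' ip ->
  semi_ip S (fun u v => ip (p u) (p v)).
Proof.
move=> lp pS H; split => // [u v Su Sv|a u v w Su Sv Sw|u Su].
- by rewrite (sipC H (pS _ Su) (pS _ Sv)).
- by rewrite lp (sipL H a (pS _ Su) (pS _ Sv) (pS _ Sw)).
- exact: (sip_ge0 H (pS _ Su)).
Qed.

Lemma semi_ip_add ip ip' : semi_ip S ip -> semi_ip S ip' ->
  semi_ip S (fun u v => ip u v + ip' u v).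
Proof.
move=> H H'; split => // [u v Su Sv|a u v w Su Sv Sw|u Su].
- by rewrite (sipC H Su Sv) (sipC H' Su Sv).
- by rewrite (sipL H a Su Sv Sw) (sipL H' a Su Sv Sw) mulrDr addrACA.
- by apply: addr_ge0; [exact: (sip_ge0 H Su)|exact: (sip_ge0 H' Su)].
Qed.

End semi_ip_constructions.

Section discrete_spaces.
Context {R : realType} {n : nat} (n0 : (0 < n)%N) (Omega : set 'rV[R]_n).
Hypotheses (oO : open Omega) (bO : bounded_set Omega).
Variables (T : seq (seq 'rV[R]_n)) (k : nat).
Hypothesis hT : triangulation Omega T.

Let cov : closure Omega = \bigcup_(K in [set` T]) hull K.
Proof. by have [_ H _] := hT. Qed.

Lemma is_polymx0 m p q : is_polymx m (0 : 'rV[R]_n -> 'M[R]_(p, q)).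
Proof.
by move=> i j; exists (fun=> 0) => x; rewrite mxE big1 // => a _; rewrite mul0r.
Qed.

Lemma Hphi0 : Hphi Omega T k 0.
Proof.
split; first exact: cst_continuous.
by move=> K _; exists 0; split => //; exact: is_polymx0.
Qed.

Lemma Hphi_lin a (u v : 'rV[R]_n -> 'rV[R]_n) :
  Hphi Omega T k u -> Hphi Omega T k v -> Hphi Omega T k (a *: u + v).
Proof.
move=> [cu Hu] [cv Hv]; split.
  apply: continuous_mx => i j; rewrite (_ : (fun _ => _) = fun x => a * u x i j + v x i j).
    apply: continuous_addf; last exact: continuous_entry.
    by apply: continuous_mulf; [exact: cst_continuous|exact: continuous_entry].
  by apply/funext => x; rewrite !mxE.
move=> K KT; have [P [HP uP]] := Hu K KT; have [Q [HQ vQ]] := Hv K KT.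
exists (a *: P + Q); split; first exact: is_polymx_lin.
by move=> x Kx; rewrite -[LHS]/(a *: u x + v x) uP // vQ.
Qed.

Lemma HphiD0 D : HphiD Omega D T k 0.
Proof. by split => //; exact: Hphi0. Qed.

Lemma HphiD_lin D a (u v : 'rV[R]_n -> 'rV[R]_n) :
  HphiD Omega D T k u -> HphiD Omega D T k v -> HphiD Omega D T k (a *: u + v).
Proof.
move=> [Hu u0] [Hv v0]; split; first exact: Hphi_lin.
by move=> x Dx; rewrite -[LHS]/(a *: u x + v x) u0 // v0 // scaler0 addr0.
Qed.

Lemma Hphi_sip : semi_ip (Hphi Omega T k) (H1ip Omega).
Proof.
apply: (semi_ip_pull Hphi0 Hphi_lin (p := id) _ _ (H1ip_sip oO bO n)) => //.
exact: Hphi_H1.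
Qed.

Lemma HphiD_sip D : semi_ip (HphiD Omega D T k) (H1ip Omega).
Proof.
apply: (semi_ip_pull (HphiD0 D) (@HphiD_lin D) (p := id) _ _ Hphi_sip) => //.
by move=> u [].
Qed.

Lemma Hphi_norm u : Hphi Omega T k u -> H1norm Omega u = sipn (H1ip Omega) u.
Proof. by move=> Hu; apply: (H1norm_sipn oO bO); exact: (Hphi_H1 n0 oO bO hT Hu). Qed.

Lemma L2tr0 : L2tr Omega 0.
Proof.
split; first exact: L2_zero.
by apply: aeW => x _; rewrite trmx0 mxtrace0.
Qed.

Lemma L2tr_lin a (r s : 'rV[R]_n -> 'M[R]_n) : L2tr Omega r -> L2tr Omega s ->
  L2tr Omega (a *: r + s).
Proof.
move=> [Lr Hr] [Ls Hs]; split; first exact: L2_lincomb.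
apply: filterS2 Hr Hs => x H1 H2 Ox; have [rt r0] := H1 Ox; have [st s0] := H2 Ox.
rewrite -[(a *: r + s) x]/(a *: r x + s x) !linearP /= r0 s0 mulr0 addr0.
by rewrite rt st.
Qed.

Lemma Ht0 : Ht Omega T k 0.
Proof.
split; first exact: L2tr0.
by move=> K _; exists 0; split; [exact: is_polymx0|exact: aeW].
Qed.

Lemma Ht_lin a r s : Ht Omega T k r -> Ht Omega T k s -> Ht Omega T k (a *: r + s).
Proof.
move=> [Hr Pr] [Hs Ps]; split; first exact: L2tr_lin.
move=> K KT; have [P [HP rP]] := Pr K KT; have [Q [HQ sQ]] := Ps K KT.
exists (a *: P + Q); split; first exact: is_polymx_lin.
apply: filterS2 rP sQ => x H1 H2 Kx.
by rewrite -[LHS]/(a *: r x + s x) H1 // H2.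
Qed.

Lemma L2_cst p q (A : 'M[R]_(p, q)) : L2 Omega (cst A).
Proof.
by move=> i j; apply: (L2s_bounded oO bO (C := `|A i j|)) => //; exact: measurable_cst.
Qed.

Lemma H0divE tau : H0div Omega tau <->
  Hdiv Omega tau /\ L2ip Omega tau (cst 1%:M) = 0.
Proof.
have E : L2ip Omega tau (cst 1%:M) = \int[leb n]_(x in Omega) \tr (tau x).
  by apply: eq_Rintegral => x _; rewrite frob_scalar mul1r.
by rewrite E; split => [[? ? ?]|[[? ?] ?]]; split.
Qed.

Lemma Hdiv0 : Hdiv Omega 0.
Proof. by have [] := Hdiv_ae0 oO bO (@L2_zero _ _ _ oO bO n n) (aeq_refl _ _). Qed.

Lemma H0div0 : H0div Omega 0.
Proof.
apply/H0divE; split; first exact: Hdiv0.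
by rewrite (sip0l (L2ip_sip oO bO n n)) //; exact: L2_cst.
Qed.

Lemma H0div_lin a s t : H0div Omega s -> H0div Omega t -> H0div Omega (a *: s + t).
Proof.
move=> /H0divE[Hs s0] /H0divE[Ht t0]; apply/H0divE; split.
  by have [] := Hdiv_lin oO bO a Hs Ht.
have [Ls _] := Hs; have [Lt _] := Ht.
by rewrite (sipL (L2ip_sip oO bO n n) a Ls Lt (L2_cst _)) s0 t0 mulr0 addr0.
Qed.

Lemma Hsigma0 : Hsigma Omega T k 0.
Proof.
split; first exact: H0div0.
move=> K _; exists 0, 0; split; try exact: is_polymx0.
by apply: aeW => x _; rewrite -[RHS]/(0 + 0 *m x) mul0mx addr0.
Qed.

Lemma Hsigma_lin a s t : Hsigma Omega T k s -> Hsigma Omega T k t ->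
  Hsigma Omega T k (a *: s + t).
Proof.
move=> [Hs Ps] [Ht Pt]; split; first exact: H0div_lin.
move=> K KT; have [P [q [HP Hq sP]]] := Ps K KT.
have [P' [q' [HP' Hq' tP]]] := Pt K KT.
exists (a *: P + P'), (a *: q + q'); split; try exact: is_polymx_lin.
apply: filterS2 sP tP => x H1 H2 Kx.
rewrite -[LHS]/(a *: s x + t x) -[RHS]/(a *: P x + P' x + (a *: q x + q' x) *m x).
by rewrite H1 // H2 // mulmxDl -scalemxAl scalerDr addrACA.
Qed.

Definition Hdivip (s t : 'rV[R]_n -> 'M[R]_n) : R :=
  L2ip Omega s t + L2ip Omega (wdiv Omega s) (wdiv Omega t).

Lemma Hdivip_sip : semi_ip (Hdiv Omega) Hdivip.
Proof.
have S0 := L2ip_sip oO bO n n; have S1 := L2ip_sip oO bO 1 n.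
split.
- exact: Hdiv0.
- by move=> a u v Hu Hv; have [] := Hdiv_lin oO bO a Hu Hv.
- move=> u v Hu Hv; have [Gu _] := wdivP Hu; have [Gv _] := wdivP Hv.
  have [Lu _] := Hu; have [Lv _] := Hv.
  by rewrite /Hdivip (sipC S0 Lu Lv) (sipC S1 Gu Gv).
- move=> a u v w Hu Hv Hw; have [Gu _] := wdivP Hu; have [Gv _] := wdivP Hv.
  have [Gw _] := wdivP Hw; have [Lu _] := Hu; have [Lv _] := Hv; have [Lw _] := Hw.
  have [Huv E] := Hdiv_lin oO bO a Hu Hv; have [Guv _] := wdivP Huv.
  have GL : L2 Omega (a *: wdiv Omega u + wdiv Omega v) by exact: L2_lincomb.
  rewrite /Hdivip (sipL S0 a Lu Lv Lw).
  rewrite (L2ip_ae oO Guv GL Gw Gw E (aeq_refl _ _)) (sipL S1 a Gu Gv Gw).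
  by rewrite mulrDr addrACA.
- move=> u Hu; have [Gu _] := wdivP Hu; have [Lu _] := Hu.
  by apply: addr_ge0; [exact: (sip_ge0 S0 Lu)|exact: (sip_ge0 S1 Gu)].
Qed.

Notation V := (('rV[R]_n -> 'M[R]_n) * ('rV[R]_n -> 'M[R]_n) *
  ('rV[R]_n -> 'rV[R]_n))%type.

Definition HHip (xi eta : V) : R :=
  L2ip Omega xi.1.1 eta.1.1 + Hdivip xi.1.2 eta.1.2 + H1ip Omega xi.2 eta.2.

Notation S1 := (HHh Omega T k : V -> Prop).

Lemma HHhP (xi : V) :
  S1 xi <-> [/\ Ht Omega T k xi.1.1, Hsigma Omega T k xi.1.2 & Hu Omega T k xi.2].
Proof. by case: xi => -[]. Qed.

Lemma HHh0 : S1 0.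
Proof. by apply/HHhP; split; [exact: Ht0|exact: Hsigma0|exact: HphiD0]. Qed.

Lemma HHh_lin a (xi eta : V) : S1 xi -> S1 eta -> S1 (a *: xi + eta).
Proof.
move=> /HHhP[? ? ?] /HHhP[? ? ?]; apply/HHhP.
by split; [exact: Ht_lin|exact: Hsigma_lin|exact: HphiD_lin].
Qed.

Lemma HHh_L2 (xi : V) : S1 xi ->
  [/\ L2 Omega xi.1.1, Hdiv Omega xi.1.2 & H1 Omega xi.2].
Proof.
by move=> /HHhP[[[? _] _] [/H0divE[? _] _] [/(Hphi_H1 n0 oO bO hT) ? _]].
Qed.

Lemma HHip_sip : semi_ip S1 HHip.
Proof.
apply: (semi_ip_add HHh0 HHh_lin); first apply: (semi_ip_add HHh0 HHh_lin).
- apply: (semi_ip_pull HHh0 HHh_lin (p := fun xi : V => xi.1.1) _ _ (L2ip_sip oO bO n n)) => //.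
  by move=> xi /HHh_L2[].
- apply: (semi_ip_pull HHh0 HHh_lin (p := fun xi : V => xi.1.2) _ _ Hdivip_sip) => //.
  by move=> xi /HHh_L2[].
- apply: (semi_ip_pull HHh0 HHh_lin (p := fun xi : V => xi.2) _ _ (H1ip_sip oO bO n)) => //.
  by move=> xi /HHh_L2[].
Qed.

Lemma HHip_sqr (xi : V) : S1 xi -> HHip xi xi =
  L2norm Omega xi.1.1 ^+ 2 +
  (L2norm Omega xi.1.2 ^+ 2 + L2norm Omega (wdiv Omega xi.1.2) ^+ 2) +
  (L2norm Omega xi.2 ^+ 2 + L2norm Omega (wgrad Omega xi.2) ^+ 2).
Proof.
move=> /HHh_L2[L1 Hd Hg].
have [L2 _] := Hd; have [L3 _] := wdivP Hd; have [L4 _] := Hg; have [L5 _] := wgradP Hg.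
by rewrite !(L2norm_sqr oO bO).
Qed.

Lemma HHnorm_sipn (xi : V) : S1 xi -> HHnorm Omega xi = sipn HHip xi.
Proof.
move=> Sxi; rewrite /sipn HHip_sqr //; case: xi Sxi => -[r tau] v Sxi.
rewrite /HHnorm /Hdivnorm /H1norm /H1semi /=.
by rewrite [in X in _ + X + _]sqr_sqrtr ?addr_ge0 ?sqr_ge0 // [in X in _ + X]sqr_sqrtr ?addr_ge0 ?sqr_ge0.
Qed.

(** Conformity of the discrete spaces, which makes the coercivity of [form_A], assumed on the
    continuous space, available for discrete triples. *)
Lemma HH_of_HHh (xi : V) : S1 xi -> HH Omega xi.
Proof.
move=> /HHhP; case: xi => -[r tau] v [[Hr _] [Htau _] Hv]; split; [exact: Hr|exact: Htau|].
exact: (HphiD_H1D n0 oO bO hT Hv).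
Qed.

Lemma l2op_of_le (W : lmodType R) (S : W -> Prop) ip p q
    (L : W -> 'rV[R]_n -> 'M[R]_(p, q)) :
  (forall u, S u -> L2 Omega (L u)) ->
  (forall a u v, S u -> S v -> aeq Omega (L (a *: u + v)) (a *: L u + L v)) ->
  (forall u, S u -> L2norm Omega (L u) <= sipn ip u) -> l2op Omega S ip L.
Proof.
move=> H1 H2 H3; split => // u Su u0.
apply: (L2norm_eq0 oO bO); first exact: H1.
by apply/eqP; rewrite eq_le L2norm_ge0 andbT -u0; exact: H3.
Qed.

Let le_sqrt_add (a b : R) : 0 <= a -> a ^+ 2 <= b -> a <= Num.sqrt b.
Proof. by move=> a0 ab; rewrite -[a]ger0_norm // -sqrtr_sqr ler_wsqrtr. Qed.

Lemma HHh_le (xi : V) : S1 xi ->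
  [/\ L2norm Omega xi.1.1 <= sipn HHip xi, L2norm Omega xi.1.2 <= sipn HHip xi,
    L2norm Omega (wdiv Omega xi.1.2) <= sipn HHip xi &
    H1norm Omega xi.2 <= sipn HHip xi].
Proof.
move=> Sxi; rewrite /sipn HHip_sqr //.
have H p q (f : 'rV[R]_n -> 'M[R]_(p, q)) := sqr_ge0 (L2norm Omega f).
have H1 := H _ _ xi.1.1; have H2 := H _ _ xi.1.2; have H3 := H _ _ (wdiv Omega xi.1.2).
have H4 := H _ _ xi.2; have H5 := H _ _ (wgrad Omega xi.2).
split; try (by apply: le_sqrt_add; [exact: L2norm_ge0|lra]).
by apply: ler_wsqrtr; rewrite /H1semi; lra.
Qed.

Notation op1 := (l2op Omega S1 HHip).
Notation opX := (l2op Omega (Hphi Omega T k) (H1ip Omega)).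

Lemma l2op_t : op1 (fun xi : V => xi.1.1).
Proof.
apply: l2op_of_le => [u /HHh_L2[]//|a u v _ _|u /HHh_le[]//]; exact: aeq_refl.
Qed.

Lemma l2op_sigma : op1 (fun xi : V => xi.1.2).
Proof.
apply: l2op_of_le => [u /HHh_L2[_ []]//|a u v _ _|u /HHh_le[]//]; exact: aeq_refl.
Qed.

Lemma l2op_div : op1 (fun xi : V => wdiv Omega xi.1.2).
Proof.
apply: l2op_of_le => [u /HHh_L2[_ /wdivP[]]//|a u v|u /HHh_le[]//].
by move=> /HHh_L2[_ Hu _] /HHh_L2[_ Hv _]; have [] := Hdiv_lin oO bO a Hu Hv.
Qed.

Lemma l2op_u : op1 (fun xi : V => xi.2).
Proof.
apply: l2op_of_le => [u /HHh_L2[_ _ []]//|a u v _ _|u /HHh_le[_ _ _]]; first exact: aeq_refl.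
exact/le_trans/L2norm_le_H1.
Qed.

Lemma l2op_gradu : op1 (fun xi : V => wgrad Omega xi.2).
Proof.
apply: l2op_of_le => [u /HHh_L2[_ _ /wgradP[]]//|a u v|u /HHh_le[_ _ _]].
  by move=> /HHh_L2[_ _ Hu] /HHh_L2[_ _ Hv]; have [] := H1_lin oO bO a Hu Hv.
exact/le_trans/H1semi_le_H1.
Qed.

Lemma l2op_phi : opX (fun phi => phi).
Proof.
apply: l2op_of_le => [u /(Hphi_H1 n0 oO bO hT)[]//|a u v _ _|u Hu]; first exact: aeq_refl.
by rewrite -Hphi_norm //; exact: L2norm_le_H1.
Qed.

Lemma l2op_gradphi : opX (fun phi => wgrad Omega phi).
Proof.
apply: l2op_of_le => [u /(Hphi_H1 n0 oO bO hT)/wgradP[]//|a u v|u Hu].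
  move=> /(Hphi_H1 n0 oO bO hT) Hu /(Hphi_H1 n0 oO bO hT) Hv.
  by have [] := H1_lin oO bO a Hu Hv.
by rewrite -Hphi_norm //; exact: H1semi_le_H1.
Qed.

Lemma Hphi_piecewise_span psi : Hphi Omega T k psi ->
  piecewise_span (@polymx_basis R n k.+1 1 n) T psi.
Proof.
move=> [_ H] K KT; have [P [/is_polymx_span[c Hc] HP]] := H K KT.
by exists c; apply: aeW => x /HP ->; rewrite Hc.
Qed.

Lemma fdim_Hphi : fdim (Hphi Omega T k)
  (fun psi => Hphi Omega T k psi -> sipn (H1ip Omega) psi = 0).
Proof.
apply: fdim_sub (fdim_piecewise_span (@polymx_basis R n k.+1 1 n) cov).
  by move=> psi; exact: Hphi_piecewise_span.
move=> psi psi0 Hpsi; have Hp := Hphi_H1 n0 oO bO hT Hpsi.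
have [Lp _] := Hp; have [_ g0] := H1_ae0 oO bO Lp psi0; have [Gp _] := wgradP Hp.
rewrite -Hphi_norm // /H1norm /H1semi (L2norm_ae0 oO bO Lp psi0) (L2norm_ae0 oO bO Gp g0).
by rewrite expr0n addr0 sqrtr0.
Qed.

Lemma fdim_HHh : fdim S1 (fun xi => S1 xi -> sipn HHip xi = 0).
Proof.
apply: (fdim_pair (p1 := fun xi : V => xi.1) (p2 := fun xi : V => xi.2)
  (P1 := fun xi => Ht Omega T k xi.1 /\ Hsigma Omega T k xi.2)
  (Z1 := fun xi => aeq Omega xi.1 0 /\ aeq Omega xi.2 0) _ _ _
  (fdim_piecewise_span (@polymx_basis R n k.+1 1 n) cov)) => //.
- apply: (fdim_pair (p1 := fst) (p2 := snd) _ _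
    (fdim_piecewise_span (@polymx_basis R n k n n) cov)
    (fdim_piecewise_span (@rt_basis R n k) cov)) => // -[r tau] [[_ Hr] [_ Htau]].
  split => K KT.
    have [P [/is_polymx_span[c Hc] HP]] := Hr K KT.
    by exists c; apply: filterS HP => x H Kx; rewrite H // Hc.
  have [P [q [/is_polymx_span[c Hc] /is_polymx_span[d Hd] HP]]] := Htau K KT.
  exists (fun m => match m with inl m => c m | inr m => d m end).
  apply: filterS HP => x H Kx; rewrite H // Hc Hd big_sumType /=; congr (_ + _).
  by rewrite mulmx_suml; apply: eq_bigr => m _; rewrite -scalemxAl.
- by move=> xi /HHhP[H1 H2 [H3 _]]; split => //; exact: Hphi_piecewise_span.
move=> xi [r0 t0] v0 Sxi; have [Lr Hd Hv] := HHh_L2 Sxi.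
have [Lt _] := Hd; have [Lv _] := Hv; have [Ld _] := wdivP Hd; have [Lg _] := wgradP Hv.
have [_ d0] := Hdiv_ae0 oO bO Lt t0; have [_ g0] := H1_ae0 oO bO Lv v0.
rewrite /sipn HHip_sqr // (L2norm_ae0 oO bO Lr r0) (L2norm_ae0 oO bO Lt t0).
rewrite (L2norm_ae0 oO bO Ld d0) (L2norm_ae0 oO bO Lv v0) (L2norm_ae0 oO bO Lg g0).
by rewrite expr0n !addr0 sqrtr0.
Qed.

End discrete_spaces.

(** * Bounds on the forms *)

Section embedding.
Context {R : realType} {n : nat} (Omega : set 'rV[R]_n).
Hypotheses (oO : open Omega) (bO : bounded_set Omega).

Let mO : measurable Omega.
Proof. exact: open_measurable_rV. Qed.

(** Discrete functions are bounded, so the quartic integrals are finite from the outset and products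
    with L^2 fields stay in L^2; the embedding is used only for its constant. *)
Definition bounded_on {p q} (f : 'rV[R]_n -> 'M[R]_(p, q)) : Prop :=
  (forall i j, measurable_fun Omega (fun x => f x i j)) /\
  exists C, forall x, Omega x -> forall i j, `|f x i j| <= C.

Lemma bounded_on_frob p q (f : 'rV[R]_n -> 'M[R]_(p, q)) : bounded_on f ->
  L2s Omega (fun x => frob (f x) (f x)).
Proof.
move=> [mf [C fC]]; rewrite /frob.
apply: (L2s_sum oO bO) => i; apply: (L2s_sum oO bO) => j.
by apply: (L2sM oO (C := C)) (L2s_bounded oO bO (mf i j) _) => // x Ox; exact: fC.
Qed.

Lemma L4norm_pow p (v : 'rV[R]_n -> 'rV[R]_p) : bounded_on v ->
  (L4norm Omega v `^ 4 = (\int[leb n]_(x in Omega) (frob (v x) (v x) ^+ 2))%:E)%E.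
Proof.
move=> /bounded_on_frob[mv iv]; rewrite /L4norm poweR_Lnorm ?pnatr_eq0 //.
rewrite fineK; last exact: (integrable_fin_num mO iv).
rewrite [RHS]integral_mkcond; apply: eq_integral => x _; rewrite !patchE.
case: ifP => _; last by rewrite abse0 poweR0r // pnatr_eq0.
rewrite /= ger0_norm ?enorm_ge0 // powR_mulrn ?enorm_ge0 //.
by rewrite -enorm_sqr -exprM.
Qed.

(** The embedding norm is an extended real; equality of its square with a real number rules out the
    infinite values and identifies it with sqrt c. *)
Lemma embnorm_real c : c%:E = (embnorm Omega ^+ 2)%E ->
  0 <= c /\ embnorm Omega = (Num.sqrt c)%:E.
Proof.
move=> Ec.
have e0 : (0 <= embnorm Omega)%E.
  have [H0 E] := H1_ae0 oO bO (@L2_zero _ _ _ oO bO 1 n) (aeq_refl _ _).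
  apply: (@le_trans _ _ (L4norm Omega (0 : 'rV[R]_n -> 'rV[R]_n))).
    exact: Lnorm_ge0.
  apply: ereal_sup_ubound; exists 0 => //; split => //.
  have [G0 _] := wgradP H0; have [L0 _] := H0.
  rewrite /H1norm /H1semi (L2norm_ae0 oO bO L0 (aeq_refl _ _)).
  by rewrite (L2norm_ae0 oO bO G0 E) expr0n addr0 sqrtr0.
case: (embnorm Omega) e0 Ec => [b b0 [->]|//|//].
by rewrite -expr2 sqrtr_sqr ger0_norm // sqr_ge0.
Qed.

(** The embedding norm is a supremum over the unit ball, so v is divided by its norm. If the norm is
    0, then v is null and the integral vanishes. *)
Lemma L4_bound c (v : 'rV[R]_n -> 'rV[R]_n) : c%:E = (embnorm Omega ^+ 2)%E ->
  H1 Omega v -> bounded_on v ->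
  \int[leb n]_(x in Omega) (frob (v x) (v x) ^+ 2) <= (c * H1norm Omega v ^+ 2) ^+ 2.
Proof.
move=> Ec Hv bv; have [c0 Eb] := embnorm_real Ec; have S := H1ip_sip oO bO n.
have [mv iv] := bounded_on_frob bv.
pose N := H1norm Omega v.
have N0 : 0 <= N by exact: sqrtr_ge0.
have unit_ball (u : 'rV[R]_n -> 'rV[R]_n) : H1 Omega u -> bounded_on u -> H1norm Omega u <= 1 ->
    \int[leb n]_(x in Omega) (frob (u x) (u x) ^+ 2) <= c ^+ 2.
  move=> Hu bu u1; rewrite -lee_fin -L4norm_pow //.
  have : (L4norm Omega u <= (Num.sqrt c)%:E)%E.
    by rewrite -Eb; apply: ereal_sup_ubound; exists u.
  move=> /(@gt0_ler_poweR _ 4%R (ler0n _ _)) H.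
  apply: le_trans (H _ _) _; rewrite ?in_itv /= ?leey ?andbT ?Lnorm_ge0 ?lee_fin ?sqrtr_ge0 //.
  rewrite powR_mulrn ?sqrtr_ge0 // -[4%N]/(2 * 2)%N exprM sqr_sqrtr //.
have [NZ|NZ] := eqVneq N 0.
  have v0 : aeq Omega v 0.
    have [Lv _] := Hv; apply: (L2norm_eq0 oO bO Lv).
    by apply/eqP; rewrite eq_le L2norm_ge0 andbT -[leRHS]NZ L2norm_le_H1.
  rewrite (int_ae oO (g := cst 0)) //.
  - by rewrite Rintegral_cst // mul0r sqr_ge0.
  - exact: measurable_funX.
  - by apply: filterS v0 => x H Ox; rewrite H // frob0 expr0n.
have Np : 0 < N by rewrite lt_def NZ N0.
have Huv : H1 Omega (N^-1 *: v) by exact: (sipSZ S).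
have H : H1norm Omega (N^-1 *: v) <= 1.
  rewrite (H1norm_sipn oO bO Huv) (sipnZ S) // -(H1norm_sipn oO bO Hv) -/N.
  by rewrite gtr0_norm ?invr_gt0 // mulVf.
have bN : bounded_on (N^-1 *: v).
  have [mv' [C vC]] := bv; split.
    move=> i j; rewrite (_ : (fun _ => _) = fun x => N^-1 * v x i j).
      by apply: measurable_funM => //; exact: measurable_cst.
    by apply/funext => x; rewrite !mxE.
  by exists (N^-1 * C) => x Ox i j; rewrite mxE normrM gtr0_norm ?invr_gt0 //
    ler_pM2l ?invr_gt0 // vC.
have := unit_ball _ Huv bN H.
rewrite (@eq_Rintegral _ _ _ _ _ (fun x => N^-1 ^+ 4 * (frob (v x) (v x) ^+ 2))); last first.
  move=> x _; rewrite -[(N^-1 *: v) x]/(N^-1 *: v x) frobZl frobZr; ring.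
rewrite int_scalef // exprVn mulrC ler_pdivrMr ?exprn_gt0 // -/N => {}H.
by rewrite exprMn -exprM.
Qed.

Lemma tens_L2 (u w : 'rV[R]_n -> 'rV[R]_n) :
  L2 Omega u -> bounded_on w -> L2 Omega (fun x => tens (u x) (w x)).
Proof.
move=> Lu [mw [C wC]] i j; rewrite -/(L2s Omega _).
rewrite (_ : (fun _ => _) = fun x => w x 0 j * u x 0 i); last first.
  by apply/funext => x; rewrite tensE mulrC.
by apply: (L2sM oO (C := C)) => // x Ox; exact: wC.
Qed.

Lemma L2norm_tens c (u w : 'rV[R]_n -> 'rV[R]_n) : c%:E = (embnorm Omega ^+ 2)%E ->
  H1 Omega u -> bounded_on u -> H1 Omega w -> bounded_on w ->
  L2norm Omega (fun x => tens (u x) (w x)) <= c * H1norm Omega u * H1norm Omega w.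
Proof.
move=> Ec Hu bu Hw bw; have [c0 _] := embnorm_real Ec.
(* The scalar |v|^2 is viewed as a field of 1 x 1 matrices: since |u (x) w|^2 = |u|^2 |w|^2, the
   Cauchy-Schwarz inequality for matrix fields splits the integral into two fourth-power
   integrals. *)
pose f (v : 'rV[R]_n -> 'rV[R]_n) x : 'M[R]_1 := (frob (v x) (v x))%:M.
have Lf v : bounded_on v -> L2 Omega (f v).
  move=> bv i j; rewrite -/(L2s Omega _).
  rewrite (_ : (fun _ => _) = fun x => frob (v x) (v x)); first exact: bounded_on_frob.
  by apply/funext => x; rewrite mxE !ord1.
have frobf v v' x : frob (f v x) (f v' x) = frob (v x) (v x) * frob (v' x) (v' x).
  by rewrite frob_row big_ord1 !mxE.
have nf v : H1 Omega v -> bounded_on v -> L2norm Omega (f v) <= c * H1norm Omega v ^+ 2.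
  move=> Hv bv; have cN : 0 <= c * H1norm Omega v ^+ 2 by rewrite mulr_ge0 ?sqr_ge0.
  rewrite -(ger0_norm cN) -sqrtr_sqr.
  apply: ler_wsqrtr; apply: le_trans (L4_bound Ec Hv bv).
  by rewrite (@eq_Rintegral _ _ _ _ _ (fun x => frob (v x) (v x) ^+ 2)) // => x _; rewrite frobf.
have [Lu _] := Hu.
have N0 v : 0 <= H1norm Omega v by exact: sqrtr_ge0.
rewrite -ler_sqr ?nnegrE ?L2norm_ge0 ?mulr_ge0 //.
rewrite (L2norm_sqr oO bO (tens_L2 Lu bw)).
have -> : L2ip Omega (fun x => tens (u x) (w x)) (fun x => tens (u x) (w x)) =
    L2ip Omega (f u) (f w).
  apply: eq_Rintegral => x _; rewrite frobf -!enorm_sqr enorm_tens; ring.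
apply: le_trans (ler_norm _) _; apply: le_trans (L2ip_le oO bO (Lf _ bu) (Lf _ bw)) _.
apply: le_trans (ler_pM _ _ (nf _ Hu bu) (nf _ Hw bw)) _; rewrite ?L2norm_ge0 //.
move: (H1norm _ u) (H1norm _ w) => a b.
by rewrite [leLHS]mulrACA -expr2 -!exprMn mulrA.
Qed.

Lemma Linfty_ae p q (K : 'rV[R]_n -> 'M[R]_(p, q)) : Linfty Omega K ->
  {ae leb n, forall x, Omega x -> forall i j, `|K x i j| <= Linftynorm Omega K}.
Proof.
move=> HK.
have H ij : {ae leb n, forall x, Omega x -> `|K x ij.1 ij.2| <= Linftynorm Omega K}.
  case: ij => i j /=; have [_ Kfin] := HK i j.
  set L := Lnorm _ _ _ in Kfin.
  have LK : (L <= (Linftynorm Omega K)%:E)%E.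
    have Lf : L \is a fin_num by rewrite ge0_fin_numE // Lnorm_ge0.
    rewrite -(fineK Lf) lee_fin /Linftynorm.
    apply: (@le_trans _ _ (\big[Num.max/0]_j
      fine (Lnorm (leb n) +oo ((fun x => (K x i j)%:E) \_ Omega)))).
      exact: (le_bigmax _ (fun j => fine (Lnorm (leb n) +oo
        ((fun x => (K x i j)%:E) \_ Omega))) j).
    exact: (le_bigmax _ (fun i => \big[Num.max/0]_j fine (Lnorm (leb n) +oo
        ((fun x => (K x i j)%:E) \_ Omega))) i).
  (* The norm with exponent infinity is the essential supremum when the whole space has positive
     measure; in the other case every statement holds almost everywhere. *)
  move: LK; rewrite /L unlock; case: ifPn => [_ /ess_supP|]; last first.
    rewrite -leNgt => m0 _; have {}m0 : leb n [set: 'rV[R]_n] = 0%E.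
      by apply/eqP; rewrite eq_le m0 measure_ge0.
    by exists setT.
  apply: filterS => x /= Hx Ox; move: Hx; rewrite patchE.
  by case: ifPn => [_|/negP]; [rewrite lee_fin|rewrite inE].
have : {ae leb n, forall x, forall ij : 'I_p * 'I_q, Omega x ->
    `|K x ij.1 ij.2| <= Linftynorm Omega K}.
  by apply: filter_forall => ij; exact: H.
by apply: filterS => x Hx Ox i j; exact: (Hx (i, j)).
Qed.

End embedding.

Section multipliers.
Context {R : realType} {n : nat} (Omega : set 'rV[R]_n).
Hypotheses (oO : open Omega) (bO : bounded_set Omega).

Let mO : measurable Omega.
Proof. exact: open_measurable_rV. Qed.

Lemma L2s_ae (f g : 'rV[R]_n -> R) : measurable_fun Omega f -> L2s Omega g ->
  {ae leb n, forall x, Omega x -> f x = g x} -> L2s Omega f.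
Proof.
move=> mf [mg ig] fg; split => //; move/integrableP: ig => [mg2 ig].
apply/integrableP; split; first by apply/measurable_EFinP; exact: measurable_funX.
rewrite (ae_eq_integral (fun x => `|(g x ^+ 2)%:E|)%E) //.
- by apply: measurableT_comp => //; apply/measurable_EFinP; exact: measurable_funX.
- by apply: measurableT_comp => //; apply/measurable_EFinP; exact: measurable_funX.
- by apply: filterS fg => x H Ox; rewrite H.
Qed.

Lemma L2_mulmx_Linfty p q r (K : 'rV[R]_n -> 'M[R]_(p, q)) (f : 'rV[R]_n -> 'M[R]_(q, r)) :
  Linfty Omega K -> L2 Omega f -> L2 Omega (fun x => K x *m f x).
Proof.
move=> HK Lf i j; rewrite -/(L2s Omega _).
rewrite (_ : (fun _ => _) = fun x => \sum_l K x i l * f x l j); last first.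
  by apply/funext => x; rewrite mxE.
apply: (L2s_sum oO bO) => l; have [mK _] := HK i l.
have Lfl := L2_entry l j Lf; have [mf _] := Lfl.
set M := Linftynorm Omega K.
(* The entries of K are bounded only almost everywhere; clipping them at the essential bound gives
   an everywhere bounded multiplier that agrees almost everywhere. *)
pose m x := Num.max (- M) (Num.min M (K x i l)).
have mm : measurable_fun Omega m.
  by apply: measurable_maxr => //; apply: measurable_minr.
have mM x : Omega x -> `|m x| <= `|M|.
  move=> _; rewrite /m; case: (lerP M (K x i l)) => h; case: (lerP (- M) _) => h'.
  - by [].
  - by rewrite normrN.
  - rewrite ler_norml (le_trans _ h') ?lerN2 ?ler_norm //=.
    exact/ltW/(lt_le_trans h)/ler_norm.
  - by rewrite normrN.
apply: L2s_ae (L2sM oO mm mM Lfl) _; first exact: measurable_funM.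
apply: filterS (Linfty_ae HK) => x Hx Ox; have := Hx Ox i l.
by rewrite -/M ler_norml => /andP[h1 h2]; rewrite /m min_r // max_r.
Qed.

Lemma tens_L2r (u w : 'rV[R]_n -> 'rV[R]_n) : bounded_on Omega u -> L2 Omega w ->
  L2 Omega (fun x => tens (u x) (w x)).
Proof.
move=> [mu [C uC]] Lw i j; rewrite -/(L2s Omega _).
rewrite (_ : (fun _ => _) = fun x => u x 0 i * w x 0 j); last first.
  by apply/funext => x; rewrite tensE.
by apply: (L2sM oO (C := C)) => // x Ox; exact: uC.
Qed.

End multipliers.

Section tens_linear.
Context {R : realType} {n : nat}.

Lemma tens_linearl (w : 'rV[R]_n) : linear (fun u : 'rV[R]_n => tens u w).
Proof. by move=> a u v; apply/matrixP => i j; rewrite !mxE !big_ord1 !mxE; ring. Qed.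

Lemma tens_linearr (u : 'rV[R]_n) : linear (fun w : 'rV[R]_n => tens u w).
Proof. by move=> a w v; apply/matrixP => i j; rewrite !mxE !big_ord1 !mxE; ring. Qed.

Lemma linear_comp p q p' q' p'' q'' (L : 'M[R]_(p, q) -> 'M[R]_(p', q'))
    (M : 'M[R]_(p', q') -> 'M[R]_(p'', q'')) : linear L -> linear M ->
  linear (fun A => M (L A)).
Proof. by move=> HL HM a u v; rewrite HL HM. Qed.

Lemma enorm_le_entries p q (A : 'M[R]_(p, q)) C : (forall i j, `|A i j| <= C) ->
  enorm A <= Num.sqrt (\sum_(i < p) \sum_(j < q) C ^+ 2).
Proof.
move=> AC; apply: ler_wsqrtr; apply: ler_sum => i _; apply: ler_sum => j _.
rewrite -expr2 -real_normK ?num_real // ler_sqr ?nnegrE //.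
by apply: le_trans (AC i j).
Qed.

Lemma enorm_sum (I : Type) (s : seq I) p q (A : I -> 'M[R]_(p, q)) :
  enorm (\sum_(i <- s) A i) <= \sum_(i <- s) enorm (A i).
Proof.
elim: s => [|i s IH]; first by rewrite !big_nil enorm0.
by rewrite !big_cons; apply: le_trans (enorm_triangle _ _) _; rewrite lerD2l.
Qed.

Lemma first_two_entry (y : 'rV[R]_n) C : (forall i, `|y 0 i| <= C) ->
  forall i j, `|first_two y i j| <= \sum_(l < n) C.
Proof.
move=> yC i j; rewrite mxE; apply: le_trans (ler_norm_sum _ _ _) _.
apply: ler_sum => l _; rewrite normrM (ord1 i); apply: le_trans (yC l).
by rewrite ler_piMr // mxE; case: (_ && _); rewrite ?normr1 ?normr0.
Qed.

(** Cauchy-Schwarz would give the factor sqrt(1 + c^2); the larger sqrt(2 + c^2) is the one in [r0]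
    and [CA], with c standing for kappa3 in the bound of B and for kappa2 in that of F. *)
Lemma sqrt_weight (c a b s : R) : 0 <= c -> 0 <= a -> 0 <= b -> 0 <= s ->
  a ^+ 2 + b ^+ 2 <= s ^+ 2 -> c * a + b <= Num.sqrt (2 + c ^+ 2) * s.
Proof.
move=> c0 a0 b0 s0 H.
have q0 : 0 <= 2 + c ^+ 2 by rewrite addr_ge0 ?sqr_ge0.
rewrite -ler_sqr ?nnegrE ?addr_ge0 ?mulr_ge0 ?sqrtr_ge0 //.
rewrite exprMn sqr_sqrtr //; have := sqr_ge0 (c * b - a).
have := ler_wpM2l q0 H; have := sqr_ge0 a; have := sqr_ge0 b; nra.
Qed.

End tens_linear.

Lemma linS_ext (R : realType) (V : lmodType R) (S : V -> Prop) (f g : V -> R) :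
  f =1 g -> linS S g -> linS S f.
Proof. by move=> /funext ->. Qed.

(** * Linearity and continuity of the form A *)

Section forms.
Context {R : realType} {n : nat} (n0 : (0 < n)%N) (Omega : set 'rV[R]_n).
Hypotheses (oO : open Omega) (bO : bounded_set Omega).
Variables (T : seq (seq 'rV[R]_n)) (k : nat).
Hypothesis hT : triangulation Omega T.

Let mO : measurable Omega.
Proof. exact: open_measurable_rV. Qed.

Notation V := (('rV[R]_n -> 'M[R]_n) * ('rV[R]_n -> 'M[R]_n) *
  ('rV[R]_n -> 'rV[R]_n))%type.
Notation S1 := (HHh Omega T k : V -> Prop).
Notation SX := (Hphi Omega T k).
Notation op1 := (l2op Omega S1 (HHip Omega)).

Let H1s : semi_ip S1 (HHip Omega) := HHip_sip n0 oO bO k hT.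
Let HXs : semi_ip SX (H1ip Omega) := Hphi_sip n0 oO bO k hT.

Lemma Hphi_bounded_on psi : SX psi -> bounded_on Omega psi.
Proof.
move=> Hpsi; have [cpsi _] := Hpsi; have [C _ HC] := Hphi_bounded bO hT Hpsi.
split; first by move=> i j; rewrite (ord1 i); exact: Hphi_measurable.
by exists C => x Ox i j; rewrite (ord1 i); apply: HC; exact: subset_closure.
Qed.

Lemma HHh_u (xi : V) : S1 xi -> SX xi.2.
Proof. by move=> /HHhP[_ _ []]. Qed.

Lemma op_dev : op1 (fun xi x => dev (xi.1.2 x)).
Proof. exact: l2op_linear (@dev_linear R n) (l2op_sigma n0 oO bO k hT). Qed.

Lemma op_sym : op1 (fun xi x => sympart (wgrad Omega xi.2 x)).
Proof. exact: l2op_linear (@sympart_linear R n) (l2op_gradu n0 oO bO k hT). Qed.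

Lemma op_skew : op1 (fun xi x => skewpart (wgrad Omega xi.2 x)).
Proof. exact: l2op_linear (@skewpart_linear R n) (l2op_gradu n0 oO bO k hT). Qed.

Lemma op_sub p q c (L M : V -> 'rV[R]_n -> 'M[R]_(p, q)) : op1 L -> op1 M ->
  op1 (fun xi x => L xi x - c *: M xi x).
Proof.
move=> HL HM; rewrite (_ : (fun _ _ => _) = fun xi x => (- c) *: M xi x + L xi x).
  exact: l2op_lincomb.
by apply/funext => xi; apply/funext => x; rewrite scaleNr addrC.
Qed.

Section form_A_theory.
Variables (nu : 'rV[R]_2 -> R) (nu2 Lnu gamma kappa1 kappa2 kappa3 : R).
Hypothesis nuB : forall y, `|nu y| <= nu2.
Hypothesis nuL : forall y z, `|nu y - nu z| <= Lnu * enorm (y - z).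

Notation nuf phi := (fun x => nu (first_two (phi x))).

Lemma continuous_nu : continuous nu.
Proof.
apply: (@continuous_of_modulus R 'rV[R]_2 nu (fun y z => Lnu * enorm (y - z))) => // [y|y].
  apply: continuous_mulf; first exact: cst_continuous.
  have ce : continuous (fun z : 'rV[R]_2 => y - z).
    apply: continuous_mx => i j; under eq_fun do rewrite !mxE.
    apply: continuous_subf; first exact: cst_continuous.
    exact: coord_continuous.
  by apply: continuous_sqrtf; exact: continuous_frob.
by rewrite subrr enorm0 mulr0.
Qed.

Lemma measurable_nuf phi : SX phi -> measurable_fun Omega (nuf phi).
Proof.
(* The scalar nu(phi) is repeated as a constant row so that the measurability result for continuous
   row fields applies; n > 0 provides an entry to read. *)
move=> [cphi _]; pose psi x : 'rV[R]_n := const_mx (nu (first_two (phi x))).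
have cpsi : {within closure Omega, continuous psi}.
  apply: continuous_mx => i j; under eq_fun do rewrite mxE.
  apply: (@continuous_compf (subspace (closure Omega)) _ _ (fun x => first_two (phi x)) nu); last exact: continuous_nu.
  apply: continuous_mx => i' j'; under eq_fun do rewrite mxE.
  apply: continuous_sum => l; apply: continuous_mulf; last exact: cst_continuous.
  exact: continuous_entry.
have := Hphi_measurable oO (Ordinal n0) cpsi.
by under eq_fun do rewrite mxE.
Qed.

Lemma L2_nuf p q phi (f : 'rV[R]_n -> 'M[R]_(p, q)) : SX phi -> L2 Omega f ->
  L2 Omega (fun x => nu (first_two (phi x)) *: f x).
Proof.
by move=> Hphi; apply: (L2_mulb oO (C := nu2)); [exact: measurable_nuf|move=> x _; exact: nuB].
Qed.

Notation A := (form_A Omega nu gamma kappa1 kappa2 kappa3).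
Notation N := (fun (xi : V) x => xi.1.1 x - kappa3 *: dev (xi.1.2 x)).
Notation e := (fun (xi : V) x => sympart (wgrad Omega xi.2 x)).
Notation om := (fun (xi : V) x => skewpart (wgrad Omega xi.2 x)).
Notation M := (fun (xi : V) x => dev (xi.1.2 x) - kappa1 *: e xi x).

Lemma form_AE phi (xi eta : V) : A phi xi eta =
  2 * L2ip Omega (fun x => nu (first_two (phi x)) *: xi.1.1 x) (N eta)
  + L2ip Omega xi.1.1 (M eta) - L2ip Omega (fun x => dev (xi.1.2 x)) (N eta)
  + (1 - kappa2 * gamma) * L2ip Omega xi.2 (wdiv Omega eta.1.2)
  - L2ip Omega eta.2 (wdiv Omega xi.1.2) + L2ip Omega (om xi) eta.1.2
  - L2ip Omega xi.1.2 (om eta) + gamma * L2ip Omega xi.2 eta.2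
  + kappa2 * L2ip Omega (wdiv Omega xi.1.2) (wdiv Omega eta.1.2)
  + kappa1 * L2ip Omega (e xi) (e eta).
Proof.
case: xi eta => -[t s] u [[r tau] v].
have -> : L2ip Omega (fun x => nu (first_two (phi x)) *: t x)
    (fun x => r x - kappa3 *: dev (tau x)) = \int[leb n]_(x in Omega)
      (nu (first_two (phi x)) * frob (t x) (r x - kappa3 *: dev (tau x))).
  by apply: eq_Rintegral => x _; rewrite frobZl.
reflexivity.
Qed.

Lemma op_N : op1 N.
Proof. exact: op_sub (l2op_t n0 oO bO k hT) op_dev. Qed.

Lemma op_M : op1 M.
Proof. exact: op_sub op_dev op_sym. Qed.

Let L2op p q (L : V -> 'rV[R]_n -> 'M[R]_(p, q)) xi : op1 L -> S1 xi -> L2 Omega (L xi).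
Proof. by move=> [H _ _]; exact: H. Qed.

Let opt := l2op_t n0 oO bO k hT.
Let ops := l2op_sigma n0 oO bO k hT.
Let opd := l2op_div n0 oO bO k hT.
Let opu := l2op_u n0 oO bO k hT.

Lemma form_A_linl phi eta : SX phi -> S1 eta -> linS S1 (fun xi => A phi xi eta).
Proof.
move=> Hphi Seta; have LL := @linS_L2ipl _ _ _ oO bO _ _ _ H1s.
have LR := @linS_L2ipr _ _ _ oO bO _ _ _ H1s.
apply: (linS_ext (fun xi => form_AE phi xi eta)).
do 9?[apply: linS_add]; try apply: linS_opp; try apply: linS_scale.
- apply: (LL _ _ (fun (xi : V) x => nu (first_two (phi x)) *: xi.1.1 x)).
    apply: (l2op_pointwise (L := fun x B => nu (first_two (phi x)) *: B)) opt.
      by move=> x a B C; rewrite scalerDr !scalerA mulrC.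
    by move=> f; exact: L2_nuf.
  exact: L2op op_N Seta.
- exact: LL opt (L2op op_M Seta).
- exact: LL op_dev (L2op op_N Seta).
- exact: LL opu (L2op opd Seta).
- exact: LR opd (L2op opu Seta).
- exact: LL op_skew (L2op ops Seta).
- exact: LL ops (L2op op_skew Seta).
- exact: LL opu (L2op opu Seta).
- exact: LL opd (L2op opd Seta).
- exact: LL op_sym (L2op op_sym Seta).
Qed.

Lemma form_A_linr phi xi : SX phi -> S1 xi -> linS S1 (A phi xi).
Proof.
move=> Hphi Sxi; have LL := @linS_L2ipl _ _ _ oO bO _ _ _ H1s.
have LR := @linS_L2ipr _ _ _ oO bO _ _ _ H1s.
apply: (linS_ext (form_AE phi xi)).
do 9?[apply: linS_add]; try apply: linS_opp; try apply: linS_scale.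
- exact: LR op_N (L2_nuf Hphi (L2op opt Sxi)).
- exact: LR op_M (L2op opt Sxi).
- exact: LR op_N (L2op op_dev Sxi).
- exact: LR opd (L2op opu Sxi).
- exact: LL opu (L2op opd Sxi).
- exact: LR ops (L2op op_skew Sxi).
- exact: LR op_skew (L2op ops Sxi).
- exact: LR opu (L2op opu Sxi).
- exact: LR opd (L2op opd Sxi).
- exact: LR op_sym (L2op op_sym Sxi).
Qed.

Lemma form_A_null phi xi eta : SX phi -> S1 xi -> S1 eta ->
  sipn (HHip Omega) eta = 0 -> A phi xi eta = 0.
Proof.
move=> Hphi Sxi Seta eta0; rewrite form_AE.
have Z p q (L : V -> 'rV[R]_n -> 'M[R]_(p, q)) g : op1 L -> L2 Omega g ->
    L2ip Omega g (L eta) = 0.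
  by move=> HL Hg; exact: (l2op_L2ip0 oO bO HL Seta eta0 Hg).
rewrite (Z _ _ _ _ op_N (L2_nuf Hphi (L2op opt Sxi))) (Z _ _ _ _ op_M (L2op opt Sxi)).
rewrite (Z _ _ _ _ op_N (L2op op_dev Sxi)) (Z _ _ _ _ opd (L2op opu Sxi)).
rewrite (sipC (L2ip_sip oO bO 1 n) (L2op opu Seta) (L2op opd Sxi)).
rewrite (Z _ _ _ _ opu (L2op opd Sxi)) (Z _ _ _ _ ops (L2op op_skew Sxi)).
rewrite (Z _ _ _ _ op_skew (L2op ops Sxi)) (Z _ _ _ _ opu (L2op opu Sxi)).
rewrite (Z _ _ _ _ opd (L2op opd Sxi)) (Z _ _ _ _ op_sym (L2op op_sym Sxi)).
by rewrite !mulr0 !subr0 !addr0.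
Qed.

(** Only the viscous integral depends on phi. The functions g l are bounded, so two combinations
    differ pointwise by at most a constant times the sum of |b_l - c_l|, and the Lipschitz property
    of nu carries this over to the integral. *)
Lemma form_A_lipschitz m (g : 'I_m -> 'rV[R]_n -> 'rV[R]_n) xi eta :
  (forall l, SX (g l)) -> S1 xi -> S1 eta -> exists L, forall b c : 'I_m -> R,
    `|A (\sum_l b l *: g l) xi eta - A (\sum_l c l *: g l) xi eta| <=
      L * \sum_l `|b l - c l|.
Proof.
move=> Sg Sxi Seta.
have HC l : exists C, forall x, Omega x -> enorm (first_two (g l x)) <= C.
  have [_ [C gC]] := Hphi_bounded_on (Sg l).
  exists (Num.sqrt (\sum_(i < 1) \sum_(j < 2) (\sum_(a < n) C) ^+ 2)) => x Ox.
  by apply: enorm_le_entries; apply: first_two_entry => i; exact: gC.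
have [C gC] := choice HC; pose D := \sum_l `|C l|.
have D0 : 0 <= D by exact: sumr_ge0.
have CD l : C l <= D.
  apply: le_trans (ler_norm _) _.
  by rewrite /D (bigD1 l) //= lerDl; exact: sumr_ge0.
pose h x := frob (xi.1.1 x) (N eta x).
have ih : integ Omega h := L2_integ_frob oO (L2op opt Sxi) (L2op op_N Seta).
have ihn : integ Omega (fun x => `|h x|) by exact: integrable_norm.
exists (2 * (`|Lnu| * D * \int[leb n]_(x in Omega) `|h x|)) => b c.
pose pb := \sum_l b l *: g l; pose pc := \sum_l c l *: g l.
have Ssum a : SX (\sum_l a l *: g l).
  by apply: (sipS_sum HXs) => l; exact: (sipSZ HXs).
pose I (phi : 'rV[R]_n -> 'rV[R]_n) := \int[leb n]_(x in Omega) (nu (first_two (phi x)) * h x).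
have E phi : L2ip Omega (fun x => nu (first_two (phi x)) *: xi.1.1 x) (N eta) = I phi.
  by apply: eq_Rintegral => x _; rewrite frobZl.
have iI phi : SX phi -> integ Omega (fun x => nu (first_two (phi x)) * h x).
  move=> Sphi.
  have := L2_integ_frob oO (L2_nuf Sphi (L2op opt Sxi)) (L2op op_N Seta).
  by under eq_fun do rewrite frobZl.
have -> : A pb xi eta - A pc xi eta = 2 * (I pb - I pc).
  rewrite !form_AE !E; move: (I pb) (I pc) => x y.
  (* The integrals that do not involve phi are generalised to variables and cancel. *)
  by repeat (match goal with |- context [L2ip Omega ?f ?g] =>
    generalize (L2ip Omega f g); intro end); ring.
rewrite normrM ger0_norm // -!mulrA ler_pM2l // !mulrA.
set s := \sum_l _.
have s0 : 0 <= s by exact: sumr_ge0.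
have pw x : Omega x -> `|nu (first_two (pb x)) - nu (first_two (pc x))| <= `|Lnu| * D * s.
  move=> Ox; apply: le_trans (nuL _ _) _.
  apply: le_trans (ler_wpM2r (enorm_ge0 _) (ler_norm Lnu)) _.
  rewrite -mulrA; apply: ler_wpM2l => //.
  have -> : first_two (pb x) - first_two (pc x) =
      \sum_l (b l - c l) *: first_two (g l x).
    rewrite /pb /pc !fct_sumE /first_two !mulmx_suml -sumrB; apply: eq_bigr => l _.
    by rewrite scalerBl -!scalemxAl.
  apply: le_trans (enorm_sum _ _) _; rewrite /s mulr_sumr; apply: ler_sum => l _.
  rewrite enormZ mulrC; apply: ler_wpM2r => //.
  exact: le_trans (gC l x Ox) (CD l).
have i2 : integ Omega (fun x => -1 * (nu (first_two (pc x)) * h x)).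
  exact: (integZ oO (-1) (iI _ (Ssum c))).
have -> : I pb - I pc = \int[leb n]_(x in Omega)
    (nu (first_two (pb x)) * h x + -1 * (nu (first_two (pc x)) * h x)).
  rewrite (int_addf oO (iI _ (Ssum b)) i2) (int_scalef oO (-1) (iI _ (Ssum c))).
  by rewrite mulN1r.
have ibc := integD oO (iI _ (Ssum b)) i2.
apply: le_trans (le_normr_Rintegral mO ibc) _.
rewrite mulrAC -(int_scalef oO _ ihn); apply: int_le => //.
- exact: integrable_norm.
- exact: integZ.
move=> x Ox; rewrite mulN1r -mulrBl normrM; apply: ler_wpM2r => //; exact: pw.
Qed.

End form_A_theory.

End forms.

(** * Linearity and bounds of the forms B, F, C and G *)

Section lower_order_forms.
Context {R : realType} {n : nat} (n0 : (0 < n)%N) (Omega : set 'rV[R]_n).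
Hypotheses (oO : open Omega) (bO : bounded_set Omega).
Variables (T : seq (seq 'rV[R]_n)) (k : nat).
Hypothesis hT : triangulation Omega T.

Notation V := (('rV[R]_n -> 'M[R]_n) * ('rV[R]_n -> 'M[R]_n) *
  ('rV[R]_n -> 'rV[R]_n))%type.
Notation S1 := (HHh Omega T k : V -> Prop).
Notation SX := (Hphi Omega T k).
Notation op1 := (l2op Omega S1 (HHip Omega)).
Notation n1 := (sipn (HHip Omega)).
Notation nX := (sipn (H1ip Omega)).

Let H1s : semi_ip S1 (HHip Omega) := HHip_sip n0 oO bO k hT.
Let HXs : semi_ip SX (H1ip Omega) := Hphi_sip n0 oO bO k hT.
Let opt := l2op_t n0 oO bO k hT.
Let ops := l2op_sigma n0 oO bO k hT.
Let opd := l2op_div n0 oO bO k hT.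
Let opu := l2op_u n0 oO bO k hT.
Let opg := l2op_gradphi n0 oO bO k hT.
Let opp := l2op_phi n0 oO bO k hT.
Let opdev := op_dev n0 oO bO k hT.

Let L2op (W : lmodType R) (S : W -> Prop) ip p q (L : W -> 'rV[R]_n -> 'M[R]_(p, q)) xi :
  l2op Omega S ip L -> S xi -> L2 Omega (L xi).
Proof. by move=> [H _ _]; exact: H. Qed.

Let bnd psi : SX psi -> bounded_on Omega psi.
Proof. exact: Hphi_bounded_on. Qed.

Let LX psi : SX psi -> L2 Omega psi.
Proof. exact: L2op opp. Qed.

Let N0 (psi : 'rV[R]_n -> 'rV[R]_n) : 0 <= nX psi.
Proof. exact: sipn_ge0. Qed.

Variables (kappa2 kappa3 : R) (alpha g : 'rV[R]_n).
Hypotheses (k20 : 0 <= kappa2) (k30 : 0 <= kappa3).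

Notation B := (form_B Omega kappa3).
Notation N := (fun (eta : V) x => kappa3 *: dev (eta.1.2 x) - eta.1.1 x).
Notation devt w u := (fun x => dev (tens (u x) (w x))).

Lemma form_BE w (xi eta : V) : B w xi eta = L2ip Omega (devt w xi.2) (N eta).
Proof. by case: xi eta => -[t s] u [[r tau] v]. Qed.

Lemma op_NB : op1 N.
Proof.
rewrite (_ : (fun _ _ => _) = fun eta x => kappa3 *: dev (eta.1.2 x) + (-1) *: eta.1.1 x).
  apply: l2op_lincomb => //.
  by apply: (l2op_linear oO bO _ opt) => a A C; rewrite !scaleN1r scalerN opprD.
by apply/funext => xi; apply/funext => x; rewrite scaleN1r.
Qed.

Let L2dev (w u : 'rV[R]_n -> 'rV[R]_n) :
  L2 Omega (fun x => tens (u x) (w x)) -> L2 Omega (devt w u).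
Proof. exact: (L2_linear oO bO (@dev_linear R n)). Qed.

Lemma form_B_w xi eta : S1 xi -> S1 eta -> linS SX (fun w => B w xi eta).
Proof.
move=> Sxi Seta; apply: (linS_ext (fun w => form_BE w xi eta)).
have bu := bnd (HHh_u Sxi).
apply: (linS_L2ipl oO bO HXs (T := fun w => devt w xi.2)); last exact: L2op op_NB Seta.
apply: (l2op_pointwise (L := fun x w => dev (tens (xi.2 x) w))) opp => [x|f Lf].
  exact: (linear_comp (tens_linearr (xi.2 x)) (@dev_linear R n)).
by apply: L2dev; exact: tens_L2r.
Qed.

Lemma form_B_l w eta : SX w -> S1 eta -> linS S1 (fun xi => B w xi eta).
Proof.
move=> Sw Seta; apply: (linS_ext (fun xi => form_BE w xi eta)).
have bw := bnd Sw.
apply: (linS_L2ipl oO bO H1s (T := fun xi : V => devt w xi.2)); last exact: L2op op_NB Seta.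
apply: (l2op_pointwise (L := fun x u => dev (tens u (w x)))) opu => [x|f Lf].
  exact: (linear_comp (tens_linearl (w x)) (@dev_linear R n)).
by apply: L2dev; exact: tens_L2.
Qed.

Let L2t w (xi : V) : SX w -> S1 xi -> L2 Omega (fun x => tens (xi.2 x) (w x)).
Proof. by move=> Sw Sxi; apply: (tens_L2 oO (L2op opu Sxi)); exact: bnd. Qed.

Lemma form_B_r w xi : SX w -> S1 xi -> linS S1 (B w xi).
Proof.
move=> Sw Sxi; apply: (linS_ext (form_BE w xi)).
by apply: (linS_L2ipr oO bO H1s op_NB); apply: L2dev; exact: L2t.
Qed.

Lemma L2norm_weight p q p' q' (f : 'rV[R]_n -> 'M[R]_(p, q))
    (f' : 'rV[R]_n -> 'M[R]_(p', q')) c s : 0 <= c -> 0 <= s ->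
  L2norm Omega f ^+ 2 + L2norm Omega f' ^+ 2 <= s ^+ 2 ->
  c * L2norm Omega f + L2norm Omega f' <= Num.sqrt (2 + c ^+ 2) * s.
Proof. by move=> c0 s0; apply: sqrt_weight => //; exact: L2norm_ge0. Qed.

Let n1_sqr (eta : V) : S1 eta -> n1 eta ^+ 2 =
  L2norm Omega eta.1.1 ^+ 2 +
  (L2norm Omega eta.1.2 ^+ 2 + L2norm Omega (wdiv Omega eta.1.2) ^+ 2) +
  (L2norm Omega eta.2 ^+ 2 + L2norm Omega (wgrad Omega eta.2) ^+ 2).
Proof. by move=> Seta; rewrite (sipn_sqr H1s Seta) (HHip_sqr n0 oO bO hT Seta). Qed.

Let L2norm_lin p q c (f h : 'rV[R]_n -> 'M[R]_(p, q)) : 0 <= c -> L2 Omega f ->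
  L2 Omega h -> L2norm Omega (c *: f + h) <= c * L2norm Omega f + L2norm Omega h.
Proof.
move=> c0 Lf Lh; have S := L2ip_sip oO bO p q.
have Scf : L2 Omega (c *: f) by exact: (sipSZ S).
have := sipnD S Scf Lh; rewrite (sipnZ S c Lf) ger0_norm //.
Qed.

Lemma L2norm_NB eta : S1 eta ->
  L2norm Omega (N eta) <= Num.sqrt (2 + kappa3 ^+ 2) * n1 eta.
Proof.
move=> Seta; have Lt := L2op opt Seta; have Ld := L2op opdev Seta.
have Ls := L2op ops Seta.
have Sopp := L2ip_sip oO bO n n.
have -> : N eta = kappa3 *: (fun x => dev (eta.1.2 x)) + (-1) *: eta.1.1.
  by rewrite scaleN1r.
have Lmt : L2 Omega ((-1) *: eta.1.1) by exact: (sipSZ Sopp).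
apply: le_trans (L2norm_lin k30 Ld Lmt) _.
rewrite [L2norm Omega (-1 *: _)](sipnZ Sopp) // normrN1 mul1r.
have H : L2norm Omega (fun x => dev (eta.1.2 x)) <= L2norm Omega eta.1.2.
  rewrite -[leRHS]mul1r; apply: (L2norm_le oO) => //.
  by apply: aeW => x _; rewrite mul1r; exact: enorm_dev.
apply: le_trans (lerD (ler_wpM2l k30 H) (lexx _)) _.
apply: L2norm_weight => //; first exact: sipn_ge0.
rewrite n1_sqr // addrC -addrA lerD2l addrAC -addrA lerDl -!addrA.
by rewrite !addr_ge0 ?sqr_ge0.
Qed.

Lemma form_B_le c w xi eta : c%:E = (embnorm Omega ^+ 2)%E -> SX w -> S1 xi -> S1 eta ->
  `|B w xi eta| <= c * Num.sqrt (2 + kappa3 ^+ 2) * nX w * n1 xi * n1 eta.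
Proof.
move=> Ec Sw Sxi Seta; have [c0 _] := embnorm_real oO bO Ec; have Lt := L2t Sw Sxi.
have Su := HHh_u Sxi; have Hw := Hphi_H1 n0 oO bO hT Sw; have Hu := Hphi_H1 n0 oO bO hT Su.
rewrite form_BE; apply: le_trans (L2ip_le oO bO (L2dev Lt) (L2op op_NB Seta)) _.
have h1 : L2norm Omega (devt w xi.2) <= c * (n1 xi * nX w).
  apply: (@le_trans _ _ (L2norm Omega (fun x => tens (xi.2 x) (w x)))).
    rewrite -[leRHS]mul1r; apply: (L2norm_le oO ler01 (L2dev Lt) Lt).
    by apply: aeW => x _; rewrite mul1r; exact: enorm_dev.
  apply: le_trans (L2norm_tens oO bO Ec Hu (bnd Su) Hw (bnd Sw)) _.
  rewrite -mulrA; apply: ler_wpM2l => //; rewrite (Hphi_norm n0 oO bO hT Sw).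
  apply: ler_wpM2r; first exact: N0.
  by have [_ _ _] := HHh_le n0 oO bO hT Sxi.
apply: le_trans (ler_pM (L2norm_ge0 _ _) (L2norm_ge0 _ _) h1 (L2norm_NB Seta)) _.
move: (n1 xi) (n1 eta) (nX w) (Num.sqrt _) => a b d s.
by rewrite le_eqVlt; apply/orP; left; apply/eqP; ring.
Qed.

Notation F := (form_F Omega kappa2 alpha g).
Notation W := (fun (eta : V) x => eta.2 x - kappa2 *: wdiv Omega eta.1.2 x).
Notation ag phi := (fun x => frob alpha (phi x) *: g).

Lemma form_FE phi (eta : V) : F phi eta = L2ip Omega (ag phi) (W eta).
Proof.
case: eta => -[r tau] v; apply: eq_Rintegral => x _; by rewrite frobZl.
Qed.

Let ag_linear : linear (fun y : 'rV[R]_n => frob alpha y *: g).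
Proof. by move=> a u v; rewrite frobDr frobZr scalerDl scalerA. Qed.

Let L2ag phi : SX phi -> L2 Omega (ag phi).
Proof. by move=> /LX; exact: (L2_linear oO bO ag_linear). Qed.

Let op_W : op1 W.
Proof. exact: (op_sub oO _ opu opd). Qed.

Lemma form_F_l eta : S1 eta -> linS SX (fun phi => F phi eta).
Proof.
move=> Seta; apply: (linS_ext (fun phi => form_FE phi eta)).
apply: (linS_L2ipl oO bO HXs (T := fun phi => ag phi)); last exact: L2op op_W Seta.
exact: (l2op_linear oO bO ag_linear opp).
Qed.

Lemma form_F_r phi : SX phi -> linS S1 (F phi).
Proof.
move=> Sphi; apply: (linS_ext (form_FE phi)).
by apply: (linS_L2ipr oO bO H1s op_W); exact: L2ag.
Qed.

Lemma form_F_le phi eta : SX phi -> S1 eta ->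
  `|F phi eta| <= enorm alpha * enorm g * Num.sqrt (2 + kappa2 ^+ 2) * nX phi * n1 eta.
Proof.
move=> Sphi Seta; rewrite form_FE.
have Lu := L2op opu Seta; have Ld := L2op opd Seta.
apply: le_trans (L2ip_le oO bO (L2ag Sphi) (L2op op_W Seta)) _.
have h1 : L2norm Omega (ag phi) <= enorm alpha * enorm g * nX phi.
  rewrite -(Hphi_norm n0 oO bO hT Sphi).
  have ag0 : 0 <= enorm alpha * enorm g by rewrite mulr_ge0 ?enorm_ge0.
  apply: le_trans (ler_wpM2l ag0 (L2norm_le_H1 Omega phi)).
  apply: (L2norm_le oO ag0 (L2ag Sphi) (LX Sphi)); apply: aeW => x _.
  rewrite enormZ mulrAC; apply: ler_wpM2r; first exact: enorm_ge0.
  exact: frob_le.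
have h2 : L2norm Omega (W eta) <= Num.sqrt (2 + kappa2 ^+ 2) * n1 eta.
  have Sv := L2ip_sip oO bO 1 n.
  (* Up to an overall sign, the nonnegative kappa2 becomes the leading coefficient, as the weighted
     estimate expects. *)
  have -> : W eta = (-1) *: (kappa2 *: wdiv Omega eta.1.2 + (-1) *: eta.2).
    by apply/funext => x; rewrite !scaleN1r opprB.
  have Lmu : L2 Omega ((-1) *: eta.2) by exact: (sipSZ Sv).
  have Lc := L2_lincomb oO kappa2 Ld Lmu.
  rewrite [leLHS](sipnZ Sv (-1) Lc) normrN1 mul1r.
  apply: le_trans (L2norm_lin k20 Ld Lmu) _.
  rewrite [L2norm Omega (-1 *: _)](sipnZ Sv (-1) Lu) normrN1 mul1r.
  apply: L2norm_weight => //; first exact: sipn_ge0.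
  rewrite n1_sqr //.
  have := sqr_ge0 (L2norm Omega eta.1.1); have := sqr_ge0 (L2norm Omega eta.1.2).
  by have := sqr_ge0 (L2norm Omega (wgrad Omega eta.2)); lra.
apply: le_trans (ler_pM (L2norm_ge0 _ _) (L2norm_ge0 _ _) h1 h2) _.
move: (nX phi) (n1 eta) (enorm alpha) (enorm g) (Num.sqrt _) => a b d s q.
by rewrite le_eqVlt; apply/orP; left; apply/eqP; ring.
Qed.

Section form_C_theory.
Variables (K : 'rV[R]_n -> 'M[R]_n) (k0 : R).
Hypotheses (hK : Linfty Omega K)
  (Kdiag : {ae leb n, forall x, Omega x -> is_diag_mx (K x)})
  (Kpos : {ae leb n, forall x, Omega x ->
     forall y : 'rV[R]_n, k0 * enorm y ^+ 2 <= frob (mxapp (K x) y) y}).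
Notation C := (form_C Omega K).

Lemma form_CE chi psi : C chi psi =
  L2ip Omega (fun x => K x *m wgrad Omega chi x) (wgrad Omega psi).
Proof. by []. Qed.

Let L2K chi : SX chi -> L2 Omega (fun x => K x *m wgrad Omega chi x).
Proof. by move=> S; exact: (L2_mulmx_Linfty oO bO hK (L2op opg S)). Qed.

Lemma form_C_l psi : SX psi -> linS SX (fun chi => C chi psi).
Proof.
move=> Spsi; apply: (linS_ext (fun chi => form_CE chi psi)).
apply: (linS_L2ipl oO bO HXs (T := fun chi x => K x *m wgrad Omega chi x));
  last exact: L2op opg Spsi.
apply: (l2op_pointwise (L := fun x A => K x *m A)) opg => [x a A A'|f Lf].
  by rewrite mulmxDr scalemxAr.
exact: (L2_mulmx_Linfty oO bO hK Lf).
Qed.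

Lemma form_C_r chi : SX chi -> linS SX (C chi).
Proof.
move=> Schi; apply: (linS_ext (form_CE chi)).
by apply: (linS_L2ipr oO bO HXs opg); exact: L2K.
Qed.

Lemma Linftynorm_ge0 : 0 <= Linftynorm Omega K.
Proof. exact: bigmax_ge_id. Qed.

Lemma form_C_le chi psi : SX chi -> SX psi ->
  `|C chi psi| <= Linftynorm Omega K * nX chi * nX psi.
Proof.
move=> Schi Spsi; have Gc := L2op opg Schi.
have M0 := Linftynorm_ge0; set M := Linftynorm Omega K in M0 *.
apply: le_trans (L2ip_le oO bO (L2K Schi) (L2op opg Spsi)) _.
apply: ler_pM; rewrite ?L2norm_ge0 //.
  apply: (@le_trans _ _ (M * L2norm Omega (wgrad Omega chi))).
    apply: (L2norm_le oO M0 (L2K Schi) Gc).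
    apply: filterS2 Kdiag (Linfty_ae hK) => x Kd KM Ox.
    apply: (enorm_diag_mulmx _ M0 (Kd Ox)) => i; exact: KM.
  apply: ler_wpM2l => //; rewrite -(Hphi_norm n0 oO bO hT Schi).
  exact: H1semi_le_H1.
rewrite -(Hphi_norm n0 oO bO hT Spsi); exact: H1semi_le_H1.
Qed.

Lemma form_C_ge psi : SX psi -> k0 * H1semi Omega psi ^+ 2 <= C psi psi.
Proof.
move=> Spsi; have Gp := L2op opg Spsi.
have iC := L2_integ_frob oO (L2K Spsi) Gp; have iG := L2_integ_frob oO Gp Gp.
rewrite /H1semi (L2norm_sqr oO bO Gp) /L2ip -(int_scalef oO k0 iG).
apply: (int_ae_le oO (integZ oO k0 iG) iC).
by apply: filterS Kpos => x H Ox; apply: frob_mulmx_columns; exact: H.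
Qed.

End form_C_theory.

Notation G := (form_G Omega).

(** Written as the gradient of phi against psi (x) w, the form has one L^2 factor and one tensor
    product, and the latter is controlled by the L^4 embedding. *)
Lemma form_GE w phi psi : G w phi psi =
  - L2ip Omega (wgrad Omega phi) (fun x => tens (psi x) (w x)).
Proof. by congr (- _); apply: eq_Rintegral => x _; rewrite frob_mxapp. Qed.

Let L2tX w psi : SX w -> SX psi -> L2 Omega (fun x => tens (psi x) (w x)).
Proof. by move=> Sw Spsi; apply: (tens_L2 oO (LX Spsi)); exact: bnd. Qed.

Lemma form_G_w phi psi : SX phi -> SX psi -> linS SX (fun w => G w phi psi).
Proof.
move=> Sphi Spsi; apply: (linS_ext (fun w => form_GE w phi psi)); apply: linS_opp.
apply: (linS_L2ipr oO bO HXs (T := fun w x => tens (psi x) (w x))); last exact: L2op opg Sphi.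
apply: (l2op_pointwise (L := fun x w => tens (psi x) w)) opp => [x|f Lf].
  exact: tens_linearr.
by apply: tens_L2r => //; exact: bnd.
Qed.

Lemma form_G_phi w psi : SX w -> SX psi -> linS SX (fun phi => G w phi psi).
Proof.
move=> Sw Spsi; apply: (linS_ext (fun phi => form_GE w phi psi)); apply: linS_opp.
by apply: (linS_L2ipl oO bO HXs opg); exact: L2tX.
Qed.

Lemma form_G_psi w phi : SX w -> SX phi -> linS SX (G w phi).
Proof.
move=> Sw Sphi; apply: (linS_ext (form_GE w phi)); apply: linS_opp.
apply: (linS_L2ipr oO bO HXs (T := fun psi x => tens (psi x) (w x))); last exact: L2op opg Sphi.
apply: (l2op_pointwise (L := fun x psi => tens psi (w x))) opp => [x|f Lf].
  exact: tens_linearl.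
by apply: tens_L2 => //; exact: bnd.
Qed.

Lemma form_G_le c w phi psi : c%:E = (embnorm Omega ^+ 2)%E ->
  SX w -> SX phi -> SX psi -> `|G w phi psi| <= c * nX w * nX phi * nX psi.
Proof.
move=> Ec Sw Sphi Spsi; rewrite form_GE normrN.
have Hw := Hphi_H1 n0 oO bO hT Sw; have Hp := Hphi_H1 n0 oO bO hT Spsi.
apply: le_trans (L2ip_le oO bO (L2op opg Sphi) (L2tX Sw Spsi)) _.
have h1 : L2norm Omega (wgrad Omega phi) <= nX phi.
  by rewrite -(Hphi_norm n0 oO bO hT Sphi); exact: H1semi_le_H1.
have h2 : L2norm Omega (fun x => tens (psi x) (w x)) <= c * nX psi * nX w.
  rewrite -(Hphi_norm n0 oO bO hT Spsi) -(Hphi_norm n0 oO bO hT Sw).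
  exact: (L2norm_tens oO bO Ec Hp (bnd Spsi) Hw (bnd Sw)).
apply: le_trans (ler_pM (L2norm_ge0 _ _) (L2norm_ge0 _ _) h1 h2) _.
move: (nX phi) (nX psi) (nX w) => a b d.
by rewrite le_eqVlt; apply/orP; left; apply/eqP; ring.
Qed.

End lower_order_forms.

(** * A priori bounds as real inequalities, and the conclusion *)

Section scalar_estimates.
Context {R : realType}.

Lemma le_div_of_sqr_le (a b x : R) : 0 < a -> 0 <= b -> 0 <= x ->
  a * x ^+ 2 <= b * x -> x <= b / a.
Proof.
move=> a0 b0 x0 H; have [->|xn0] := eqVneq x 0; first by rewrite divr_ge0 // ltW.
have xp : 0 < x by rewrite lt_def xn0.
by rewrite ler_pdivlMr // mulrC -(ler_pM2r xp) -mulrA -expr2.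
Qed.

(** Here a is the norm of xi, and u and p are the scaled norms of velocity and temperature, at most
    r. In the equation tested with xi, half of al a^2 absorbs B, and one factor a is divided out. *)
Lemma energy_bound (al be fF r a u p A B F : R) : 0 < al -> 0 <= be -> 0 <= fF ->
  0 < r -> 0 <= a -> be * r <= al / 2 -> u <= r -> p <= r ->
  al * a ^+ 2 <= A -> A + B = F -> `|B| <= be * u * a * a -> `|F| <= fF * p * a ->
  a <= fF * r / (al / 2).
Proof.
move=> al0 be0 fF0 r0 a0 ber ur pr hA E.
rewrite ler_norml => /andP[hB _]; rewrite ler_norml => /andP[_ hF].
apply: le_div_of_sqr_le => //; [exact: divr_gt0|by rewrite mulr_ge0 // ltW|].
have h5 : fF * p * a <= fF * r * a by rewrite ler_wpM2r // ler_wpM2l.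
have h6 : be * u * a * a <= al / 2 * a ^+ 2.
  rewrite -[leLHS]mulrA -expr2 ler_wpM2r ?sqr_ge0 //; apply: le_trans ber.
  by rewrite ler_wpM2l.
lra.
Qed.

(** Here p1 is the norm of phi - E and e that of E, while su and sp are scaled norms. The second
    equation is tested with phi - E; estimating one scaled factor by u and the other by r gives the
    term r u. *)
Lemma lifting_bound (alt c kC r su sp u p1 e C CE G : R) : 0 < alt -> 0 <= c ->
  0 <= kC -> 0 <= e -> 0 <= p1 -> 0 < r -> 0 <= su -> su <= u -> 0 <= sp -> sp <= r ->
  alt * p1 ^+ 2 <= C -> CE + C = G -> `|CE| <= kC * e * p1 ->
  `|G| <= c * su * sp * p1 -> p1 <= (c * (r * u) + kC * e) / alt.
Proof.
move=> alt0 c0 kC0 e0 p10 r0 su0 suu sp0 spr hC E.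
rewrite ler_norml => /andP[hE _]; rewrite ler_norml => /andP[_ hG].
have u0 : 0 <= u by exact: le_trans suu.
apply: le_div_of_sqr_le => //; first by rewrite addr_ge0 // !mulr_ge0 // ltW.
have h5 : c * su * sp * p1 <= c * (r * u) * p1.
  rewrite ler_wpM2r // -mulrA ler_wpM2l // mulrC; exact: ler_pM.
lra.
Qed.

(** The triangle inequality adds |E|, itself at most ct d. The coefficients of r u and of d are then
    the two entries of the maximum, which explains the form of [CB]. *)
Lemma lifted_norm_bound (alt c kC ct r u p p1 e d : R) : 0 < alt -> 0 <= kC ->
  0 < r -> 0 <= u -> 0 <= d -> p <= e + p1 -> e <= ct * d ->
  p1 <= (c * (r * u) + kC * e) / alt ->
  p <= Num.max (alt^-1 * c) (ct * (alt^-1 * kC + 1)) * (r * u + d).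
Proof.
move=> alt0 kC0 r0 u0 d0 pe ed p1B; set M := Num.max _ _.
have h2 : alt^-1 * c * (r * u) <= M * (r * u).
  by rewrite ler_wpM2r // ?mulr_ge0 ?(ltW r0) // /M le_max lexx.
have h3 : ct * (alt^-1 * kC + 1) * d <= M * d.
  by rewrite ler_wpM2r // /M le_max lexx orbT.
have h4 : (alt^-1 * kC + 1) * e <= (alt^-1 * kC + 1) * (ct * d).
  by rewrite ler_wpM2l // addr_ge0 ?mulr_ge0 // invr_ge0 ltW.
have h5 : (c * (r * u) + kC * e) / alt =
    alt^-1 * c * (r * u) + alt^-1 * kC * e by rewrite mulrDl; ring.
rewrite h5 in p1B; rewrite mulrDr; move: h2 h3 h4 p1B pe.
set X := M * _; set Y := M * _; set Z := alt^-1 * c * _; set q := alt^-1 * kC.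
nra.
Qed.

(** With q the bound on a, one gets u + p <= q + CB (r q + d) = q (1 + r CB) + CB d, the left-hand
    side of the smallness condition. *)
Lemma smallness_bound (CA CB r a u p d g1 g2 : R) : 0 <= CB -> 0 < r -> u <= a ->
  a <= CA * r * g1 * g2 -> p <= CB * (r * u + d) ->
  r * CA * (1 + r * CB) * g1 * g2 + CB * d <= r -> u + p <= r.
Proof.
move=> CB0 r0 ua; set q := CA * r * g1 * g2 => aq pB H; apply: le_trans H.
have -> : r * CA * (1 + r * CB) * g1 * g2 = q + CB * (r * q) by rewrite /q; ring.
have h1 : CB * (r * u) <= CB * (r * q).
  by rewrite ler_wpM2l // ler_pM2l // (le_trans ua).
by rewrite mulrDr in pB; lra.
Qed.

End scalar_estimates.

Theorem theorem4p8
  (R : realType) (n : nat) (hn : n = 2%N \/ n = 3%N)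
  (* domain *)
  (Omega GD GN : set 'rV[R]_n)
  (hOmega : polyhedral Omega) (hGamma : boundary_parts Omega GD GN)
  (* data *)
  (gamma : R) (hgamma : 0 < gamma)
  (alpha g : 'rV[R]_n)
  (K : 'rV[R]_n -> 'M[R]_n) (k0 : R)
  (hK : Linfty Omega K)
  (hKdiag : {ae leb n, forall x, Omega x -> is_diag_mx (K x)})
  (hk0 : 0 < k0)
  (hKpos : {ae leb n, forall x, Omega x ->
     forall y : 'rV[R]_n, k0 * enorm y ^+ 2 <= frob (mxapp (K x) y) y})
  (nu : 'rV[R]_2 -> R) (nu1 nu2 Lnu : R)
  (hnu1 : 0 < nu1) (hnu : forall y, nu1 <= nu y <= nu2)
  (hnuL : forall y z, `|nu y - nu z| <= Lnu * enorm (y - z))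
  (phiD : 'rV[R]_n -> 'rV[R]_n) (hphiD : Hhalf Omega GD phiD)
  (EphiD : 'rV[R]_n -> 'rV[R]_n)
  (hEphiD : is_min_extension Omega GD phiD EphiD)
  (* parameters *)
  (delta1 delta2 delta3 kappa1 kappa2 kappa3 : R)
  (hdelta1 : 0 < delta1 < 1 / nu2)
  (hdelta2 : 0 < delta2 < 2 / gamma)
  (hdelta3 : 0 < delta3 < 1)
  (hkappa3 : 0 < kappa3 < 2 * nu1 * delta1 / nu2)
  (hkappa2 : 0 < kappa2 < 2 * delta2)
  (hkappa1 : 0 < kappa1 < 2 * delta3 * (2 * nu1 - kappa3 * nu2 / delta1))
  (* triangulations and Scott-Zhang operators *)
  (k : nat) (hs : set R) (Th : R -> seq (seq 'rV[R]_n))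
  (hTh : regular_family Omega GD GN hs Th)
  (ISZ : R -> ('rV[R]_n -> 'rV[R]_n) -> 'rV[R]_n -> 'rV[R]_n)
  (hISZ : forall h, hs h -> scott_zhang Omega GD (Th h) k (ISZ h))
  (* constants *)
  (c1 alphaOmega cgp ctilde : R)
  (hc1 : c1%:E = (embnorm Omega ^+ 2)%E)
  (halpha0 : 0 < alphaOmega)
  (halpha : forall (phi : 'rV[R]_n -> 'rV[R]_n) (xi : triple),
     H1 Omega phi -> HH Omega xi ->
     alphaOmega * HHnorm Omega xi ^+ 2 <=
       form_A Omega nu gamma kappa1 kappa2 kappa3 phi xi xi)
  (hcgp0 : 0 < cgp)
  (hcgp : forall psi : 'rV[R]_n -> 'rV[R]_n, H1D Omega GD psi ->
     H1norm Omega psi <= cgp * H1semi Omega psi)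
  (hctilde0 : 0 < ctilde)
  (hctilde : forall h, hs h -> forall v : 'rV[R]_n -> 'rV[R]_n, H1 Omega v ->
     H1norm Omega (ISZ h v) <= ctilde * H1norm Omega v) :
  let r0 := alphaOmega / (2 * c1 * Num.sqrt (2 + kappa3 ^+ 2)) in
  let CA := 2 * Num.sqrt 2 * Num.sqrt (2 + kappa2 ^+ 2) / alphaOmega in
  let alphat := k0 * cgp ^- 2 in
  let CB := Num.max (alphat^-1 * c1)
                    (ctilde * (alphat^-1 * Linftynorm Omega K + 1)) in
  forall r : R, 0 < r < r0 ->
  r * CA * (1 + r * CB) * enorm alpha * enorm g + CB * Hhalfnorm Omega GD phiD
    <= r ->
  forall h, hs h ->
  exists (th sigmah : 'rV[R]_n -> 'M[R]_n) (uh phih : 'rV[R]_n -> 'rV[R]_n),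
    let xih := (th, sigmah, uh) in
    [/\ HHh Omega (Th h) k xih /\ Hphi Omega (Th h) k phih,
        forall x, GD x -> phih x = ISZ h EphiD x,
        (forall etah, HHh Omega (Th h) k etah ->
           form_A Omega nu gamma kappa1 kappa2 kappa3 phih xih etah +
           form_B Omega kappa3 uh xih etah =
           form_F Omega kappa2 alpha g phih etah) /\
        (forall psih, HphiD Omega GD (Th h) k psih ->
           form_C Omega K phih psih = form_G Omega uh phih psih),
        H1norm Omega uh + H1norm Omega phih <= r &
        HHnorm Omega xih <= CA * r * enorm alpha * enorm g /\
        H1norm Omega phih <=
          CB * (r * H1norm Omega uh + Hhalfnorm Omega GD phiD)].
Proof.
move=> r0 CA alphat CB r /andP[rp rr0] hdata h hh.
have n0 : (0 < n)%N by case: hn => ->.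
have [oO _ bO _ _] := hOmega.
have [_ hT _ _] := hTh.1 h hh.
set T := Th h in hT *.
have [[SZc [_ SZ]] _] := hISZ h hh.
have [[HE _] nE] := hEphiD.
have SXE : Hphi Omega T k (ISZ h EphiD) by have [] := SZ EphiD HE.
(* The extension attains the infimum that defines the norm of the boundary datum, so stability of
   the interpolation bounds the lifting by ctilde times that norm. *)
have EnD := hctilde h hh EphiD HE; rewrite nE in EnD.
set E := ISZ h EphiD in SXE EnD *.
set nD := Hhalfnorm Omega GD phiD in nE hdata EnD *.
have nD0 : 0 <= nD by rewrite -nE; exact: sqrtr_ge0.
clearbody E nD.
pose V := (('rV[R]_n -> 'M[R]_n) * ('rV[R]_n -> 'M[R]_n) *
  ('rV[R]_n -> 'rV[R]_n))%type.
pose S1 : V -> Prop := HHh Omega T k.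
have H1s : semi_ip S1 (HHip Omega) := HHip_sip n0 oO bO k hT.
have HXs := Hphi_sip n0 oO bO k hT.
have H2s := HphiD_sip n0 oO bO k hT GD.
have [c10 _] := embnorm_real oO bO hc1.
have /andP[k2p _] := hkappa2; have /andP[k3p _] := hkappa3.
have s30 : 0 < Num.sqrt (2 + kappa3 ^+ 2) by rewrite sqrtr_gt0 addr_gt0 // exprn_gt0.
(* Division by zero gives zero, so c1 = 0 would make r0 = 0 and leave no r in (0, r0). *)
have c1p : 0 < c1.
  rewrite lt_def c10 andbT; apply/eqP => c1Z.
  by move: (lt_trans rp rr0); rewrite /r0 c1Z mulr0 mul0r invr0 mulr0 ltxx.
pose be := c1 * Num.sqrt (2 + kappa3 ^+ 2).
have bep : 0 < be by exact: mulr_gt0.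
(* The radius r0 is exactly the one for which B takes up half of the coercivity of A. *)
have ber : be * r <= alphaOmega / 2.
  have <- : be * r0 = alphaOmega / 2.
    by rewrite /r0 /be; field; rewrite !gt_eqF.
  by rewrite ler_pM2l // ltW.
have alt0 : 0 < alphat by rewrite mulr_gt0 // invr_gt0 exprn_gt0.
have nuB y : `|nu y| <= nu2.
  by have /andP[a b] := hnu y; rewrite gtr0_norm // (lt_le_trans hnu1).
pose fF := enorm alpha * enorm g * Num.sqrt (2 + kappa2 ^+ 2).
have fF0 : 0 <= fF by rewrite !mulr_ge0 ?enorm_ge0 ?sqrtr_ge0.
pose kC := Linftynorm Omega K.
have kC0 : 0 <= kC := Linftynorm_ge0 Omega K.
have S2X psi : HphiD Omega GD T k psi -> Hphi Omega T k psi by case.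
have [m1 dep1] := fdim_dependent (fdim_HHh n0 oO bO k hT).
have [m2 dep2] := fdim_dependent (fdim_Hphi n0 oO bO k hT).
have {}dep1 (f : 'I_m1 -> V) : (forall i, S1 (f i)) -> exists2 c : 'I_m1 -> R,
    exists i, c i != 0 & sipn (HHip Omega) (\sum_i c i *: f i) = 0.
  move=> Sf; have [c c0 Hc] := dep1 f Sf; exists c => //; apply: Hc.
  by apply: (sipS_sum H1s) => i; exact: (sipSZ H1s).
have {}dep2 (f : 'I_m2 -> 'rV[R]_n -> 'rV[R]_n) : (forall i, HphiD Omega GD T k (f i)) ->
    exists2 c : 'I_m2 -> R,
      exists i, c i != 0 & sipn (H1ip Omega) (\sum_i c i *: f i) = 0.
  move=> Sf; have [c c0 Hc] := dep2 f (fun i => S2X _ (Sf i)); exists c => //; apply: Hc.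
  by apply: (sipS_sum HXs) => i; apply: (sipSZ HXs); exact: S2X.
have hphi := @Hphi_norm _ _ n0 _ oO bO _ k hT.
have A_coercive phi (xi : V) : Hphi Omega T k phi -> S1 xi ->
    alphaOmega * sipn (HHip Omega) xi ^+ 2 <=
      form_A Omega nu gamma kappa1 kappa2 kappa3 phi xi xi.
  move=> Sphi Sxi; rewrite -(HHnorm_sipn n0 oO bO hT Sxi).
  apply: halpha; first exact: (Hphi_H1 n0 oO bO hT Sphi).
  exact: (HH_of_HHh n0 oO bO hT Sxi).
(* Positivity of K controls the seminorm, and the Poincare inequality on functions vanishing on GD
   turns k0 into k0 / cgp^2. *)
have C_coercive psi : HphiD Omega GD T k psi ->
    alphat * sipn (H1ip Omega) psi ^+ 2 <= form_C Omega K psi psi.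
  move=> Spsi; have SXpsi := S2X _ Spsi.
  apply: le_trans (form_C_ge n0 oO bO hT hK hKpos SXpsi).
  rewrite /alphat -mulrA; apply: ler_wpM2l; first exact: ltW.
  rewrite -exprVn -exprMn -(hphi _ SXpsi) ler_sqr ?nnegrE ?mulr_ge0 ?sqrtr_ge0 ?invr_ge0 ?(ltW hcgp0) //.
  rewrite mulrC ler_pdivrMr // mulrC; apply: hcgp; exact: (HphiD_H1D n0 oO bO hT Spsi).
have B_le := @form_B_le _ _ n0 _ oO bO _ k hT kappa3 (ltW k3p) c1.
have F_le := @form_F_le _ _ n0 _ oO bO _ k hT kappa2 alpha g (ltW k2p).
have C_le := @form_C_le _ _ n0 _ oO bO _ k hT K hK hKdiag.
have G_le := @form_G_le _ _ n0 _ oO bO _ k hT c1.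
have C_l := @form_C_l _ _ n0 _ oO bO _ k hT K hK.
have [xi [phi1 [s [Sxi Sphi1 [/andP[s0 s1] sr sE] eqA eqC]]]] :=
  truncated_solution H1s HXs H2s S2X dep1 dep2 halpha0 (ltW bep) fF0 alt0 kC0 c10 rp
    ber SXE (pr := snd) (fun _ _ _ => erefl) (@HHh_u _ _ _ _ _)
    (@form_A_linl _ _ n0 _ oO bO _ k hT nu nu2 Lnu gamma kappa1 kappa2 kappa3 nuB hnuL)
    (@form_A_linr _ _ n0 _ oO bO _ k hT nu nu2 Lnu gamma kappa1 kappa2 kappa3 nuB hnuL)
    (@form_A_null _ _ n0 _ oO bO _ k hT nu nu2 Lnu gamma kappa1 kappa2 kappa3 nuB hnuL)
    A_coercive
    (@form_A_lipschitz _ _ n0 _ oO bO _ k hT nu nu2 Lnu gamma kappa1 kappa2 kappa3 nuB hnuL)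
    (@form_B_w _ _ n0 _ oO bO _ k hT kappa3)
    (@form_B_l _ _ n0 _ oO bO _ k hT kappa3)
    (@form_B_r _ _ n0 _ oO bO _ k hT kappa3)
    (fun w xi eta => @B_le w xi eta hc1)
    (@form_F_l _ _ n0 _ oO bO _ k hT kappa2 alpha g)
    (@form_F_r _ _ n0 _ oO bO _ k hT kappa2 alpha g)
    F_le C_l
    (@form_C_r _ _ n0 _ oO bO _ k hT K hK)
    C_le C_coercive
    (@form_G_w _ _ n0 _ oO bO _ k hT)
    (@form_G_phi _ _ n0 _ oO bO _ k hT)
    (@form_G_psi _ _ n0 _ oO bO _ k hT)
    (fun w phi psi => @G_le w phi psi hc1).
have SXphi1 := S2X _ Sphi1.
set phi := E + phi1 in sr sE eqA eqC.
have Sphi : Hphi Omega T k phi by exact: (sipSD HXs).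
have phiE : phi = E + phi1 by [].
clearbody phi.
have Su : Hphi Omega T k xi.2 := HHh_u Sxi.
have Ssu : Hphi Omega T k (s *: xi.2) by exact: (sipSZ HXs).
have Ssphi : Hphi Omega T k (s *: phi) by exact: (sipSZ HXs).
have ua : sipn (H1ip Omega) xi.2 <= sipn (HHip Omega) xi.
  by have [_ _ _] := HHh_le n0 oO bO hT Sxi; rewrite hphi.
have nsu := sipnZ HXs s Su; rewrite (gtr0_norm s0) in nsu.
have nsphi := sipnZ HXs s Sphi; rewrite (gtr0_norm s0) in nsphi.
have hA := A_coercive _ _ Ssphi Sxi; have eqAxi := eqA xi Sxi.
have hB := B_le _ _ _ hc1 Ssu Sxi Sxi; rewrite nsu in hB.
have hF := F_le _ _ Ssphi Sxi; rewrite nsphi in hF.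
have eqC1 := eqC phi1 Sphi1.
(* The test function is phi1, so C(phi, phi1) is split into the coercive C(phi1, phi1) and the datum
   term C(E, phi1). *)
rewrite phiE (linSD (C_l _ SXphi1) SXE SXphi1) -phiE in eqC1.
have hC := C_coercive _ Sphi1; have hCE := C_le _ _ SXE SXphi1.
have hG := G_le _ _ _ hc1 Ssu Ssphi SXphi1; rewrite nsu nsphi in hG.
have pe := sipnD HXs SXE SXphi1; rewrite -phiE in pe.
rewrite (hphi _ SXE) in EnD.
have [a0 u0 p0 p10 e0] : [/\ 0 <= sipn (HHip Omega) xi, 0 <= sipn (H1ip Omega) xi.2,
    0 <= sipn (H1ip Omega) phi, 0 <= sipn (H1ip Omega) phi1 & 0 <= sipn (H1ip Omega) E].
  by split; exact: sipn_ge0.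
have {}hA := energy_bound halpha0 (ltW bep) fF0 rp a0 ber _ _ hA eqAxi hB hF.
have {}hC := lifting_bound alt0 c10 kC0 e0 p10 rp _ _ _ _ hC eqC1 hCE hG.
clear eqAxi hB hF eqC1 hCE hG nsu nsphi.
have HaX : HHnorm Omega xi = sipn (HHip Omega) xi := HHnorm_sipn n0 oO bO hT Sxi.
have HuX := hphi _ Su; have HpX := hphi _ Sphi.
(* Once |u| + |phi| <= r is known, the truncation factor s is 1 and the truncated equations are the
   original ones. *)
suff [upr aCA pB] : [/\ sipn (H1ip Omega) xi.2 + sipn (H1ip Omega) phi <= r,
    sipn (HHip Omega) xi <= CA * r * enorm alpha * enorm g &
    sipn (H1ip Omega) phi <= CB * (r * sipn (H1ip Omega) xi.2 + nD)].
  have s1E : s = 1 by exact: sE.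
  rewrite s1E !scale1r in eqA eqC; rewrite -HuX -HpX in upr pB *; rewrite -HaX in aCA.
  case: xi Sxi eqA eqC upr aCA pB {Su Ssu sr sE ua hA a0 u0 pe hC HaX HuX} =>
    -[t sg] v Sxi eqA eqC upr aCA pB.
  exists t, sg, v, phi; split.
  - by split; [exact: Sxi|exact: Sphi].
  - move=> x Dx; have [_ phi10] := Sphi1.
    by rewrite phiE -[LHS]/(E x + phi1 x) (phi10 x Dx) addr0.
  - by split; [exact: eqA|exact: eqC].
  - exact: upr.
  - by split; [exact: aCA|exact: pB].
move: sr ua EnD a0 u0 p0 p10 e0 pe hA hC; rewrite -/kC; clear - s0 s1 rp hdata halpha0 alt0 kC0 nD0 c10.
(* From here on the norms are arbitrary nonnegative reals, related only by the estimates collected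
   so far. *)
move: (sipn (HHip Omega) xi) (sipn (H1ip Omega) xi.2) (sipn (H1ip Omega) phi)
  (sipn (H1ip Omega) phi1) (sipn (H1ip Omega) E) => a u p p1 e.
move=> sr ua ed a0 u0 p0 p10 e0 pe hA hC.
have spr : s * p <= r.
  by apply: le_trans sr; apply: ler_wpM2l; [exact: ltW|rewrite lerDr].
have sur : s * u <= r.
  by apply: le_trans sr; apply: ler_wpM2l; [exact: ltW|rewrite lerDl].
have suu : s * u <= u by exact: ler_piMl.
have su0 : 0 <= s * u by apply: mulr_ge0 => //; exact: ltW.
have sp0 : 0 <= s * p by apply: mulr_ge0 => //; exact: ltW.
have pB : p <= CB * (r * u + nD).
  exact: (lifted_norm_bound alt0 kC0 rp u0 nD0 pe ed (hC u su0 suu sp0 spr)).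
have CB0 : 0 <= CB by rewrite /CB le_max mulr_ge0 // invr_ge0 ltW.
have aCA : a <= CA * r * enorm alpha * enorm g.
  apply: le_trans (hA sur spr) _; rewrite /fF /CA.
  (* The energy estimate gives the constant 2 sqrt(2 + kappa2^2) / alpha(Omega); the extra factor
     sqrt 2 of [CA] only enlarges it. *)
  have q2 : 1 <= Num.sqrt (2 : R) by rewrite -[leLHS]sqrtr1 ler_wsqrtr // ler1n.
  set q := Num.sqrt 2 in q2 *; set w := Num.sqrt _.
  have -> : enorm alpha * enorm g * w * r / (alphaOmega / 2) =
      (2 * w / alphaOmega * r * enorm alpha * enorm g) * 1.
    by field; rewrite gt_eqF.
  have -> : 2 * q * w / alphaOmega * r * enorm alpha * enorm g =
      (2 * w / alphaOmega * r * enorm alpha * enorm g) * q by ring.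
  by rewrite ler_wpM2l // !mulr_ge0 ?enorm_ge0 ?sqrtr_ge0 ?invr_ge0 // ltW.
by split; [exact: (smallness_bound CB0 rp ua aCA pB hdata)|exact: aCA|exact: pB].
Qed.
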